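(* Let $\Lambda_0\subset\mathbb{R}^d$ be an aperiodic and repetitive Delone set of finite local complexity with pattern space $\Omega$, and assume that the action of $\mathbb{R}^d$ on $\Omega$ by translations is uniquely ergodic with unique invariant probability measure $\mu$. Let $(P_t)_{t>0}$ be the heat semigroup on $L^2(\Omega,\mu)$, $\mathcal{L}$ its generator and $U_{\vec t}$, $\vec t\in\mathbb{R}^d$, the Koopman operators on $L^2(\Omega,\mu)$. Then: (1) zero is a simple eigenvalue (with the constant eigenfunction) of the Laplacian $\mathcal{L}$, and one is a simple eigenvalue (with the constant eigenfunction) of the heat semigroup $P_t$; (2) if the spectrum of the family of the Koopman operators $U_{\vec t}$ consists of eigenvalues of finite multiplicity, then the spectra of $P_t$ and $\mathcal{L}$ are pure point; (3) if the family of the Koopman operators $U_{\vec t}$ has no nonzero eigenvalues, then $\mathcal{L}$ does not have nonzero eigenvalues of finite multiplicity.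
   Context: Delone sets. $\Lambda\subset\mathbb{R}^d$ is a Delone set if it is uniformly discrete (there is $\varepsilon>0$ with $|\vec x-\vec y|>\varepsilon$ for all distinct $\vec x,\vec y\in\Lambda$) and relatively dense (there is $R>0$ with $\Lambda\cap B_R(\vec x)\ne\varnothing$ for all $\vec x\in\mathbb{R}^d$). A cluster is a finite subset of $\Lambda$. $\Lambda$ has finite local complexity if for every $R>0$ there are finitely many clusters $P_1,\dots,P_n$ such that for each $\vec x\in\mathbb{R}^d$ the set $B_R(\vec x)\cap\Lambda$ is a translate of some $P_i$. It is aperiodic if $\Lambda-\vec t=\Lambda$ implies $\vec t=\vec 0$. It is repetitive if for every cluster $P\subset\Lambda$ there is $R_P>0$ such that for every $\vec x\in\mathbb{R}^d$ the set $B_{R_P}(\vec x)\cap\Lambda$ contains a translate of $P$. Pattern space. Write $\varphi_{\vec t}(\Lambda)=\Lambda-\vec t$. Put $\varrho(\Lambda_1,\Lambda_2)=\min\{\bar\varrho(\Lambda_1,\Lambda_2),2^{-1/2}\}$, where $\bar\varrho(\Lambda_1,\Lambda_2)$ is the infimum of all $\varepsilon>0$ such that there exist $\vec s,\vec t\in B_\varepsilon(\vec 0)$ with $B_{1/\varepsilon}(\vec 0)\cap\varphi_{\vec s}(\Lambda_1)=B_{1/\varepsilon}(\vec 0)\cap\varphi_{\vec t}(\Lambda_2)$. The pattern space $\Omega$ of $\Lambda_0$ is the closure of $\{\varphi_{\vec t}(\Lambda_0):\vec t\in\mathbb{R}^d\}$ with respect to the metric $\varrho$; it is a compact metric space of Delone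 sets on which $\mathbb{R}^d$ acts continuously by $\varphi$. Unique ergodicity means there is exactly one Borel probability measure $\mu$ on $\Omega$ invariant under all $\varphi_{\vec t}$. Operators (complex $L^2$). For $t>0$ and $f\in C(\Omega)$, $T_tf(\Lambda)=\int_{\mathbb{R}^d}(2\pi t)^{-d/2}e^{-\|\vec s\|^2/(2t)}f(\varphi_{\vec s}(\Lambda))\,d\vec s$; $(P_t)_{t>0}$ is its unique extension to a strongly continuous semigroup of self-adjoint contractions on $L^2(\Omega,\mu)$, and $\mathcal{L}$ is the (self-adjoint) generator of $(P_t)_{t>0}$. $U_{\vec t}f=f\circ\varphi_{\vec t}$ is unitary on $L^2(\Omega,\mu)$. An eigenfunction of the family $(U_{\vec t})_{\vec t\in\mathbb{R}^d}$ with eigenvalue $\vec\alpha\in\mathbb{R}^d$ is a nonzero $f\in L^2(\Omega,\mu)$ with $U_{\vec t}f=e^{2\pi i\langle\vec t,\vec\alpha\rangle}f$ for all $\vec t\in\mathbb{R}^d$; the multiplicity of $\vec\alpha$ is the dimension of the space of its eigenfunctions (with $0$). The spectrum of the family is the support of the projection-valued measure $E$ on $\mathbb{R}^d$ with $U_{\vec t}=\int_{\mathbb{R}^d}e^{2\pi i\langle\vec t,\vec\alpha\rangle}\,dE(\vec\alpha)$. A self-adjoint operator has pure point spectrum if $L^2(\Omega,\mu)$ has an orthonormal basis of its eigenfunctions. *)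

(* Defs.v *)
From HB Require Import structures.
From mathcomp Require Import all_boot all_order all_algebra.
From mathcomp Require Import complex ring lra.
From mathcomp Require Import all_classical all_reals all_analysis.

Set Implicit Arguments.
Unset Strict Implicit.
Unset Printing Implicit Defensive.

Import Order.TTheory GRing.Theory Num.Theory numFieldNormedType.Exports.

Local Open Scope classical_set_scope.
Local Open Scope ring_scope.

Section euclidean.
Context {R : realType} {d : nat}.
Implicit Types u v x y : 'rV[R]_d.

Definition dotp u v : R := \sum_i u 0 i * v 0 i.

(* The norm carried by ['rV[R]_d] in the library is the sup norm. *)
Definition enorm u : R := Num.sqrt (dotp u u).

(* Balls are open. *)
Definition eball x (r : R) : set 'rV[R]_d := [set y | enorm (y - x) < r].

Lemma dotp_ge0 u : 0 <= dotp u u.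
Proof. by apply: sumr_ge0 => i _; rewrite -expr2 sqr_ge0. Qed.

Lemma enorm_ge0 u : 0 <= enorm u. Proof. exact: sqrtr_ge0. Qed.

Lemma enorm0 : enorm 0 = 0.
Proof. by rewrite /enorm /dotp big1 ?sqrtr0// => i _; rewrite mxE mul0r. Qed.

Lemma enormN u : enorm (- u) = enorm u.
Proof. by congr Num.sqrt; apply: eq_bigr => i _; rewrite !mxE mulrNN. Qed.

Lemma enorm_eq0 u : enorm u = 0 -> u = 0.
Proof.
move=> /eqP; rewrite sqrtr_eq0 => u0; apply/rowP => i; rewrite mxE.
have /eqP : dotp u u = 0 by apply/eqP; rewrite eq_le u0 dotp_ge0.
rewrite psumr_eq0; last by move=> j _; rewrite -expr2 sqr_ge0.
by move=> /allP /(_ i (mem_index_enum _)) /=; rewrite mulf_eq0 orbb => /eqP.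
Qed.

Lemma dotp_scale u v (a b : R) :
  dotp (a *: u - b *: v) (a *: u - b *: v) =
  a ^+ 2 * dotp u u - 2 * a * b * dotp u v + b ^+ 2 * dotp v v.
Proof.
rewrite /dotp !mulr_sumr -sumrB -big_split/=; apply: eq_bigr => i _.
by rewrite !mxE; ring.
Qed.

Lemma dotp_le u v : dotp u v <= enorm u * enorm v.
Proof.
have [/enorm_eq0 ->|u0] := eqVneq (enorm u) 0.
  by rewrite enorm0 mul0r /dotp big1// => i _; rewrite mxE mul0r.
have [/enorm_eq0 ->|v0] := eqVneq (enorm v) 0.
  by rewrite enorm0 mulr0 /dotp big1// => i _; rewrite mxE mulr0.
have pu : 0 < enorm u by rewrite lt_neqAle eq_sym u0 enorm_ge0.
have pv : 0 < enorm v by rewrite lt_neqAle eq_sym v0 enorm_ge0.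
have := dotp_ge0 (enorm v *: u - enorm u *: v).
rewrite dotp_scale.
have := sqr_sqrtr (dotp_ge0 u); have := sqr_sqrtr (dotp_ge0 v).
rewrite -!/(enorm _) => <- <- h.
have uv0 : 0 < enorm u * enorm v by rewrite mulr_gt0.
rewrite -(ler_pM2l uv0); lra.
Qed.

Lemma ler_enormD u v : enorm (u + v) <= enorm u + enorm v.
Proof.
rewrite -(@ler_sqr _ (enorm (u + v))) ?nnegrE ?addr_ge0 ?enorm_ge0//.
rewrite sqr_sqrtr ?dotp_ge0//.
have -> : u + v = 1 *: u - (-1) *: v by rewrite scale1r scaleN1r opprK.
rewrite dotp_scale.
have := sqr_sqrtr (dotp_ge0 u); have := sqr_sqrtr (dotp_ge0 v).
rewrite -!/(enorm _) => <- <-.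
by have := dotp_le u v; lra.
Qed.

Lemma eball0 x r : eball 0 r x = (enorm x < r) :> Prop.
Proof. by rewrite /eball/= subr0. Qed.

End euclidean.

Section delone.
Context {R : realType} {d : nat}.
Implicit Types L P : set 'rV[R]_d.

Definition uniformly_discrete L := exists2 e : R, 0 < e &
  forall x y, L x -> L y -> x != y -> e < enorm (x - y).

Definition relatively_dense L := exists2 r : R, 0 < r &
  forall x, L `&` eball x r !=set0.

Definition is_delone L := uniformly_discrete L /\ relatively_dense L.

(* [translate t L] is the set $L - t$. *)
Definition translate (t : 'rV[R]_d) L : set 'rV[R]_d := [set x | L (x + t)].

Definition is_cluster L P := finite_set P /\ P `<=` L.

Definition finite_local_complexity L := forall r : R, 0 < r ->
  exists Ps : set (set 'rV[R]_d), [/\ finite_set Ps, Ps `<=` is_cluster L &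
    forall x, exists2 P, Ps P & exists t, eball x r `&` L = translate t P].

Definition aperiodic L := forall t, translate t L = L -> t = 0.

Definition repetitive L := forall P, is_cluster L P ->
  exists2 r : R, 0 < r & forall x, exists t, translate t P `<=` eball x r `&` L.

Lemma is_delone_translate t L : is_delone L -> is_delone (translate t L).
Proof.
move=> [[e e0 ud] [r r0 rd]]; split.
  exists e => // x y Lx Ly xy.
  have := ud _ _ Lx Ly; rewrite (inj_eq (addIr t)) => /(_ xy).
  by rewrite opprD addrACA subrr addr0.
exists r => // x; have [y [Ly xy]] := rd (x + t).
exists (y - t); split; first by rewrite /translate/= subrK.
by rewrite /eball/= addrAC -addrA -opprD.
Qed.

End delone.

Section pattern_metric.
Context {R : realType} {d : nat}.

Record delone := Delone {
  delone_set :> set 'rV[R]_d;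
  deloneP : is_delone delone_set }.

HB.instance Definition _ := gen_eqMixin delone.
HB.instance Definition _ := gen_choiceMixin delone.

Implicit Types L : delone.

Lemma delone_inj L1 L2 : delone_set L1 = delone_set L2 -> L1 = L2.
Proof.
case: L1 L2 => [A hA] [B hB] /= AB; rewrite {}AB in hA *.
by congr Delone; exact: Prop_irrelevance.
Qed.

Definition delone_translate t L := Delone (is_delone_translate t (deloneP L)).

Definition rho_close L1 L2 (e : R) := 0 < e /\ exists s t,
  [/\ eball 0 e s, eball 0 e t &
   eball 0 e^-1 `&` translate s L1 = eball 0 e^-1 `&` translate t L2].

Definition rhobar L1 L2 : R := inf [set e | rho_close L1 L2 e].

Definition rho L1 L2 : R := Num.min (rhobar L1 L2) (Num.sqrt 2)^-1.

Lemma rho_closeP L1 L2 e : rho_close L1 L2 e <-> 0 < e /\ exists s t,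
  [/\ enorm s < e, enorm t < e &
   forall x, enorm x < e^-1 -> delone_set L1 (x + s) <-> delone_set L2 (x + t)].
Proof.
rewrite /rho_close; split=> -[e0 [s [t []]]].
  rewrite !eball0 => se te /seteqP[h1 h2]; split=> //; exists s, t; split=> // x xe.
  split=> h; first by apply: (h1 x _).2; split=> //; rewrite eball0.
  by apply: (h2 x _).2; split=> //; rewrite eball0.
move=> se te h; split=> //; exists s, t; rewrite !eball0; split=> //.
by apply/seteqP; split=> x [] xe /= /h hx; split => //; apply: hx; rewrite -eball0.
Qed.

Let rho_close_has_inf L1 L2 : has_inf [set e | rho_close L1 L2 e].
Proof.
split; last by exists 0 => e /= [/ltW].
case: (deloneP L1) => -[a a0 ud1] [r1 r10 rd1].
case: (deloneP L2) => -[b b0 ud2] [r2 r20 rd2].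
have [p [Lp _]] := rd1 0; have [q [Lq _]] := rd2 0.
have aV0 : 0 < a^-1 by rewrite invr_gt0.
have bV0 : 0 < b^-1 by rewrite invr_gt0.
pose e := enorm p + enorm q + (a^-1 + b^-1).
have pe : enorm p < e by have := enorm_ge0 q; rewrite /e; lra.
have qe : enorm q < e by have := enorm_ge0 p; rewrite /e; lra.
have e0 : 0 < e by rewrite (le_lt_trans (enorm_ge0 p)).
have ea : e^-1 <= a.
  rewrite -[leRHS]invrK lef_pV2 ?posrE ?invr_gt0//.
  by have := enorm_ge0 p; have := enorm_ge0 q; rewrite /e; lra.
have eb : e^-1 <= b.
  rewrite -[leRHS]invrK lef_pV2 ?posrE ?invr_gt0//.
  by have := enorm_ge0 p; have := enorm_ge0 q; rewrite /e; lra.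
exists e; apply/rho_closeP; split=> //; exists p, q; split=> // x xe.
have [->|x0] := eqVneq x 0; first by rewrite !add0r.
split=> h.
  have := ud1 _ _ h Lp; rewrite -subr_eq0 addrK => /(_ x0).
  by rewrite ltNge (ltW (lt_le_trans xe ea)).
have := ud2 _ _ h Lq; rewrite -subr_eq0 addrK => /(_ x0).
by rewrite ltNge (ltW (lt_le_trans xe eb)).
Qed.

Let rhobar_lt L1 L2 e : rhobar L1 L2 < e -> exists2 e', rho_close L1 L2 e' & e' < e.
Proof. by move=> /inf_lt -/(_ (rho_close_has_inf L1 L2).1) [e' ? ?]; exists e'. Qed.

Let rhobar_le L1 L2 e : rho_close L1 L2 e -> rhobar L1 L2 <= e.
Proof. by move=> he; apply: ge_inf => //; exact: (rho_close_has_inf L1 L2).2. Qed.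

Let sqrt2V_gt0 : 0 < (Num.sqrt 2 : R)^-1.
Proof. by rewrite invr_gt0 sqrtr_gt0. Qed.

Let sqrt2V_lt1 : (Num.sqrt 2 : R)^-1 < 1.
Proof.
rewrite invf_lt1 ?sqrtr_gt0// -[ltLHS]sqrtr1 ltr_sqrt//; lra.
Qed.

Lemma rho_lt L1 L2 e : rho L1 L2 < e -> e <= (Num.sqrt 2)^-1 ->
  exists2 e', rho_close L1 L2 e' & e' < e.
Proof.
rewrite /rho gt_min => /orP[/rhobar_lt//|h1 h2].
by have := lt_le_trans h1 h2; rewrite ltxx.
Qed.

Lemma rho_le L1 L2 e : rho_close L1 L2 e -> rho L1 L2 <= e.
Proof. by move=> /rhobar_le h; rewrite ge_min h. Qed.

Let rhobar_ge0 L1 L2 : 0 <= rhobar L1 L2.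
Proof.
apply: lb_le_inf; first exact: (rho_close_has_inf L1 L2).1.
by move=> e /= [/ltW].
Qed.

Let rhoxx L : rho L L = 0.
Proof.
apply/eqP; rewrite eq_le; apply/andP; split; last first.
  by rewrite le_min rhobar_ge0 ltW.
apply/ler_addgt0Pl => e e0; rewrite addr0; apply: rho_le.
by apply/rho_closeP; split=> //; exists 0, 0; rewrite enorm0; split.
Qed.

Let rhoC L1 L2 : rho L1 L2 = rho L2 L1.
Proof.
congr (Num.min (inf _) _); apply/seteqP; split=> e /= [e0 [s [t [? ? h]]]];
  by split=> //; exists t, s; split.
Qed.

Lemma rho_close_triangle L1 L2 L3 a b : a + b <= 1 ->
  rho_close L1 L2 a -> rho_close L2 L3 b -> rho_close L1 L3 (a + b).
Proof.
move=> ab1 /rho_closeP[a0 [s [t [sa ta h]]]] /rho_closeP[b0 [s' [t' [sb tb h']]]].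
apply/rho_closeP; split; first by rewrite addr_gt0.
have ab0 : 0 < a + b by rewrite addr_gt0.
have key (x y : R) : 0 < x -> 0 < y -> x + y <= 1 -> (x + y)^-1 + y <= x^-1.
  move=> x0 y0 xy1; have xy0 : 0 < x + y by rewrite addr_gt0.
  rewrite -subr_ge0.
  have -> : x^-1 - ((x + y)^-1 + y) = y * (1 - x * (x + y)) / (x * (x + y)).
    by field; rewrite !gt_eqF.
  rewrite divr_ge0 ?mulr_ge0 ?ltW// subr_gt0.
  have : x * (x + y) <= x * 1 by rewrite ler_pM2l.
  by lra.
exists (s' + s), (t + t'); split.
- by rewrite (le_lt_trans (ler_enormD _ _))// addrC ltrD.
- by rewrite (le_lt_trans (ler_enormD _ _))// ltrD.
- move=> x xab; rewrite !addrA; apply: (iff_trans (h _ _)).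
    rewrite (le_lt_trans (ler_enormD _ _))//.
    by have := key _ _ a0 b0 ab1; lra.
  rewrite (addrAC x s' t); apply: (iff_trans (h' (x + t) _)) => //; rewrite (le_lt_trans (ler_enormD _ _))//.
  by rewrite [a + b]addrC in ab1 xab; have := key _ _ b0 a0 ab1; lra.
Qed.

Let rho_triangle L2 L1 L3 : rho L1 L3 <= rho L1 L2 + rho L2 L3.
Proof.
have r0 A B : 0 <= rho A B by rewrite le_min rhobar_ge0 ltW.
have := r0 L1 L2; have := r0 L2 L3.
set a := rho L1 L2; set b := rho L2 L3 => b0 a0.
have [h|h] := leP (Num.sqrt 2 : R)^-1 (a + b).
  by rewrite (le_trans _ h)// ge_min lexx orbT.
apply/ler_addgt0Pl => e e0.
pose f := Num.min (e / 2) (((Num.sqrt 2)^-1 - (a + b)) / 2).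
have f0 : 0 < f by rewrite lt_min !divr_gt0// subr_gt0.
have fe : f <= e / 2 by rewrite ge_min lexx.
have f2 : f <= ((Num.sqrt 2)^-1 - (a + b)) / 2 by rewrite ge_min lexx orbT.
have /rho_lt[|a' ha' a'a] : rho L1 L2 < a + f by rewrite ltrDl.
  by lra.
have /rho_lt[|b' hb' b'b] : rho L2 L3 < b + f by rewrite ltrDl.
  by lra.
have ab1 : a' + b' <= 1 by have := sqrt2V_lt1; lra.
by have := rho_le (rho_close_triangle ab1 ha' hb'); lra.
Qed.

Let rho_sub L1 L2 x : rho L1 L2 = 0 -> delone_set L1 x -> delone_set L2 x.
Proof.
move=> r0 L1x; case: (deloneP L2) => -[a a0 ud] _.
have near e : 0 < e -> exists2 y, delone_set L2 y & enorm (y - x) < e.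
  move=> e0; pose f := Num.min (e / 2) (Num.min (Num.sqrt 2)^-1 (enorm x + 1)^-1).
  have x1 : 0 < enorm x + 1 by have := enorm_ge0 x; lra.
  have f0 : 0 < f by rewrite !lt_min sqrt2V_gt0 invr_gt0 x1 divr_gt0.
  have /rho_lt[|f'] : rho L1 L2 < f by rewrite r0.
    by rewrite !ge_min lexx orbT.
  move=> /rho_closeP[f'0 [s [t [sf tf h]]]] f'f.
  have f'e : f' < e / 2 by apply: (lt_le_trans f'f); rewrite ge_min lexx.
  have f'1 : f' < 1.
    by apply: (lt_trans f'f); rewrite !gt_min sqrt2V_lt1 orbT.
  have f'x : enorm x + 1 < f'^-1.
    rewrite -[ltLHS]invrK ltf_pV2 ?posrE ?invr_gt0//.
    by apply: (lt_le_trans f'f); rewrite !ge_min lexx !orbT.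
  exists (x - s + t).
    apply/h; last by rewrite subrK.
    rewrite (le_lt_trans (ler_enormD _ _))// enormN.
    by lra.
  have -> : x - s + t - x = t - s by rewrite addrAC [x - s]addrC addrK addrC.
  rewrite (le_lt_trans (ler_enormD _ _))// enormN; lra.
have [y L2y ya] := near (a / 2) ltac:(lra).
suff -> : x = y by [].
apply/eqP; rewrite -subr_eq0; apply/eqP/enorm_eq0/eqP; rewrite eq_le enorm_ge0 andbT.
apply/ler_addgt0Pl => e e0; rewrite addr0.
have [z L2z] := near (Num.min e (a / 2)) ltac:(by rewrite lt_min e0 divr_gt0).
rewrite lt_min => /andP[ze za].
have [yz|yz] := eqVneq z y.
  by rewrite -enormN opprB -yz ltW.
have := ud _ _ L2z L2y yz.
have -> : z - y = (z - x) - (y - x) by rewrite opprB addrA subrK.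
have := ler_enormD (z - x) (- (y - x)); rewrite enormN.
lra.
Qed.

Let rho_eq0 L1 L2 : rho L1 L2 = 0 -> L1 = L2.
Proof.
move=> r0; apply: delone_inj; apply/seteqP; split=> x; first exact: rho_sub.
by apply: rho_sub; rewrite rhoC.
Qed.

HB.instance Definition _ :=
  @isMetric.Build R delone rho rhoxx rho_eq0 rhoC rho_triangle.

Lemma mdistE L1 L2 : mdist L1 L2 = rho L1 L2. Proof. by []. Qed.

End pattern_metric.
Arguments delone : clear implicits.

Lemma delone_translate_continuous (R : realType) (d : nat) t : continuous (@delone_translate R d t).
Proof.
move=> L; apply/(@cvg_ballP R (delone R d) _ _ (nbhs_filter L)) => e e0.
pose f := Num.min (Num.sqrt 2)^-1 (2 / e + enorm t)^-1.
have et : 0 < 2 / e + enorm t by rewrite ltr_wpDr ?enorm_ge0 ?divr_gt0.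
have f0 : 0 < f by rewrite lt_min invr_gt0 sqrtr_gt0 ltr0n invr_gt0.
apply/nbhs_ballP; exists f => // L'; rewrite /= !ballEmdist/= => /rho_lt[|g]; first by rewrite ge_min lexx.
move=> /rho_closeP[g0 [s [s' [sg s'g h]]]] gf.
have gt : 2 / e + enorm t < g^-1.
  rewrite -[ltLHS]invrK ltf_pV2 ?posrE ?invr_gt0//.
  by apply: (lt_le_trans gf); rewrite ge_min lexx orbT.
have ge : g < e / 2.
  rewrite -ltf_pV2 ?posrE ?divr_gt0// invf_div.
  by have := enorm_ge0 t; lra.
apply: (@le_lt_trans _ _ (e / 2)); last by lra.
apply: rho_le; apply/rho_closeP; split; first by rewrite divr_gt0.
exists s, s'; split; [exact: lt_trans ge|exact: lt_trans ge|move=> x].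
rewrite invf_div => xe; rewrite /delone_translate /translate/= !(addrAC _ _ t).
apply: h; rewrite (le_lt_trans (ler_enormD _ _))//; lra.
Qed.



Notation borel T := (g_sigma_algebraType (@open T)).

Section lebesgue_rV.
Context {R : realType}.

Section step.
Local Notation RR := (measurableTypeR R).
Context (n : nat) (m : {sigma_finite_measure set (n.-tuple RR) -> \bar R}).

Let cons_tup (p : RR * n.-tuple RR) : n.+1.-tuple RR := [tuple of p.1 :: p.2].

Let measurable_cons_tup : measurable_fun setT cons_tup.
Proof. exact: (measurable_cons measurable_fst measurable_snd). Qed.

Let mprod : {measure set (RR * n.-tuple RR)%type -> \bar R} :=
  (@lebesgue_measure R \x m)%E.

(* The product of the Lebesgue measure on R with m, carried to tuples. *)
Definition lebesgue_cons : set (n.+1.-tuple RR) -> \bar R :=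
  pushforward (@lebesgue_measure R \x m)%E cons_tup.
HB.instance Definition _ := Measure.copy lebesgue_cons (measure_function_pushforward__canonical__measure_function_Measure mprod measurable_cons_tup).

Let lebesgue_cons_sigma_finite : sigma_finite setT lebesgue_cons.
Proof.
have /sigma_finiteP[F [FT ndF Foo]] := sigma_finiteT (@lebesgue_measure R).
have /sigma_finiteP[G [GT ndG Goo]] := sigma_finiteT m.
pose g (t : n.+1.-tuple RR) : RR * n.-tuple RR := (thead t, [tuple of behead t]).
have mg : measurable_fun setT g.
  apply/measurable_fun_pairP; split; [exact: measurable_tnth|exact: measurable_behead].
have gK : cancel cons_tup g.
  by case=> x t; rewrite /g /cons_tup/= theadE; congr pair; exact/val_inj.
exists (fun k => g @^-1` (F k `*` G k)).
  rewrite -preimage_bigcup (_ : \bigcup_i _ = setT) ?preimage_setT//.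
  rewrite -setXTT FT GT predeqE => -[x y]; split.
    by move=> [n' _ []/= ? ?]; split; exists n'.
  move=> [/= [n' _ Fnx] [k _ Gky]]; exists (maxn n' k) => //; split.
  - by move: x Fnx; exact/subsetPset/ndF/leq_maxl.
  - by move: y Gky; exact/subsetPset/ndG/leq_maxr.
move=> k; have [mF Fk] := Foo k; have [mG Gk] := Goo k.
split.
  by rewrite -[X in measurable X]setTI; apply: mg => //; exact: measurableX.
rewrite /lebesgue_cons /pushforward -comp_preimage.
rewrite (_ : g \o cons_tup = id) ?preimage_id; last by apply/funext => x /=; exact: gK.
by rewrite product_measure1E// lte_mul_pinfty// ge0_fin_numE.
Qed.

HB.instance Definition _ :=
  Measure_isSigmaFinite.Build _ _ _ lebesgue_cons lebesgue_cons_sigma_finite.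

Definition lebesgue_step :
  {sigma_finite_measure set (n.+1.-tuple RR) -> \bar R} := lebesgue_cons.
End step.

Definition lebesgue_tuple0 :
    {sigma_finite_measure set (0.-tuple (measurableTypeR R)) -> \bar R} :=
  dirac [tuple].

Fixpoint lebesgue_tuple n :
    {sigma_finite_measure set (n.-tuple (measurableTypeR R)) -> \bar R} :=
  match n with
  | 0 => lebesgue_tuple0
  | n'.+1 => lebesgue_step (lebesgue_tuple n')
  end.

Definition tuple_rV d (t : d.-tuple (measurableTypeR R)) : borel 'rV[R]_d :=
  \row_i tnth t i.

Lemma measurable_tuple_rV d : measurable_fun setT (@tuple_rV d).
Proof.
apply: (@measurability _ _ _ (borel 'rV[R]_d) setT (@tuple_rV d) (@open 'rV[R]_d)) => //.
move=> _ [U oU <-]; rewrite setTI.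
pose Q (p : 'rV[rat]_d * rat) : 'rV[R]_d := \row_i ratr (p.1 0 i).
pose r (p : 'rV[rat]_d * rat) : R := ratr p.2.
pose B p : set (d.-tuple (measurableTypeR R)) :=
  if `[< 0 < r p /\ ball (Q p) (r p) `<=` U >] then
    \bigcap_(i in [set: 'I_d]) [set t | ball (ratr (p.1 0 i) : R) (r p) (tnth t i)]
  else set0.
rewrite (_ : _ @^-1` U = \bigcup_p B p).
  apply: countable_bigcupT_measurable => // p; rewrite /B; case: ifP => // _.
  apply: fin_bigcap_measurable; first exact: finite_finset.
  move=> i _; rewrite -[X in measurable X]setTI.
  apply: (@measurable_tnth _ (measurableTypeR R)) => //.
  by rewrite ball_itv; exact: measurable_itv.
apply/seteqP; split=> [t Ut|t [p _]]; last first.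
  rewrite /B; case: asboolP => // -[r0 BU] h; apply: BU; split=> // i j.
  by rewrite !mxE; exact: h.
have /nbhs_ballP[e /= e0 eU] := oU _ Ut.
have [a] := rat_in_itvoo (divr_gt0 e0 (ltr0n R 2)).
rewrite in_itv/= => /andP[a0 ae].
have hq i : exists b : rat, ball (ratr b : R) (ratr a) (tnth t i).
  have [|b] := @rat_in_itvoo R (tnth t i - ratr a) (tnth t i + ratr a); first lra.
  rewrite in_itv/= => /andP[b1 b2]; exists b.
  by rewrite /ball/= ltr_norml; apply/andP; split; lra.
have [q hq'] := choice hq.
exists (\row_i q i, a) => //; rewrite /B; case: asboolP.
  by move=> _ i _ /=; rewrite mxE; exact: hq'.
case; rewrite /r/=; split=> // y [_ yq]; apply: eU; split=> // i j.
have /(le_ball (ltW ae)) := yq i j.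
have /(le_ball (ltW ae))/ball_sym := hq' j.
by rewrite !mxE /= ord1 => h1 h2; have := ball_triangle h1 h2; rewrite -splitr.
Qed.


Definition lebesgue_rV d : set (borel 'rV[R]_d) -> \bar R := pushforward (lebesgue_tuple d) (@tuple_rV d).
HB.instance Definition _ d := Measure.copy (@lebesgue_rV d) (measure_function_pushforward__canonical__measure_function_Measure (lebesgue_tuple d) (@measurable_tuple_rV d)).

End lebesgue_rV.


Section complex_functions.
Context {disp : measure_display} {T : measurableType disp} {R : realType}.

(* The integral of a complex function, taken componentwise. The set function
   [mu] need not come with a proof that it is a measure. *)
Definition cintegral (mu : set T -> \bar R) (f : T -> R[i]) : R[i] :=
  (fine (\int[mu]_x (complex.Re (f x))%:E)%E +i*
   fine (\int[mu]_x (complex.Im (f x))%:E)%E)%C.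

Variable mu : {measure set T -> \bar R}.

(* |f|^2 = (Re f)^2 + (Im f)^2, so f is measurable with |f|^2 integrable iff
   both components are in the real L^2. *)
Definition sqr_integrable : {pred (T -> R[i]^o)} :=
  [pred f : T -> R[i]^o | ((fun x => complex.Re (f x)) \in Lfun mu 2%:E) &&
                          ((fun x => complex.Im (f x)) \in Lfun mu 2%:E)].

Lemma sqr_integrable_submod : submod_closed sqr_integrable.
Proof.
have p1 : (1 <= 2%:E :> \bar R)%E by rewrite lee_fin ler1n.
have [L0 LD] := Lfun_submod_closed mu p1.
split; first by rewrite inE /=; apply/andP; split; exact: L0.
move=> a f g; rewrite !inE => /andP[f1 f2] /andP[g1 g2]; apply/andP; split.
- apply: (eq_ind _ (fun h => h \in Lfun mu 2%:E)
    (LD (complex.Re a) _ _ f1 (LD (- complex.Im a) _ _ f2 g1))).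
  apply/funext => x; rewrite /= !fctE.
  case: a (f x) (g x) => [a1 a2] [x1 x2] [y1 y2] /=.
  by rewrite /GRing.scale/= mulNr addrA.
- apply: (eq_ind _ (fun h => h \in Lfun mu 2%:E)
    (LD (complex.Re a) _ _ f2 (LD (complex.Im a) _ _ f1 g2))).
  apply/funext => x; rewrite /= !fctE.
  case: a (f x) (g x) => [a1 a2] [x1 x2] [y1 y2] /=.
  by rewrite /GRing.scale/= addrA.
Qed.

HB.instance Definition _ :=
  GRing.isSubmodClosed.Build R[i] (T -> R[i]^o) sqr_integrable
    sqr_integrable_submod.

Record sqrint := SqrInt {
  sqrint_fun :> T -> R[i]^o;
  sqrintP : sqrint_fun \in sqr_integrable }.

HB.instance Definition _ := [isSub for sqrint_fun].
HB.instance Definition _ := [Choice of sqrint by <:].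
HB.instance Definition _ := [SubChoice_isSubLmodule of sqrint by <:].

(* [L2] is the quotient by almost everywhere equality. *)
Definition null_fun : {pred sqrint} :=
  mem [set f : sqrint | \forall x \ae mu, f x = 0].

Lemma null_fun_submod : submod_closed null_fun.
Proof.
split; first by rewrite inE; apply: aeW.
move=> a f g; rewrite !inE => f0 g0.
by apply: filterS2 f0 g0 => x fx gx; rewrite -[LHS]/(a *: f x + g x) fx gx scaler0 addr0.
Qed.

HB.instance Definition _ :=
  GRing.isSubmodClosed.Build R[i] sqrint null_fun null_fun_submod.

Definition L2 : Type := Quotient.quot null_fun.
HB.instance Definition _ := Choice.on L2.
HB.instance Definition _ := EqQuotient.on L2.
HB.instance Definition _ := GRing.Zmodule.on L2.

Local Open Scope quotient_scope.

Definition L2_scale (a : R[i]) (u : L2) : L2 := \pi_L2 (a *: repr u).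

Lemma pi_L2_scale a f : \pi_L2 (a *: f) = L2_scale a (\pi_L2 f).
Proof.
apply/eqP; rewrite /L2_scale -(Quotient.idealrBE null_fun) -scalerBr.
apply: rpredZ; rewrite (Quotient.idealrBE null_fun).
by apply/eqP/esym/reprK.
Qed.

Let L2_scaleA a b u : L2_scale a (L2_scale b u) = L2_scale (a * b) u.
Proof.
rewrite -[u]reprK; move: (repr u) => f.
by rewrite -(pi_L2_scale b f) -(pi_L2_scale a) -(pi_L2_scale (a * b)) scalerA.
Qed.

Let L2_scale1 : left_id 1 L2_scale.
Proof. by move=> u; rewrite -[u]reprK -pi_L2_scale scale1r. Qed.

Let L2_scaleDr : right_distributive L2_scale +%R.
Proof.
by move=> a u v; rewrite -[u]reprK -[v]reprK -raddfD -!pi_L2_scale -raddfD scalerDr.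
Qed.

Let L2_scaleDl u : {morph L2_scale^~ u : a b / a + b}.
Proof. by move=> a b; rewrite -[u]reprK -!pi_L2_scale -raddfD scalerDl. Qed.

HB.instance Definition _ := GRing.Zmodule_isLmodule.Build R[i] L2
  L2_scaleA L2_scale1 L2_scaleDr L2_scaleDl.

(* The class of [f], and 0 when [f] is not square integrable. *)
Definition L2class (f : T -> R[i]) : L2 := \pi_L2 (insubd (0 : sqrint) f).

Definition L2dot (u v : L2) : R[i] :=
  cintegral mu (fun x => sqrint_fun (repr u) x * (sqrint_fun (repr v) x)^*).

End complex_functions.
Arguments L2 {disp T R} mu.


Section operators.
Context {K : fieldType} {V : lmodType K}.

Definition has_dim (W : set V) (n : nat) := exists b : 'I_n -> V,
  [/\ forall i, W (b i),
      forall c : 'I_n -> K, \sum_i c i *: b i = 0 -> forall i, c i = 0 &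
      forall w, W w -> exists c : 'I_n -> K, w = \sum_i c i *: b i].

Definition finite_dim (W : set V) := exists n, has_dim W n.

(* Operators need not be everywhere defined: [A u v] means that u is in the
   domain of A and A u = v. *)
Definition operator := V -> V -> Prop.

Definition graph_of (A : V -> V) : operator := fun u v => A u = v.

(* The eigenspaces below always contain 0. *)
Definition op_eigenspace (A : operator) (l : K) : set V :=
  [set u | A u (l *: u)].

Definition has_nonzero (W : set V) := exists2 u, u != 0 & W u.

Definition op_eigenvalue (A : operator) (l : K) :=
  has_nonzero (op_eigenspace A l).

Definition simple_op_eigenvalue (A : operator) (l : K) :=
  has_dim (op_eigenspace A l) 1.

End operators.
Arguments operator {K} V.

Section L2_operators.
Context {disp : measure_display} {T : measurableType disp} {R : realType}.
Variable mu : {measure set T -> \bar R}.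
Local Notation H := (L2 mu).

Definition L2norm (u : H) : R := Num.sqrt (complex.Re (L2dot u u)).

Definition orthonormal (B : set H) := forall u v, B u -> B v ->
  L2dot u v = (u == v)%:R.

Definition dense_span (B : set H) := forall u (e : R), 0 < e ->
  exists s : seq (R[i] * H), (forall p, p \in s -> B p.2) /\
    L2norm (u - \sum_(p <- s) p.1 *: p.2) < e.

Definition pure_point_spectrum (A : operator H) := exists B : set H,
  [/\ orthonormal B, dense_span B &
      forall u, B u -> exists l : R[i], op_eigenspace A l u].

Definition contractive (A : H -> H) := forall u, L2norm (A u) <= L2norm u.
Definition self_adjoint (A : H -> H) := forall u v, L2dot (A u) v = L2dot u (A v).

(* P is only constrained at positive times. *)
Definition contraction_semigroup (P : R -> H -> H) :=
  [/\ forall t, 0 < t ->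
        [/\ linear (P t), contractive (P t) & self_adjoint (P t)],
      forall s t u, 0 < s -> 0 < t -> P (s + t) u = P s (P t u) &
      forall u, L2norm (P t u - u) @[t --> 0^'+] --> (0 : R)].

(* The infinitesimal generator: v is the limit of (P_t u - u) / t as t tends
   to 0 from the right. *)
Definition generator (P : R -> H -> H) : operator H := fun u v =>
  L2norm ((t^-1)%:C%C *: (P t u - u) - v) @[t --> 0^'+] --> (0 : R).

End L2_operators.

Section projection_valued.
Context {disp : measure_display} {T : measurableType disp} {R : realType}.
Variable mu : {measure set T -> \bar R}.
Local Notation H := (L2 mu).
Context {d : nat}.
Local Notation Rd := (borel 'rV[R]_d).

Definition projection_valued_measure (E : set Rd -> H -> H) :=
  [/\ forall A, measurable A ->
        [/\ linear (E A), self_adjoint (E A) & E A \o E A = E A],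
      E setT = id &
      forall F : nat -> set Rd, (forall n, measurable (F n)) ->
        trivIset setT F -> forall u,
        L2norm (E (\bigcup_n F n) u - \sum_(0 <= k < n) E (F k) u)
          @[n --> \oo] --> (0 : R)].

Definition spectral_support (E : set Rd -> H -> H) : set 'rV[R]_d :=
  [set a | forall V : set 'rV[R]_d, open_nbhs a V -> exists u, E V u != 0].

(* For a projection E A one has <E A u, u> >= 0. *)
Definition spectral_measure (E : set Rd -> H -> H) (u : H) (A : set Rd) : \bar R :=
  (complex.Re (L2dot (E A u) u))%:E.

Definition expi (x : R) : R[i] := (cos x +i* sin x)%C.

(* The weak form of U_t = \int e^{2 pi i <t, a>} dE(a): by polarization, the
   quadratic forms <U_t u, u> determine U_t. *)
Definition is_spectral_resolution (E : set Rd -> H -> H) (U : 'rV[R]_d -> H -> H) :=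
  projection_valued_measure E /\
  forall t u, L2dot (U t u) u =
    cintegral (spectral_measure E u) (fun a : Rd => expi (2 * pi * dotp t a)).
End projection_valued.

Section pattern_space.
Context {R : realType} {d : nat}.
Variable L0 : delone R d.

(* The closure is taken in the metric space of all Delone sets; for [L0] of
   finite local complexity it is compact. *)
Definition hull : set (delone R d) :=
  closure (range (fun t => delone_translate t L0)).

Definition pattern_space : Type := set_type hull.

HB.instance Definition _ := PseudoMetric.copy pattern_space (set_type hull).

Lemma delone_translateD s t (L : delone R d) :
  delone_translate s (delone_translate t L) = delone_translate (s + t) L.
Proof. by apply: delone_inj; apply/funext => x; rewrite /= /translate/= -addrA. Qed.

Lemma hull_translate t L : L \in hull -> delone_translate t L \in hull.
Proof.
rewrite !inE => hL B /(delone_translate_continuous)/hL [_ [[s _ <-] /= hB]].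
exists (delone_translate t (delone_translate s L0)); split=> //.
by exists (t + s) => //; rewrite delone_translateD.
Qed.

Lemma hull_self : L0 \in hull.
Proof.
rewrite inE; apply: subset_closure; exists 0 => //.
by apply: delone_inj; apply/funext => x; rewrite /= /translate/= addr0.
Qed.

HB.instance Definition _ :=
  isPointed.Build pattern_space (exist _ L0 hull_self).

Definition flow (t : 'rV[R]_d) (x : pattern_space) : pattern_space :=
  exist _ (delone_translate t (val x)) (hull_translate t (valP x)).

Local Notation Omega := (borel pattern_space).

Definition flow_invariant (m : {measure set Omega -> \bar R}) :=
  forall t (A : set Omega), measurable A -> m (flow t @^-1` A) = m A.

Definition uniquely_ergodic (mu : probability Omega R) :=
  flow_invariant mu /\
  forall nu : probability Omega R, flow_invariant nu ->
    forall A : set Omega, measurable A -> nu A = mu A.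

Definition gauss_kernel (t : R) (s : 'rV[R]_d) : R :=
  (2 * pi * t) `^ (- (d%:R / 2)) * expR (- (enorm s ^+ 2 / (2 * t))).

Definition heat_integral (t : R) (f : Omega -> R[i]) (x : Omega) : R[i] :=
  cintegral (@lebesgue_rV R d)
    (fun s => (gauss_kernel t s)%:C%C * f (flow s x)).

Variable mu : probability Omega R.

Definition heat_semigroup (P : R -> L2 mu -> L2 mu) :=
  contraction_semigroup P /\
  forall t (f : pattern_space -> R[i]^o), 0 < t -> continuous f ->
    P t (L2class mu f) = L2class mu (heat_integral t f).

(* When [mu] is invariant, [f \o flow t] is again square integrable and its
   class does not depend on the representative f of u. *)
Definition koopman (t : 'rV[R]_d) (u : L2 mu) : L2 mu :=
  L2class mu (fun x => sqrint_fun (repr u) (flow t x)).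

Definition koopman_eigenspace (a : 'rV[R]_d) : set (L2 mu) :=
  [set u | forall t, koopman t u = expi (2 * pi * dotp t a) *: u].

Definition koopman_eigenvalue (a : 'rV[R]_d) :=
  has_nonzero (koopman_eigenspace a).

End pattern_space.
Arguments koopman {R d L0} mu t u.
Arguments koopman_eigenspace {R d L0} mu a.
Arguments koopman_eigenvalue {R d L0} mu a.

(* Main.v *)
Require Import Defs.
From HB Require Import structures.
From mathcomp Require Import all_boot all_order all_algebra.
From mathcomp Require Import complex ring lra.
From mathcomp Require Import all_classical all_reals all_analysis.
From mathcomp Require Import measurable_realfun.
From mathcomp Require spectral.

Set Implicit Arguments.
Unset Strict Implicit.
Unset Printing Implicit Defensive.

Import Order.TTheory GRing.Theory Num.Theory numFieldNormedType.Exports.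

Local Open Scope classical_set_scope.
Local Open Scope ring_scope.

(** Everything rests on one formula: for all u and v in L2 and t > 0,

      Re <P_t u, v> = \int K_t(s) Re <U_s u, v> ds,

    where K_t is the Gaussian kernel ([heat_weak_formula]). For the class u
    of a continuous function it is Fubini's theorem, and both sides are
    continuous in u; continuous functions are dense because a closed subspace
    that contains the indicators of a generating pi-system is the whole of L2
    ([closed_subspace_full]). Testing against vectors v avoids both
    vector-valued integrals and a choice of measurable representatives.

    The formula says that P_t u is an average of the translates U_s u with
    strictly positive weights of total mass 1, and three facts follow.
    If P_t u = u, then Re <U_s u, u> has mean |u|^2 although it never exceeds
    |u|^2, so that U_s u = u by the equality case of the Cauchy-Schwarz
    inequality ([heat_fixed_koopman_fixed]). The operators P_t and U_s
    commute. A vector orthogonal to all the translates of w is orthogonal to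
    P_t w, so every Koopman eigenvector is an eigenvector of each P_t
    ([koopman_eigenvector_heat]); the eigenvalues form a continuous
    multiplicative semigroup of reals, hence are expR (l * t), and w is an
    eigenvector of the generator.

    Part (1). A vector killed by the generator is fixed by every P_t
    ([generator_zero_fixed]), hence by every U_s; unique ergodicity implies
    ergodicity, since the normalized restriction of mu to an invariant set
    is again an invariant probability, so the fixed vectors are the constants
    ([koopman_invariant_constant]).

    Part (2). Koopman eigenspaces for different eigenvalues are orthogonal
    and L2 is separable ([countable_total]), so the spectrum, which is
    assumed to consist of eigenvalues, is countable. The resolution of the
    identity is then a sum over its points, and E {a} has its range in the
    eigenspace of a. The union of orthonormal bases of these finite
    dimensional eigenspaces is thus a total orthonormal set of Koopman
    eigenvectors, which are eigenvectors of P_t and of the generator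
    ([koopman_eigenbasis]).

    Part (3). A finite dimensional eigenspace of the generator for l <> 0 is
    stable under the commuting operators U_s, so it contains a common
    eigenvector w. Its eigenvalues form a continuous unitary character of the
    translation group, hence s |-> exp (2 i pi <s, a>) for some a
    ([character_rV]). If the only Koopman eigenvalue is 0, then w is fixed by
    every U_s, thus killed by the generator, against l <> 0. *)

(** * Inner products *)

Lemma cvg0_ltP (R : realType) (T : Type) (F : set_system T) {FF : Filter F} (f : T -> R) :
  (forall x, 0 <= f x) ->
  f x @[x --> F] --> (0 : R) <-> (forall e, 0 < e -> \forall x \near F, f x < e).
Proof.
move=> f0; split=> [/cvgrPdist_lt h e e0|h].
  by have := h e e0; apply: filterS => x; rewrite sub0r normrN ger0_norm.
apply/cvgrPdist_lt => e e0; have := h e e0.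
by apply: filterS => x; rewrite sub0r normrN ger0_norm.
Qed.

Section complex_parts.
Context {R : realType}.
Implicit Types z w : R[i].
Local Notation Re := (@complex.Re R).
Local Notation Im := (@complex.Im R).

Lemma complex_ext z w : Re z = Re w -> Im z = Im w -> z = w.
Proof. by case: z w => [a b] [c e] /= -> ->. Qed.
Lemma cReD z w : Re (z + w) = Re z + Re w. Proof. by case: z w => [a b] [c e]. Qed.
Lemma cImD z w : Im (z + w) = Im z + Im w. Proof. by case: z w => [a b] [c e]. Qed.
Lemma cReN z : Re (- z) = - Re z. Proof. by case: z. Qed.
Lemma cReM z w : Re (z * w) = Re z * Re w - Im z * Im w.
Proof. by case: z w => [a b] [c e]. Qed.
Lemma cImM z w : Im (z * w) = Re z * Im w + Im z * Re w.
Proof. by case: z w => [a b] [c e]. Qed.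
Lemma cReJ z : Re z^* = Re z. Proof. by case: z. Qed.
Lemma cImJ z : Im z^* = - Im z. Proof. by case: z. Qed.
Lemma normcRe z : `|z| = (Num.sqrt (Re z ^+ 2 + Im z ^+ 2))%:C%C.
Proof. by rewrite normc_def. Qed.
End complex_parts.

Section inner_product.
Context {R : realType} {H : lmodType R[i]}.
Implicit Types (u v w : H) (a b : R[i]) (r : R).

Record inner_product (dot : H -> H -> R[i]) : Prop := InnerProduct {
  dotPl : forall a u v w, dot (a *: u + v) w = a * dot u w + dot v w;
  dotJ : forall u v, dot v u = (dot u v)^*;
  dot_ge0 : forall u, 0 <= dot u u;
  dot_eq0 : forall u, dot u u = 0 -> u = 0 }.

Variable dot : H -> H -> R[i].
Hypothesis ip : inner_product dot.

(** Its real part determines a sesquilinear form, see [dot_rdot], and keeps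
    the integrals below real. *)
Definition rdot u v : R := complex.Re (dot u v).
Definition nrm u : R := Num.sqrt (complex.Re (dot u u)).

Lemma dotDl u v w : dot (u + v) w = dot u w + dot v w.
Proof. by rewrite -[u in LHS]scale1r (dotPl ip) mul1r. Qed.
Lemma dot0l u : dot 0 u = 0.
Proof. by apply: (addrI (dot 0 u)); rewrite -dotDl !addr0. Qed.
Lemma dotZl a u v : dot (a *: u) v = a * dot u v.
Proof. by rewrite -[a *: u]addr0 (dotPl ip) dot0l addr0. Qed.
Lemma dotNl u v : dot (- u) v = - dot u v.
Proof. by rewrite -scaleN1r dotZl mulN1r. Qed.
Lemma dotBl u v w : dot (u - v) w = dot u w - dot v w.
Proof. by rewrite dotDl dotNl. Qed.
Lemma dotDr u v w : dot u (v + w) = dot u v + dot u w.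
Proof. by rewrite (dotJ ip) dotDl rmorphD /= -!(dotJ ip). Qed.
Lemma dotZr a u v : dot u (a *: v) = a^* * dot u v.
Proof. by rewrite (dotJ ip) dotZl rmorphM /= -(dotJ ip). Qed.
Lemma dot0r u : dot u 0 = 0. Proof. by rewrite (dotJ ip) dot0l rmorph0. Qed.
Lemma dotNr u v : dot u (- v) = - dot u v.
Proof. by rewrite (dotJ ip) dotNl rmorphN /= -(dotJ ip). Qed.
Lemma dot_suml I (s : seq I) (F : I -> H) u :
  dot (\sum_(i <- s) F i) u = \sum_(i <- s) dot (F i) u.
Proof.
elim: s => [|i s ih]; first by rewrite !big_nil dot0l.
by rewrite !big_cons dotDl ih.
Qed.

Lemma rdotC u v : rdot u v = rdot v u.
Proof. by rewrite /rdot (dotJ ip) cReJ. Qed.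
Lemma rdotDl u v w : rdot (u + v) w = rdot u w + rdot v w.
Proof. by rewrite /rdot dotDl cReD. Qed.
Lemma rdotNl u v : rdot (- u) v = - rdot u v.
Proof. by rewrite /rdot dotNl cReN. Qed.
Lemma rdotBl u v w : rdot (u - v) w = rdot u w - rdot v w.
Proof. by rewrite rdotDl rdotNl. Qed.
Lemma rdotDr u v w : rdot u (v + w) = rdot u v + rdot u w.
Proof. by rewrite rdotC rdotDl -!(rdotC u). Qed.
Lemma rdotNr u v : rdot u (- v) = - rdot u v.
Proof. by rewrite rdotC rdotNl -(rdotC u). Qed.
Lemma rdotBr u v w : rdot u (v - w) = rdot u v - rdot u w.
Proof. by rewrite rdotDr rdotNr. Qed.
Lemma rdotZl r u v : rdot (r%:C%C *: u) v = r * rdot u v.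
Proof. by rewrite /rdot dotZl cReM /= mul0r subr0. Qed.
Lemma rdotZr r u v : rdot u (r%:C%C *: v) = r * rdot u v.
Proof. by rewrite rdotC rdotZl rdotC. Qed.
Lemma rdotZJ a u v : rdot (a *: u) v = rdot u (a^* *: v).
Proof. by rewrite /rdot dotZl dotZr conjCK. Qed.

Lemma rdot_ext u v : (forall w, rdot u w = rdot v w) -> u = v.
Proof.
move=> uv; apply/eqP; rewrite -subr_eq0; apply/eqP/(dot_eq0 ip)/complex_ext.
  by rewrite -/(rdot (u - v) (u - v)) rdotBl uv subrr.
by have := dot_ge0 ip (u - v); rewrite lecE => /andP[/eqP].
Qed.

Lemma dot_rdot u v : dot u v = (rdot u v +i* rdot u ('i%C *: v))%C.
Proof.
by apply: complex_ext => //=; rewrite /rdot dotZr cReM /=; lra.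
Qed.

Lemma nrm_ge0 u : 0 <= nrm u. Proof. exact: sqrtr_ge0. Qed.
Lemma nrm_sqr u : nrm u ^+ 2 = rdot u u.
Proof.
by rewrite /nrm sqr_sqrtr//; have := dot_ge0 ip u; rewrite lecE => /andP[].
Qed.
Lemma dot_nrm u : dot u u = (nrm u ^+ 2)%:C%C.
Proof.
apply: complex_ext; rewrite nrm_sqr//=.
by have := dot_ge0 ip u; rewrite lecE => /andP[/eqP].
Qed.
Lemma nrm0 : nrm 0 = 0.
Proof. by rewrite /nrm dot0l sqrtr0. Qed.
Lemma nrm_eq0 u : nrm u = 0 -> u = 0.
Proof. by move=> u0; apply: (dot_eq0 ip); rewrite dot_nrm u0 expr0n. Qed.
Lemma nrm_gt0 u : u != 0 -> 0 < nrm u.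
Proof.
move=> u0; rewrite lt_neqAle nrm_ge0 andbT eq_sym.
by apply: contra u0 => /eqP/nrm_eq0->.
Qed.
Lemma nrmN u : nrm (- u) = nrm u.
Proof. by rewrite /nrm dotNl dotNr opprK. Qed.
Lemma nrmBC u v : nrm (u - v) = nrm (v - u).
Proof. by rewrite -nrmN opprB. Qed.
Lemma nrmZ a u : nrm (a *: u) = complex.Re `|a| * nrm u.
Proof.
rewrite /nrm dotZl dotZr mulrA dot_nrm.
have -> : a * a^* = ((complex.Re `|a|) ^+ 2)%:C%C.
  by rewrite -[LHS]sqr_normc normcRe /= -rmorphXn.
rewrite -rmorphM /= sqrtrM ?sqr_ge0// !sqrtr_sqr !ger0_norm ?nrm_ge0//.
by have := normr_ge0 a; rewrite lecE => /andP[].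
Qed.
Lemma nrmZr r u : nrm (r%:C%C *: u) = `|r| * nrm u.
Proof. by rewrite nrmZ normcRe /= expr0n/= addr0 sqrtr_sqr. Qed.

Lemma nrmB_sqr u v : nrm (u - v) ^+ 2 = nrm u ^+ 2 - 2 * rdot u v + nrm v ^+ 2.
Proof.
rewrite !nrm_sqr !(rdotBl, rdotBr) (rdotC v u) mulrDl !mul1r; lra.
Qed.

Lemma rdot_le u v : `|rdot u v| <= nrm u * nrm v.
Proof.
wlog uv : u / 0 <= rdot u v => [hw|].
  have [|/ltW uv] := leP 0 (rdot u v); first exact: hw.
  by rewrite -nrmN -normrN -rdotNl hw// rdotNl oppr_ge0.
rewrite ger0_norm//.
have [/nrm_eq0 ->|u0] := eqVneq (nrm u) 0.
  by rewrite /rdot dot0l nrm0 mul0r.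
have [/nrm_eq0 ->|v0] := eqVneq (nrm v) 0.
  by rewrite /rdot dot0r nrm0 mulr0.
have pu : 0 < nrm u by rewrite lt_neqAle eq_sym u0 nrm_ge0.
have pv : 0 < nrm v by rewrite lt_neqAle eq_sym v0 nrm_ge0.
have := sqr_ge0 (nrm ((nrm v)%:C%C *: u - (nrm u)%:C%C *: v)).
rewrite nrmB_sqr rdotZl rdotZr !nrmZr !ger0_norm ?nrm_ge0// !exprMn => h.
have uv0 : 0 < nrm u * nrm v by rewrite mulr_gt0.
by rewrite -(ler_pM2l uv0); lra.
Qed.

Lemma nrmD u v : nrm (u + v) <= nrm u + nrm v.
Proof.
rewrite -(@ler_sqr _ (nrm (u + v))) ?nnegrE ?addr_ge0 ?nrm_ge0//.
rewrite -[v in leLHS]opprK nrmB_sqr nrmN rdotNr.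
by have := ler_normlW (rdot_le u v); lra.
Qed.

Lemma nrmB_le w u v : nrm (u - v) <= nrm (u - w) + nrm (w - v).
Proof. by rewrite -(subrKA w) nrmD. Qed.

Lemma rdot_cvg (T : Type) (F : set_system T) {FF : Filter F} (u_ : T -> H) u v :
  nrm (u_ x - u) @[x --> F] --> (0 : R) -> rdot (u_ x) v @[x --> F] --> rdot u v.
Proof.
move=> h; apply/cvgrPdist_lt => e e0.
have v1 : 0 < nrm v + 1 by rewrite ltr_wpDl// nrm_ge0.
have hF : \forall x \near F, nrm (u_ x - u) < e / (nrm v + 1).
  exact: (cvg0_ltP (fun x => nrm_ge0 (u_ x - u))).1 h _ (divr_gt0 e0 v1).
apply: filterS hF => x hx; rewrite -rdotBl (le_lt_trans (rdot_le _ _))// nrmBC.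
apply: (@le_lt_trans _ _ (nrm (u_ x - u) * (nrm v + 1))).
  by rewrite ler_wpM2l ?nrm_ge0// lerDl.
by rewrite -ltr_pdivlMr.
Qed.

(** Here |u - v|^2 = |u|^2 - 2 Re <u, v> + |v|^2 <= 0. *)
Lemma cauchy_schwarz_eq u v : nrm u <= nrm v -> rdot u v = nrm v ^+ 2 -> u = v.
Proof.
move=> uv h; apply/eqP; rewrite -subr_eq0; apply/eqP/nrm_eq0/eqP.
rewrite -sqrf_eq0 eq_le sqr_ge0 andbT nrmB_sqr h.
have : nrm u ^+ 2 <= nrm v ^+ 2 by rewrite ler_sqr ?nnegrE ?nrm_ge0.
by lra.
Qed.

End inner_product.

(** * Orthonormal families *)

Section orthonormal_families.
Context {R : realType} {H : lmodType R[i]}.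
Variable dot : H -> H -> R[i].
Hypothesis ip : inner_product dot.

Definition sqn (z : R[i]) : R := complex.Re z ^+ 2 + complex.Im z ^+ 2.

Lemma sqn_gt0 z : z != 0 -> 0 < sqn z.
Proof.
move=> z0; rewrite lt_neqAle addr_ge0 ?sqr_ge0// andbT eq_sym.
apply: contra z0; rewrite paddr_eq0 ?sqr_ge0// !sqrf_eq0.
by move=> /andP[/eqP a /eqP b]; apply/eqP/complex_ext.
Qed.

Lemma bessel (I : eqType) (e : I -> H) (s : seq I) (u : H) : uniq s ->
  {in s &, forall i j, dot (e i) (e j) = (i == j)%:R} ->
  \sum_(i <- s) sqn (dot u (e i)) <= nrm dot u ^+ 2.
Proof.
elim: s u => [|i s ih] u; first by rewrite big_nil sqr_ge0.
move=> /= /andP[is_ us] on; rewrite big_cons.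
pose c := dot u (e i); pose u' := u - c *: e i.
have ei1 : dot (e i) (e i) = 1 by rewrite on ?eqxx ?mem_head.
have -> : nrm dot u ^+ 2 = nrm dot u' ^+ 2 + sqn c.
  have e1 : nrm dot (e i) = 1 by rewrite /nrm ei1 /= sqrtr1.
  rewrite (nrmB_sqr ip) (nrmZ ip) e1 mulr1 /rdot (dotZr ip) cReM cReJ cImJ.
  rewrite normcRe /= (sqr_sqrtr (addr_ge0 (sqr_ge0 _) (sqr_ge0 _))) -/c /sqn; lra.
rewrite addrC lerD2r.
have /ih-/(_ u') : {in s &, forall i j, dot (e i) (e j) = (i == j)%:R}.
  by move=> j k js ks; apply: on; rewrite inE ?js ?ks orbT.
move=> /(_ us); apply: le_trans; rewrite le_eqVlt; apply/orP; left; apply/eqP.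
rewrite !big_seq; apply: eq_bigr => j js.
rewrite (dotBl ip) (dotZl ip) on ?mem_head ?inE ?js ?orbT//.
by case: eqP => [ij|_]; [rewrite ij js in is_|rewrite mulr0 subr0].
Qed.

(** Each vector of a total set has non-negligible components along finitely
    many members of the family, by Bessel, and every member is seen by some
    vector of the total set. *)
Lemma countable_orthonormal (I : choiceType) (S : set I) (e : I -> H)
    (C : set H) : countable C ->
  (forall u, (forall c, C c -> dot u c = 0) -> u = 0) ->
  (forall i j, S i -> S j -> dot (e i) (e j) = (i == j)%:R) -> countable S.
Proof.
move=> cC total on.
pose F c n := [set i | S i /\ n.+1%:R^-1 < sqn (dot c (e i))].
have finF c n : finite_set (F c n).
  apply: contrapT => infF.
  have [k kc] : exists k : nat, nrm dot c ^+ 2 * n.+1%:R < k%:R.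
    exists (Num.bound (nrm dot c ^+ 2 * n.+1%:R)).
    by rewrite archi_boundP// mulr_ge0 ?sqr_ge0.
  have [A AF Ak] := infinite_set_fset k infF.
  have AS i : i \in finmap.enum_fset A -> F c n i by move=> iA; apply: AF.
  have onA : {in finmap.enum_fset A &, forall i j, dot (e i) (e j) = (i == j)%:R}.
    by move=> i j /AS[Si _] /AS[Sj _]; exact: on.
  have := @bessel _ e _ c (finmap.fset_uniq A) onA.
  apply/negP; rewrite -ltNge.
  have : k%:R * n.+1%:R^-1 <= \sum_(i <- finmap.enum_fset A) sqn (dot c (e i)).
    apply: (@le_trans _ _ (\sum_(i <- finmap.enum_fset A) n.+1%:R^-1)).
      by rewrite big_const_seq count_predT iter_addr_0 -[leRHS]mulr_natl ler_wpM2r ?invr_ge0 ?ler_nat.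
    by rewrite !big_seq; apply: ler_sum => i /AS[_ /ltW].
  by apply: lt_le_trans; rewrite ltr_pdivlMr ?ltr0n.
apply: (@sub_countable _ _ _ (\bigcup_(c in C) \bigcup_n F c n)); last first.
  apply: bigcup_countable => // c _; apply: bigcup_countable => // n _.
  exact: finite_set_countable.
apply: subset_card_le => i Si.
have [c Cc ci] : exists2 c, C c & dot c (e i) != 0.
  apply: contrapT => h; have : e i = 0.
    apply: total => c Cc; apply: contrapT => ec; apply: h; exists c => //.
    apply/eqP => ce; apply: ec; by rewrite (dotJ ip) ce rmorph0.
  move=> ei0; have := on _ _ Si Si; rewrite ei0 (dot0l ip) eqxx => /eqP.
  by rewrite eq_sym oner_eq0.
exists c => //; pose n := Num.bound (sqn (dot c (e i)))^-1; exists n => //.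
split=> //; rewrite invf_plt ?posrE ?sqn_gt0//.
have : (sqn (dot c (e i)))^-1 < n%:R.
  by rewrite archi_boundP// invr_ge0 ltW// sqn_gt0.
by move=> /lt_trans -> //; rewrite ltr_nat.
Qed.

Definition submod_set (W : set H) :=
  W 0 /\ forall a u v, W u -> W v -> W (a *: u + v).

Lemma submod_sum (W : set H) (I : eqType) (s : seq I) (c : I -> R[i]) (F : I -> H) :
  submod_set W -> {in s, forall i, W (F i)} -> W (\sum_(i <- s) c i *: F i).
Proof.
move=> [W0 WD]; elim: s => [|i s ih] Fs; first by rewrite big_nil.
rewrite big_cons; apply: WD; first exact/Fs/mem_head.
by apply: ih => j js; apply: Fs; rewrite inE js orbT.
Qed.

Definition orthonormal_seq (s : seq H) :=
  uniq s /\ {in s &, forall u v, dot u v = (u == v)%:R}.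

Lemma dot_sum_orthonormal (s : seq H) (c : H -> R[i]) e : orthonormal_seq s ->
  e \in s -> dot (\sum_(f <- s) c f *: f) e = c e.
Proof.
move=> [us on] es; rewrite (dot_suml ip) (bigD1_seq e)//= (dotZl ip) on// eqxx mulr1.
rewrite big_seq_cond big1 ?addr0// => f /andP[fs fe].
by rewrite (dotZl ip) on// (negbTE fe) mulr0.
Qed.

Lemma gram_schmidt (W : set H) (bs : seq H) : submod_set W ->
  {in bs, forall u, W u} ->
  exists s, [/\ orthonormal_seq s, {in s, forall u, W u} &
    {in bs, forall u, u = \sum_(e <- s) dot u e *: e}].
Proof.
move=> hW; elim: bs => [|x bs ih] Wbs; first by exists [::].
have [|s [os Ws hs]] := ih; first by move=> u ub; apply: Wbs; rewrite inE ub orbT.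
pose p := \sum_(e <- s) dot x e *: e; pose w := x - p.
have [w0|w0] := eqVneq w 0.
  exists s; split=> // u; rewrite inE => /predU1P[->|/hs//].
  by apply/eqP; rewrite -subr_eq0 -/p -/w w0.
have we e : e \in s -> dot w e = 0.
  by move=> es; rewrite (dotBl ip) dot_sum_orthonormal// subrr.
have nw := nrm_gt0 ip w0.
pose f := ((nrm dot w)^-1)%:C%C *: w.
have wf : w = (nrm dot w)%:C%C *: f.
  by rewrite scalerA -rmorphM divff ?gt_eqF// scale1r.
have fe e : e \in s -> dot f e = 0 by move=> es; rewrite (dotZl ip) we// mulr0.
have ef e : e \in s -> dot e f = 0 by move=> es; rewrite (dotJ ip) fe// rmorph0.
have ff : dot f f = 1.
  rewrite (dot_nrm ip) (nrmZr ip) ger0_norm ?invr_ge0 ?nrm_ge0//.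
  by rewrite mulVf ?gt_eqF// expr1n.
have fs : f \notin s.
  by apply/negP => fs; have := fe f fs; rewrite ff => /eqP; rewrite oner_eq0.
exists (f :: s); split.
- split=> [|u v]; first by rewrite /= fs; case: os.
  rewrite !inE => /predU1P[->|us] /predU1P[->|vs].
  + by rewrite ff eqxx.
  + by rewrite fe//; case: eqP => // fv; rewrite fv vs in fs.
  + by rewrite ef//; case: eqP => // fu; rewrite -fu us in fs.
  + by case: os => _; apply.
- move=> u; rewrite inE => /predU1P[->|/Ws//].
  have Ww : W w.
    rewrite /w addrC -scaleN1r; apply: hW.2; last exact/Wbs/mem_head.
    exact: submod_sum.
  by rewrite -[f]addr0; apply: hW.2 => //; exact: hW.1.
- move=> u; rewrite inE => /predU1P[->|ub]; rewrite big_cons.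
    suff -> : dot x f = (nrm dot w)%:C%C by rewrite -wf subrK.
    rewrite -[x in LHS](subrK p) -/w (dotDl ip) {1}wf (dotZl ip) ff mulr1.
    rewrite (dot_suml ip) big_seq big1 ?addr0// => e es.
    by rewrite (dotZl ip) ef// mulr0.
  rewrite {1}(hs _ ub) (_ : dot u f = 0) ?scale0r ?add0r//.
  rewrite (hs _ ub) (dot_suml ip) big_seq big1// => e es.
  by rewrite (dotZl ip) ef// mulr0.
Qed.

Lemma finite_dim_orthonormal (W : set H) : submod_set W -> finite_dim W ->
  exists s, [/\ orthonormal_seq s, {in s, forall u, W u} &
    forall u, W u -> u = \sum_(e <- s) dot u e *: e].
Proof.
move=> hW [n [b [Wb _ span]]].
have [|s [os Ws hs]] := @gram_schmidt W [seq b i | i <- enum 'I_n] hW.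
  by move=> _ /mapP[i _ ->].
exists s; split=> // u /span[c ->].
rewrite (eq_bigr (fun e => \sum_i (c i * dot (b i) e) *: e)); last first.
  move=> e _; rewrite (dot_suml ip) scaler_suml; apply: eq_bigr => i _.
  by rewrite (dotZl ip).
rewrite exchange_big; apply: eq_bigr => i _.
rewrite {1}(hs (b i)) ?map_f ?mem_enum// scaler_sumr.
by apply: eq_bigr => e _; rewrite scalerA.
Qed.

End orthonormal_families.

(** * Common eigenvectors of commuting operators *)

(** Finitely many of the commuting matrices span all of them, so a common
    eigenvector of these is one of the whole family. *)
Lemma common_eigenrow (C : numClosedFieldType) n (I : eqType) (A : I -> 'M[C]_n) :
  (0 < n)%N -> (forall i j, A i *m A j = A j *m A i) ->
  exists2 v : 'rV[C]_n, v != 0 & forall i, exists c, v *m A i = c *: v.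
Proof.
move=> n0 Acomm.
pose P k := `[< exists t : seq I, size t = k /\ free [seq A i | i <- t] >].
have P0 : exists k, P k.
  by exists 0%N; apply/asboolP; exists [::]; rewrite /= nil_free.
have Pub k : P k -> (k <= n * n)%N.
  move=> /asboolP[t [<- ft]]; rewrite -(size_map A) -[(n * n)%N](dim_matrix C n n).
  by rewrite -(eqP ft) -dimvf dimvS// subvf.
case: (ex_maxnP P0 Pub) => k /asboolP[t [tk ft]] kmax.
have [|v v0 /allP vt] := @spectral.common_eigenvector C n [seq A i | i <- t] n0.
  by move=> B D /mapP[i _ ->] /mapP[j _ ->]; exact: Acomm.
exists v => // i.
have : A i \in <<[seq A i | i <- t]>>%VS.
  apply: contraT => Ait; have /kmax : P k.+1.
    by apply/asboolP; exists (i :: t); rewrite /= tk free_cons Ait ft.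
  by rewrite ltnn.
rewrite -(in_tupleE [seq A i | i <- t]) => /coord_span ->.
set B := (X in _ *m X); suff /sub_rVP[c ->] : stablemx v B by exists c.
rewrite /B; elim/big_ind : _ => [|D D'|j _].
- by rewrite mulmx0 sub0mx.
- by rewrite mulmxDr; exact: addmx_sub.
- by rewrite -scalemxAr scalemx_sub// vt// mem_nth.
Qed.

(** In coordinates on the finite dimensional W, where the restrictions of the
    operators are commuting matrices. *)
Lemma common_eigenvector_of_family (C : numClosedFieldType) (V : lmodType C)
    (W : set V) (I : eqType) (U : I -> V -> V) :
  finite_dim W -> has_nonzero W -> (forall i, linear (U i)) ->
  (forall a u v, W u -> W v -> W (a *: u + v)) -> W 0 ->
  (forall i u, W u -> W (U i u)) ->
  (forall i j u, U i (U j u) = U j (U i u)) ->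
  exists2 w, w != 0 /\ W w & forall i, exists c, U i w = c *: w.
Proof.
move=> [n [b [Wb free_b span_b]]] [u u0 Wu] Ulin WD W0 WU Ucomm.
pose phi (v : 'rV[C]_n) := \sum_j v 0 j *: b j.
have phi_inj v : phi v = 0 -> v = 0.
  by move=> /free_b v0; apply/rowP => j; rewrite v0 mxE.
have phiB v w : phi (v - w) = phi v - phi w.
  by rewrite /phi -sumrB; apply: eq_bigr => j _; rewrite !mxE scalerBl.
have Wphi v : W (phi v).
  by rewrite /phi; apply: big_ind => // [x y Wx Wy|j _];
    [rewrite -[x]scale1r; exact: WD|rewrite -[_ *: _]addr0; exact: WD].
have n0 : (0 < n)%N.
  rewrite lt0n; apply/eqP => n0; have [c uc] := span_b _ Wu.
  by move: u0; rewrite uc big1 ?eqxx// => j _; have := ltn_ord j; rewrite {2}n0.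
have hA i : exists A : 'M[C]_n, forall j, U i (b j) = \sum_k A j k *: b k.
  have /choice[c hc] : forall j, exists c : 'I_n -> C, U i (b j) = \sum_k c k *: b k.
    by move=> j; exact/span_b/WU.
  by exists (\matrix_(j, k) c j k) => j; rewrite hc; apply: eq_bigr => k _; rewrite mxE.
have {hA}[A hA] := choice hA.
have Usum i (s : seq 'I_n) (c : 'I_n -> C) (F : 'I_n -> V) :
    U i (\sum_(j <- s) c j *: F j) = \sum_(j <- s) c j *: U i (F j).
  have U0 : U i 0 = 0 by have := Ulin i (-1) 0 0; rewrite scaler0 addr0 scaleN1r addNr.
  by elim: s => [|j s ih]; [rewrite !big_nil|rewrite !big_cons Ulin ih].
have Uphi i v : U i (phi v) = phi (v *m A i).
  rewrite Usum; under eq_bigr do rewrite hA scaler_sumr.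
  rewrite exchange_big; apply: eq_bigr => k _; rewrite !mxE scaler_suml.
  by apply: eq_bigr => j _; rewrite scalerA.
have Acomm i j : A i *m A j = A j *m A i.
  apply/row_matrixP => k; rewrite !rowE !mulmxA.
  by apply/eqP; rewrite -subr_eq0; apply/eqP/phi_inj; rewrite phiB -!Uphi Ucomm subrr.
have [v v0 hv] := common_eigenrow n0 Acomm.
exists (phi v); first by split=> //; apply: contra v0 => /eqP/phi_inj->.
move=> i; have [c vc] := hv i; exists c; rewrite Uphi vc /phi scaler_sumr.
by apply: eq_bigr => j _; rewrite mxE scalerA.
Qed.

(** * Characters and one-parameter semigroups of scalars *)

Section expi_theory.
Context {R : realType}.
Implicit Types x y : R.

Lemma expi0 : expi (0 : R) = 1.
Proof. by rewrite /expi cos0 sin0. Qed.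
Lemma expiD x y : expi (x + y) = expi x * expi y.
Proof.
by apply: complex_ext; rewrite ?(cReM, cImM) /= ?cosD ?sinD//; ring.
Qed.
Lemma expiN x : expi x * expi (- x) = 1.
Proof. by rewrite -expiD subrr expi0. Qed.
Lemma expi_natM n x : expi (n%:R * x) = expi x ^+ n.
Proof.
elim: n => [|n ih]; first by rewrite mul0r expi0.
by rewrite -addn1 natrD mulrDl mul1r expiD ih exprD expr1.
Qed.
Lemma expi_neq0 x : expi x != 0.
Proof.
by apply/eqP => x0; have := expiN x; rewrite x0 mul0r => /eqP; rewrite eq_sym oner_eq0.
Qed.

End expi_theory.

Section characters.
Context {R : realType}.

(** Sequential continuity is what dominated convergence gives for the matrix
    coefficients of the Koopman operators. *)
Definition cts_along_seq (V : topologicalType) (f : V -> R[i]) :=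
  forall (s : nat -> V) x, s n @[n --> \oo] --> x ->
    complex.Re (f (s n)) @[n --> \oo] --> complex.Re (f x) /\
    complex.Im (f (s n)) @[n --> \oo] --> complex.Im (f x).

(** A unit complex number in the right half plane has a unique square root
    there. Since chi is close to 1 near 0, this pins it down at x0 / 2 ^ n
    for all n, hence at the multiples of these points, which are dense. *)
Lemma character1 (chi : R -> R[i]) :
  (forall s t, chi (s + t) = chi s * chi t) ->
  (forall s, complex.Re (chi s) ^+ 2 + complex.Im (chi s) ^+ 2 = 1) ->
  cts_along_seq chi ->
  exists th, forall x, chi x = expi (th * x).
Proof.
move=> chiD chi1 chic.
have chi_neq0 s : chi s != 0.
  by apply/eqP => s0; have := chi1 s; rewrite s0 /= expr0n/= addr0 => /eqP; rewrite eq_sym oner_eq0.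
have chi0 : chi 0 = 1.
  by apply: (mulfI (chi_neq0 0)); rewrite -chiD addr0 mulr1.
have half_cvg (x : R) : x / 2 ^+ n @[n --> \oo] --> 0.
  have -> : (fun n => x / 2 ^+ n) = geometric x (2^-1).
    by apply/funext => n; rewrite /geometric/= exprVn.
  by apply: cvg_geometric; rewrite ger0_norm// invf_lt1//; lra.
(* From x0 = 1 / 2 ^ N on, the halved points stay in the right half plane. *)
have [N hN] : exists N, forall n, 0 < complex.Re (chi (1 / 2 ^+ (N + n))).
  have [+ _] := chic _ _ (half_cvg 1); rewrite chi0 /=.
  move=> /cvgrPdist_lt/(_ 1 ltr01)[N _ hN]; exists N => n.
  by have := hN (N + n)%N (leq_addr _ _); rewrite /= ltr_distlC; lra.
pose x0 : R := 1 / 2 ^+ N.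
have x00 : 0 < x0 by rewrite divr_gt0// exprn_gt0.
have hx n : 0 < complex.Re (chi (x0 / 2 ^+ n)).
  by rewrite /x0 -mulrA -invfM -exprD; exact: hN.
pose y := complex.Im (chi x0); pose z := complex.Re (chi x0).
have z0 : 0 < z by have := hx 0%N; rewrite expr0 divr1.
have zy : z ^+ 2 + y ^+ 2 = 1 by exact: chi1.
have y1 : -1 < y < 1.
  have : 0 < z ^+ 2 by rewrite exprn_gt0.
  move: zy => {}zy z2; have : y ^+ 2 < 1 by lra.
  by move=> y21; apply/andP; split; nra.
have y1' : -1 <= y <= 1 by case/andP: y1 => *; apply/andP; split; exact: ltW.
pose phi := asin y.
have chix0 : chi x0 = expi phi.
  apply: complex_ext; rewrite /= /phi ?asinK ?in_itv//= cos_asin//.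
  by rewrite -zy addrK sqrtr_sqr gtr0_norm.
have phi_lt : - (pi / 2) < phi < pi / 2.
  by case/andP: y1 => ya yb; rewrite asin_gtNpi2 ?asin_ltpi2// ?ya ?yb ?(ltW ya) ?(ltW yb).
(* Halving determines the square up to sign, and the positive real part fixes
   the sign. *)
have dyadic n : chi (x0 / 2 ^+ n) = expi (phi / 2 ^+ n).
  elim: n => [|n ih]; first by rewrite !expr0 !divr1.
  set w := chi _; set v := expi _.
  have hw2 (a : R) : a / 2 ^+ n = a / 2 ^+ n.+1 + a / 2 ^+ n.+1.
    by rewrite exprS invfM; field; rewrite expf_neq0.
  have : w ^+ 2 == v ^+ 2 by rewrite !expr2 -chiD -expiD -!hw2 ih.
  rewrite eqf_sqr => /orP[/eqP//|/eqP wv].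
  have := hx n.+1; rewrite -/w wv cReN /= oppr_gt0 => cneg.
  have cpos : 0 < cos (phi / 2 ^+ n.+1).
    have p1 : 1 <= 2 ^+ n.+1 :> R by rewrite exprn_ege1// ler1n.
    have := @pi_gt0 R; case/andP: phi_lt => pa pb pi0.
    apply: cos_gt0_pihalf; apply/andP; split.
      by rewrite ltr_pdivlMr ?exprn_gt0//; clear -p1 pa pb pi0; nra.
    by rewrite ltr_pdivrMr ?exprn_gt0//; clear -p1 pa pb pi0; nra.
  by have := lt_trans cneg cpos; rewrite ltxx.
pose th := phi / x0; exists th.
have hpos x : 0 <= x -> chi x = expi (th * x).
  move=> xge0; pose k n := Num.truncn (x * 2 ^+ n / x0).
  pose xn n := (k n)%:R * (x0 / 2 ^+ n).
  have chin n : chi (xn n) = expi (th * xn n).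
    rewrite /xn [th * _]mulrCA expi_natM (_ : th * _ = phi / 2 ^+ n); last first.
      by rewrite /th; field; rewrite expf_neq0//= gt_eqF.
    rewrite -dyadic; elim: (k n) => [|m ih]; first by rewrite mul0r chi0.
    by rewrite -addn1 natrD mulrDl mul1r chiD ih exprD expr1.
  have xnx : xn n @[n --> \oo] --> x.
    apply/cvgrPdist_lt => e e0.
    have := half_cvg x0; move=> /cvgrPdist_lt/(_ e e0).
    apply: filterS => n; rewrite sub0r normrN; apply: le_lt_trans.
    have p0 : 0 < x0 / 2 ^+ n by rewrite divr_gt0// exprn_gt0.
    rewrite [leRHS]ger0_norm ?(ltW p0)//.
    have : 0 <= x * 2 ^+ n / x0 by rewrite divr_ge0 ?(ltW x00)// mulr_ge0 ?exprn_ge0.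
    move=> /truncn_itv/andP; rewrite -/(k n) => -[h1 h2].
    have e1 : x = (x * 2 ^+ n / x0) * (x0 / 2 ^+ n).
      by field; rewrite expf_neq0//= gt_eqF.
    have l1 : xn n <= x by rewrite [leRHS]e1 ler_wpM2r// ltW.
    have l2 : x <= xn n + x0 / 2 ^+ n.
      rewrite [leLHS]e1 /xn -[X in _ + X]mul1r -mulrDl ler_wpM2r ?(ltW p0)//.
      by rewrite natr1 ltW.
    by rewrite ger0_norm; lra.
  have thx : th * xn n @[n --> \oo] --> th * x by exact: cvgMr.
  have [hr hi] := chic _ _ xnx.
  apply: complex_ext.
  - have e : (fun n => complex.Re (chi (xn n))) = (fun n => cos (th * xn n)).
      by apply/funext => n; rewrite chin.
    rewrite e in hr; apply: (@cvg_unique _ (@Rhausdorff R) _ _ _ _ hr).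
    exact: (continuous_cvg _ (@continuous_cos R _) thx).
  - have e : (fun n => complex.Im (chi (xn n))) = (fun n => sin (th * xn n)).
      by apply/funext => n; rewrite chin.
    rewrite e in hi; apply: (@cvg_unique _ (@Rhausdorff R) _ _ _ _ hi).
    exact: (continuous_cvg _ (@continuous_sin R _) thx).
move=> x; have [/hpos//|/ltW x_le0] := leP 0 x.
apply: (mulIf (expi_neq0 (th * - x))).
by rewrite -hpos ?oppr_ge0// -chiD subrr chi0 hpos ?oppr_ge0// mulrN expiN.
Qed.

(** Each coordinate axis carries a character of the line. *)
Lemma character_rV d (chi : 'rV[R]_d -> R[i]) :
  (forall s t, chi (s + t) = chi s * chi t) ->
  (forall s, complex.Re (chi s) ^+ 2 + complex.Im (chi s) ^+ 2 = 1) ->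
  cts_along_seq chi ->
  exists a, forall t, chi t = expi (2 * pi * dotp t a).
Proof.
move=> chiD chi1 chic.
have chi0 : chi 0 = 1.
  have chi_neq0 : chi 0 != 0.
    by apply/eqP => s0; have := chi1 0; rewrite s0 /= expr0n/= addr0 => /eqP; rewrite eq_sym oner_eq0.
  by apply: (mulfI chi_neq0); rewrite -chiD addr0 mulr1.
have /choice[th hth] (i : 'I_d) : exists th, forall x, chi (x *: delta_mx 0 i) = expi (th * x).
  apply: character1 => [s t|s|s x sx]; first by rewrite scalerDl chiD.
    exact: chi1.
  apply: chic; exact: cvgZr_tmp.
exists (\row_i (th i / (2 * pi))) => t.
rewrite [t in LHS]row_sum_delta.
have -> : 2 * pi * dotp t (\row_i (th i / (2 * pi))) = \sum_i th i * t 0 i.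
  rewrite /dotp mulr_sumr; apply: eq_bigr => i _; rewrite mxE.
  have : 2 * pi != 0 :> R by rewrite mulf_neq0 ?pnatr_eq0// gt_eqF// pi_gt0.
  by move: (2 * pi) => c c0; field.
elim/big_ind2 : _ => [|x1 x2 y1 y2 h1 h2|i _]; first by rewrite expi0 chi0.
  by rewrite chiD expiD h1 h2.
exact: hth.
Qed.

End characters.

Section scalar_semigroups.
Context {R : realType}.

(** The limit at 0 makes lam positive near 0, hence everywhere by halving. Its
    logarithm is then additive, nonincreasing because lam <= 1, and so
    linear. *)
Lemma scalar_semigroup (lam : R -> R) :
  (forall s t, 0 < s -> 0 < t -> lam (s + t) = lam s * lam t) ->
  (forall t, 0 < t -> lam t <= 1) ->
  lam t @[t --> 0^'+] --> (1 : R) ->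
  exists l, forall t, 0 < t -> lam t = expR (l * t).
Proof.
move=> lamD lam1 lamc.
have lam_pos t : 0 < t -> 0 < lam t.
  move=> t0.
  have hhalf n : lam t = lam (t / 2 ^+ n) ^+ (2 ^ n).
    elim: n => [|n ->]; first by rewrite expr0 divr1.
    rewrite expnS exprM; congr (_ ^+ _); rewrite expr2 -lamD ?divr_gt0 ?exprn_gt0//.
    by congr lam; rewrite exprS; field; rewrite expf_neq0.
  have [n ln] : exists n, 0 < lam (t / 2 ^+ n).
    have [e /= e0 he] := (@cvgrPdist_lt _ _ _ _ _ _ _).1 lamc 1 ltr01.
    have h2 : `|2^-1 : R| < 1 by rewrite ger0_norm// invf_lt1//; lra.
    have := @cvg_geometric R t _ h2.
    move=> /cvgrPdist_lt/(_ e e0)[n _ /(_ n (leqnn n))] /=.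
    rewrite sub0r normrN /geometric/= exprVn => hn; exists n.
    have tn : 0 < t / 2 ^+ n by rewrite divr_gt0// exprn_gt0.
    have := he (t / 2 ^+ n) _ tn; rewrite /= sub0r normrN => /(_ hn).
    by rewrite ltr_distlC; lra.
  by rewrite (hhalf n) exprn_gt0.
pose g t := ln (lam t).
have gD s t : 0 < s -> 0 < t -> g (s + t) = g s + g t.
  by move=> s0 t0; rewrite /g lamD// lnM ?posrE ?lam_pos.
have g_le0 t : 0 < t -> g t <= 0 by move=> t0; rewrite ln_le0// lam1.
have gn n t : 0 < t -> g (n.+1%:R * t) = n.+1%:R * g t.
  move=> t0; elim: n => [|n ih]; first by rewrite !mul1r.
  by rewrite -[n.+2]addn1 natrD !mulrDl gD ?ih ?mul1r// mulr_gt0.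
have g_mono s t : 0 < s -> s <= t -> g t <= g s.
  move=> s0; rewrite le_eqVlt => /predU1P[->//|st].
  by rewrite -(subrK s t) gD ?subr_gt0// gerDr g_le0// subr_gt0.
exists (g 1) => t t0.
suff -> : g 1 * t = g t by rewrite /g lnK// posrE lam_pos.
have g1 := g_le0 1 ltr01.
(* With k the integer part of (n + 1) t, monotonicity puts (n + 1) g t between
   (k + 1) g 1 and k g 1. *)
have bound n : n.+1%:R * `|g 1 * t - g t| <= - g 1.
  have nt0 : 0 < n.+1%:R * t by rewrite mulr_gt0.
  have := truncn_itv (ltW nt0); set k := Num.truncn _ => /andP[h1 h2].
  have u1 : (k.+1%:R) * g 1 <= n.+1%:R * g t.
    by rewrite -!gn// mulr1 g_mono// ltW.
  have u2 : n.+1%:R * g t <= k%:R * g 1.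
    case: k h1 {h2 u1} => [|k] h1; first by rewrite mul0r pmulr_rle0// g_le0.
    by rewrite -!gn// mulr1 g_mono.
  have k1 : k.+1%:R = k%:R + 1 :> R by rewrite -natr1.
  rewrite -[X in X * _]ger0_norm// -normrM ler_norml mulrBr.
  by rewrite k1 in u1 h2; apply/andP; split; nra.
apply/eqP; rewrite -subr_eq0 -normr_le0 leNgt; apply/negP => h.
have := archi_boundP (divr_ge0 (_ : 0 <= - g 1) (ltW h)).
rewrite oppr_ge0 => /(_ g1); rewrite ltr_pdivrMr//.
set m := Num.bound _ => hm; have := bound m; apply/negP; rewrite -ltNge.
by apply: (lt_le_trans hm); rewrite ler_wpM2r// ler_nat.
Qed.

Lemma expR_right_derivative (l : R) :
  (expR (l * t) - 1) / t @[t --> 0^'+] --> l.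
Proof.
have : is_derive (0 : R) (1 : R) (fun t => expR (l * t)) l.
  apply: is_derive_eq; rewrite mulr0 expR0 /GRing.scale/= !mulr1 ?mul1r//.
move=> [hd]; rewrite /derive => hl.
move: hd; rewrite /derivable => /cvg_ex[/= l' hl'].
have ll : l' = l := etrans (esym (cvg_lim (@Rhausdorff R) hl')) hl.
rewrite {}ll in hl'.
rewrite [F in fmap F](_ : _ = fun h : R => h^-1 *: (expR (l * (h%:A + 0)) - expR (l * 0))).
  exact: cvg_dnbhs_at_right.
by apply/funext => t; rewrite mulr0 expR0 addr0 /GRing.scale/= mulr1 mulrC.
Qed.
End scalar_semigroups.

(** * The Hilbert space L2 *)

Section almost_everywhere.
Context {disp : measure_display} {T : measurableType disp} {R : realType}.
Variable mu : {measure set T -> \bar R}.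

Lemma ae_mono (P Q : T -> Prop) : (forall x, P x -> Q x) ->
  (\forall x \ae mu, P x) -> \forall x \ae mu, Q x.
Proof. exact: filterS. Qed.

Lemma ae_mono2 (P1 P2 Q : T -> Prop) : (forall x, P1 x -> P2 x -> Q x) ->
  (\forall x \ae mu, P1 x) -> (\forall x \ae mu, P2 x) -> \forall x \ae mu, Q x.
Proof. exact: filterS2. Qed.

End almost_everywhere.

Section L2_space.
Context {disp : measure_display} {T : measurableType disp} {R : realType}.
Variable mu : {measure set T -> \bar R}.
Implicit Types f g h : T -> R[i].
Local Notation H := (L2 mu).
Local Notation sq := (sqr_integrable mu).

Definition cintegrable f :=
  mu.-integrable setT (EFin \o (fun x => complex.Re (f x))) /\
  mu.-integrable setT (EFin \o (fun x => complex.Im (f x))).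

Definition cmeasurable f :=
  measurable_fun setT (fun x => complex.Re (f x)) /\
  measurable_fun setT (fun x => complex.Im (f x)).

Lemma cintegrable_measurable f : cintegrable f -> cmeasurable f.
Proof.
move=> [h1 h2].
by split; apply/measurable_EFinP; [exact: measurable_int h1|exact: measurable_int h2].
Qed.

Lemma sq_mulJ f g : f \in sq -> g \in sq -> cintegrable (fun x => f x * (g x)^*).
Proof.
rewrite !inE => /andP[f1 f2] /andP[g1 g2]; split.
- have := integrableD measurableT ((Lfun1_integrable _ _).1 (Lfun2_mul_Lfun1 f1 g1))
    ((Lfun1_integrable _ _).1 (Lfun2_mul_Lfun1 f2 g2)).
  apply: eq_integrable => // x _; rewrite /= cReM cReJ cImJ -EFinD; congr EFin; ring.
- have := integrableB measurableT ((Lfun1_integrable _ _).1 (Lfun2_mul_Lfun1 f2 g1))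
    ((Lfun1_integrable _ _).1 (Lfun2_mul_Lfun1 f1 g2)).
  apply: eq_integrable => // x _; rewrite /= cImM cReJ cImJ -EFinB; congr EFin; ring.
Qed.

Lemma integrableZ_EFin k (u : T -> R) : mu.-integrable setT (EFin \o u) ->
  mu.-integrable setT (EFin \o (fun x => k * u x)).
Proof.
move=> iu; apply: eq_integrable (integrableZl measurableT k iu) => // x _.
Qed.

Lemma integrableD_EFin (u v : T -> R) : mu.-integrable setT (EFin \o u) ->
  mu.-integrable setT (EFin \o v) -> mu.-integrable setT (EFin \o (fun x => u x + v x)).
Proof.
move=> iu iv; apply: eq_integrable (integrableD measurableT iu iv) => // x _.
Qed.

Lemma integrableB_EFin (u v : T -> R) : mu.-integrable setT (EFin \o u) ->
  mu.-integrable setT (EFin \o v) -> mu.-integrable setT (EFin \o (fun x => u x - v x)).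
Proof.
move=> iu iv; apply: eq_integrable (integrableB measurableT iu iv) => // x _.
Qed.

Lemma cintegralPl a f g : cintegrable f -> cintegrable g ->
  cintegral mu (fun x => a * f x + g x) = a * cintegral mu f + cintegral mu g.
Proof.
move=> [f1 f2] [g1 g2]; have i1 := integrableZ_EFin (complex.Im a) f1.
have i2 := integrableZ_EFin (complex.Re a) f2.
have i3 := integrableZ_EFin (complex.Im a) f2.
have i4 := integrableZ_EFin (complex.Re a) f1.
apply: complex_ext; rewrite ?(cReD, cImD, cReM, cImM) /=.
- rewrite -[LHS]/(\int[mu]_x complex.Re (a * f x + g x)).
  rewrite (eq_Rintegral _ (g := fun x => (complex.Re a * complex.Re (f x) -
    complex.Im a * complex.Im (f x)) + complex.Re (g x))); last first.
    by move=> x _; rewrite cReD cReM.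
  rewrite RintegralD//; last exact: integrableB_EFin.
  by rewrite RintegralB// !RintegralZl.
- rewrite -[LHS]/(\int[mu]_x complex.Im (a * f x + g x)).
  rewrite (eq_Rintegral _ (g := fun x => (complex.Re a * complex.Im (f x) +
    complex.Im a * complex.Re (f x)) + complex.Im (g x))); last first.
    by move=> x _; rewrite cImD cImM.
  rewrite RintegralD//; last exact: integrableD_EFin.
  by rewrite RintegralD// !RintegralZl.
Qed.

Lemma ae_eq_Rintegral (f g : T -> R) : measurable_fun setT f -> measurable_fun setT g ->
  (\forall x \ae mu, f x = g x) -> \int[mu]_x f x = \int[mu]_x g x.
Proof.
move=> mf mg fg; rewrite /Rintegral; congr fine; apply: ae_eq_integral => //.
- exact/measurable_EFinP.
- exact/measurable_EFinP.
- by apply: filterS fg => x -> .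
Qed.

Lemma ae_eq_cintegral f g : cmeasurable f -> cmeasurable g ->
  (\forall x \ae mu, f x = g x) -> cintegral mu f = cintegral mu g.
Proof.
move=> [f1 f2] [g1 g2] fg; apply: complex_ext => /=; apply: ae_eq_Rintegral => //;
  by apply: filterS fg => x ->.
Qed.

Lemma repr_sq (u : H) : sqrint_fun (repr u) \in sq.
Proof. exact: sqrintP. Qed.

Lemma repr_L2class f : f \in sq -> \forall x \ae mu, sqrint_fun (repr (L2class mu f)) x = f x.
Proof.
move=> sf; pose F : sqrint mu := insubd 0 (f : T -> R[i]^o).
have Ff : sqrint_fun F = f by apply: (insubdK (0 : sqrint mu)).
have : repr (L2class mu f) - F \in @Defs.null_fun _ _ _ mu.
  by rewrite (Quotient.idealrBE (@Defs.null_fun _ _ _ mu)); apply/eqP/reprK.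
rewrite inE /=; apply: filterS => x; rewrite -Ff => /eqP; rewrite subr_eq0.
by move=> /eqP.
Qed.

Lemma eq_L2class f g : f \in sq -> g \in sq -> (\forall x \ae mu, f x = g x) ->
  L2class mu f = L2class mu g.
Proof.
move=> sf sg fg; apply/eqP; rewrite -(Quotient.idealrBE (@Defs.null_fun _ _ _ mu)) inE /=.
apply: filterS fg => x fgx.
have Ff : sqrint_fun (insubd (0 : sqrint mu) (f : T -> R[i]^o)) = f by exact: insubdK.
have Gg : sqrint_fun (insubd (0 : sqrint mu) (g : T -> R[i]^o)) = g by exact: insubdK.
rewrite -[LHS]/(sqrint_fun (insubd (0 : sqrint mu) (f : T -> R[i]^o)) x -
  sqrint_fun (insubd (0 : sqrint mu) (g : T -> R[i]^o)) x).
by rewrite Ff Gg fgx subrr.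
Qed.

Lemma L2class_repr (u : H) : L2class mu (sqrint_fun (repr u)) = u.
Proof.
rewrite /L2class -[RHS]reprK; congr (\pi_(L2 mu) _)%qT; apply/val_inj.
by rewrite /= insubdK// repr_sq.
Qed.

Lemma sq_lin a f g : f \in sq -> g \in sq -> (fun x => a * f x + g x) \in sq.
Proof. by move=> sf sg; exact: (rpredD (rpredZ a sf) sg). Qed.

Lemma L2classP a f g : f \in sq -> g \in sq ->
  L2class mu (fun x => a * f x + g x) = a *: L2class mu f + L2class mu g.
Proof.
move=> sf sg; rewrite /L2class -[a *: _]/(L2_scale a _) -pi_L2_scale -raddfD; congr (\pi_(L2 mu) _)%qT.
by apply/val_inj; rewrite /= !insubdK//; exact: sq_lin.
Qed.

Lemma L2dot_class f g : f \in sq -> g \in sq ->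
  L2dot (L2class mu f) (L2class mu g) = cintegral mu (fun x => f x * (g x)^*).
Proof.
move=> sf sg; apply: ae_eq_cintegral.
- by apply/cintegrable_measurable/sq_mulJ; exact: repr_sq.
- by apply/cintegrable_measurable/sq_mulJ.
- by apply: filterS2 (repr_L2class sf) (repr_L2class sg) => x -> ->.
Qed.

Lemma sq0 : (fun _ : T => 0) \in sq. Proof. by apply: rpred0. Qed.

Lemma L2class0 : L2class mu (fun=> 0) = 0.
Proof.
rewrite /L2class -[RHS](raddf0 (\pi_(L2 mu))%qT); congr (\pi_(L2 mu) _)%qT.
by apply/val_inj; rewrite /= insubdK ?sq0.
Qed.

Lemma L2_inner : inner_product (@L2dot _ _ _ mu).
Proof.
split.
- move=> a u v w; rewrite -[u]L2class_repr -[v]L2class_repr -[w]L2class_repr.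
  set f := sqrint_fun (repr u); set g := sqrint_fun (repr v); set h := sqrint_fun (repr w).
  have sf : f \in sq by exact: repr_sq.
  have sg : g \in sq by exact: repr_sq.
  have sh : h \in sq by exact: repr_sq.
  rewrite -L2classP// !L2dot_class ?sq_lin// -cintegralPl; [|exact: sq_mulJ..].
  by congr cintegral; apply/funext => x; rewrite mulrDl mulrA.
- move=> u v; rewrite /L2dot; have [h1 h2] := sq_mulJ (repr_sq u) (repr_sq v).
  apply: complex_ext; rewrite ?(cReJ, cImJ) /=.
    congr fine; apply: eq_integral => x _.
    by rewrite !cReM !cReJ !cImJ; congr EFin; ring.
  rewrite -[RHS]mulN1r -[RHS]/(-1 * \int[mu]_x _) -RintegralZl//.
  apply: eq_Rintegral => x _.
  by rewrite !cImM !cReJ !cImJ; ring.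
- move=> u; rewrite lecE /L2dot /=; apply/andP; split.
    rewrite [X in X == _](_ : _ = 0)// (eq_integral (cst 0%E)) ?integral0//.
    by move=> x _; rewrite cImM cReJ cImJ; congr EFin; ring.
  apply: Rintegral_ge0 => x _; rewrite cReM cReJ cImJ mulrN opprK.
  by rewrite addr_ge0// -expr2 sqr_ge0.
- move=> u /(congr1 (@complex.Re R)); rewrite /L2dot /= => h.
  have sf := repr_sq u; set f := sqrint_fun (repr u) in sf h *.
  have [i1 _] := sq_mulJ sf sf.
  have : (\int[mu]_x `| (complex.Re (f x * (f x)^*))%:E | = 0)%E.
    under eq_integral => x _.
      rewrite gee0_abs; last first.
        rewrite lee_fin cReM cReJ cImJ mulrN opprK.
        by rewrite addr_ge0// -expr2 sqr_ge0.
      over.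
    by rewrite -[LHS]fineK ?h//; exact: integrable_fin_num.
  move=> /(ae_eq_integral_abs _ measurableT (measurable_int _ i1)) h0.
  rewrite -[u]L2class_repr -/f -[RHS]L2class_repr; apply: eq_L2class => //.
    exact: repr_sq.
  have z0 : \forall x \ae mu, sqrint_fun (repr (0 : H)) x = 0.
    by have := repr_L2class sq0; rewrite L2class0.
  apply: filterS2 h0 z0 => x h0 ->; have := h0 I => -[].
  rewrite cReM cReJ cImJ mulrN opprK -!expr2 => /eqP.
  by rewrite paddr_eq0 ?sqr_ge0// !sqrf_eq0 => /andP[/eqP a /eqP b]; exact: complex_ext.
Qed.

End L2_space.

Section real_classes.
Context {disp : measure_display} {T : measurableType disp} {R : realType}.
Variable mu : probability T R.
Implicit Types f g h : T -> R.
Local Notation H := (L2 mu).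
Local Notation sq := (sqr_integrable mu).
Local Notation ip := (L2_inner mu).
Local Notation Lfun2 := (Lfun mu 2%:E).

(** The class of a real function; complex classes are combinations of two of
    these, which keeps the measure theory real. *)
Definition rclass f : H := L2class mu (fun x => (f x)%:C%C).

Lemma Lfun2_sqr f : measurable_fun setT f ->
  mu.-integrable setT (EFin \o (fun x => f x ^+ 2)) -> f \in Lfun2.
Proof.
move=> mf intf; rewrite inE; apply/andP; split; rewrite inE//=.
rewrite /finite_norm unlock poweR_lty//.
have /integrableP[_] := intf; apply: le_lt_trans; apply: ge0_le_integral => //=.
- apply/measurable_EFinP/(@measurableT_comp _ _ _ _ _ _ (fun x : R => x `^ 2)%R) => //.
  exact/measurableT_comp.
- apply/measurable_EFinP; apply: measurableT_comp => //; exact: measurable_funX.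
- by move=> x _; rewrite lee_fin powR_mulrn// normrX.
Qed.

Lemma Lfun2_le f g : measurable_fun setT f -> g \in Lfun2 ->
  (forall x, `|f x| <= `|g x|) -> f \in Lfun2.
Proof.
move=> mf g2 fg; apply: Lfun2_sqr => //.
apply: le_integrable (Lfun2_integrable_sqr g2) => //.
  by apply/measurable_EFinP; exact: measurable_funX.
by move=> x _ /=; rewrite lee_fin !normrX lerXn2r ?nnegrE.
Qed.

Lemma Lfun2_bounded f (M : R) : measurable_fun setT f ->
  (forall x, `|f x| <= M) -> f \in Lfun2.
Proof.
move=> mf fM; apply: (@Lfun2_le _ (cst M)) => //; first exact: Lfun_cst.
by move=> x; rewrite (le_trans (fM x))// ler_norm.
Qed.

Lemma Lfun2_lin (a : R) f g : f \in Lfun2 -> g \in Lfun2 ->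
  (fun x => a * f x + g x) \in Lfun2.
Proof. by have [_ h] := Lfun_submod_closed mu (lee1n 2); exact: h. Qed.

Lemma rclass_sq f : f \in Lfun2 -> (fun x => (f x)%:C%C) \in sq.
Proof. by move=> f2; rewrite inE /= f2; exact: Lfun_cst. Qed.

Lemma rclassP (a : R) f g : f \in Lfun2 -> g \in Lfun2 ->
  rclass (fun x => a * f x + g x) = a%:C%C *: rclass f + rclass g.
Proof.
move=> f2 g2; rewrite /rclass -L2classP ?rclass_sq//; congr L2class.
by apply/funext => x; rewrite rmorphD rmorphM.
Qed.

Lemma rclassB f g : f \in Lfun2 -> g \in Lfun2 ->
  rclass (fun x => f x - g x) = rclass f - rclass g.
Proof.
move=> f2 g2; rewrite addrC -scaleN1r -(rmorphN1 (real_complex R)) -rclassP//.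
by congr rclass; apply/funext => x; rewrite mulN1r addrC.
Qed.

Lemma rclassD f g : f \in Lfun2 -> g \in Lfun2 ->
  rclass (fun x => f x + g x) = rclass f + rclass g.
Proof.
move=> f2 g2; rewrite -[rclass f]scale1r -(rmorph1 (real_complex R)) -rclassP//.
by congr rclass; apply/funext => x; rewrite mul1r.
Qed.

Lemma rclass0 : rclass (fun=> 0) = 0.
Proof. exact: L2class0. Qed.

Lemma rdot_rclass f g : f \in Lfun2 -> g \in Lfun2 ->
  rdot (@L2dot _ _ _ mu) (rclass f) (rclass g) = \int[mu]_x (f x * g x).
Proof.
move=> f2 g2; rewrite /rdot L2dot_class ?rclass_sq//.
rewrite -[LHS]/(\int[mu]_x complex.Re ((f x)%:C%C * ((g x)%:C%C)^* )).
by apply: eq_Rintegral => x _; rewrite cReM cReJ cImJ /=; ring.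
Qed.

Lemma nrm_rclass f : f \in Lfun2 ->
  nrm (@L2dot _ _ _ mu) (rclass f) ^+ 2 = \int[mu]_x (f x ^+ 2).
Proof. by move=> f2; rewrite (nrm_sqr ip) rdot_rclass. Qed.

Definition re_part (u : H) : T -> R := fun x => complex.Re (sqrint_fun (repr u) x).
Definition im_part (u : H) : T -> R := fun x => complex.Im (sqrint_fun (repr u) x).

Lemma re_partP u : re_part u \in Lfun2.
Proof. by have := repr_sq u; rewrite inE => /andP[]. Qed.
Lemma im_partP u : im_part u \in Lfun2.
Proof. by have := repr_sq u; rewrite inE => /andP[]. Qed.

Lemma L2_parts u : u = 'i%C *: rclass (im_part u) + rclass (re_part u).
Proof.
rewrite -L2classP; [|by rewrite rclass_sq ?re_partP ?im_partP..].
rewrite -[LHS]L2class_repr; congr L2class; apply/funext => x.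
by apply: complex_ext; rewrite ?(cReD, cImD, cReM, cImM) /= /re_part /im_part; ring.
Qed.

(** Dominated convergence for |f_n - f|^2 <= 4 g^2. *)
Lemma rclass_dominated (f_ : nat -> T -> R) f g : g \in Lfun2 -> f \in Lfun2 ->
  (forall n, measurable_fun setT (f_ n)) ->
  (forall n x, `|f_ n x| <= g x) ->
  (forall x, f_ n x @[n --> \oo] --> f x) ->
  nrm (@L2dot _ _ _ mu) (rclass (f_ n) - rclass f) @[n --> \oo] --> (0 : R).
Proof.
move=> g2 f2 mf fg ff.
have g_ge0 x : 0 <= g x by exact: le_trans (normr_ge0 _) (fg 0%N x).
have fn2 n : f_ n \in Lfun2.
  by apply: Lfun2_le g2 _ => // x; rewrite [leRHS]ger0_norm.
have fle x : `|f x| <= g x.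
  have h : `|f_ n x| @[n --> \oo] --> `|f x| by exact: cvg_norm (ff x).
  by apply: (cvgr_to_le h); exact: nearW.
have mf' : measurable_fun setT f.
  by move: f2; rewrite inE => /andP[/[!inE]].
have [|||||_ _] := @dominated_convergence _ _ _ mu setT measurableT
    (fun n x => ((f_ n x - f x) ^+ 2)%:E) (cst 0%E) (fun x => (4 * g x ^+ 2)%:E).
- by move=> n; apply/measurable_EFinP/measurable_funX/measurable_funB.
- exact: measurable_cst.
- apply: aeW => x _; apply: cvg_EFin; first exact: nearW.
  have : (f_ n x - f x) ^+ 2 @[n --> \oo] --> (0 : R).
    have h : f_ n x - f x @[n --> \oo] --> (0 : R) by rewrite -(subrr (f x)); apply: cvgB => //; exact: cvg_cst.
    by rewrite -[X in _ --> X](expr0n _ 2); exact: (@cvg_comp _ _ _ _ (fun y => y ^+ 2) _ _ _ h (@exprn_continuous _ 2 0)).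
  by [].
- exact: integrableZ_EFin (Lfun2_integrable_sqr g2).
- apply: aeW => x n _; rewrite /= lee_fin ger0_norm ?sqr_ge0//.
  have -> : 4 * g x ^+ 2 = (2 * g x) ^+ 2 by ring.
  rewrite -real_normK ?num_real// lerXn2r ?nnegrE ?mulr_ge0//.
  by rewrite (le_trans (ler_normB _ _))//; have := fg n x; have := fle x; lra.
rewrite integral0 => h.
have h2 : nrm (@L2dot _ _ _ mu) (rclass (f_ n) - rclass f) ^+ 2 @[n --> \oo] --> (0 : R).
  rewrite (_ : (fun n => _) = fine \o (fun n => \int[mu]_x ((f_ n x - f x) ^+ 2)%:E)%E).
    exact: (fine_cvg h).
  apply/funext => n /=; rewrite -rclassB// nrm_rclass//.
  apply: (Lfun2_le (g := fun x => g x * 2)); first exact: measurable_funB.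
    by apply: (Lfun_scale 2 _ g2); rewrite ler1n.
  move=> x; rewrite [leRHS]ger0_norm ?mulr_ge0// (le_trans (ler_normB _ _))//.
  by have := fg n x; have := fle x; lra.
have := @cvg_comp _ _ _ _ (@Num.sqrt R) _ _ _ h2 (@sqrt_continuous R 0).
rewrite sqrtr0; apply: cvg_trans; apply: near_eq_cvg; apply: nearW => n /=.
by rewrite sqrtr_sqr ger0_norm// nrm_ge0.
Qed.

End real_classes.

Section closed_subspaces.
Import HBNNSimple.
Context {disp : measure_display} {T : measurableType disp} {R : realType}.
Variable mu : probability T R.
Implicit Types f g h : T -> R.
Local Notation H := (L2 mu).
Local Notation dot := (@L2dot _ _ _ mu).
Local Notation ip := (L2_inner mu).
Local Notation Lfun2 := (Lfun mu 2%:E).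

Definition closed_subspace (V : set H) := submod_set V /\
  forall u, (forall e, 0 < e -> exists2 v, V v & nrm dot (v - u) < e) -> V u.

Lemma closed_subspace_lim (V : set H) (u_ : nat -> H) u : closed_subspace V ->
  (forall n, V (u_ n)) -> nrm dot (u_ n - u) @[n --> \oo] --> (0 : R) -> V u.
Proof.
move=> [_ Vc] Vu h; apply: Vc => e e0.
have /cvgrPdist_lt/(_ e e0)[n _ /(_ n (leqnn n))] := h.
by rewrite /= sub0r normrN ger0_norm ?nrm_ge0// => un; exists (u_ n).
Qed.

Lemma Lfun2_indic (A : set T) : measurable A -> (\1_A : T -> R) \in Lfun2.
Proof.
move=> mA; apply: (@Lfun2_bounded _ _ _ _ _ 1) => [|x]; first exact: measurable_indic.
by rewrite indicE; case: (_ \in _); rewrite ?normr1 ?normr0.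
Qed.

(** The sets with indicator in V form a Dynkin system, so the pi-lambda
    theorem gives all measurable sets. Simple functions, monotone limits and
    the parts of a function do the rest. *)
Theorem closed_subspace_full (V : set H) (G : set (set T)) :
  @measurable _ T = <<s G >> -> setI_closed G -> closed_subspace V ->
  V (rclass mu (cst 1)) -> (forall A, G A -> V (rclass mu \1_A)) ->
  forall u, V u.
Proof.
move=> mG GI clV V1 VG.
have [[V0 VD] _] := clV.
have VZ a u : V u -> V (a *: u) by move=> Vu; rewrite -[_ *: _]addr0; exact: VD.
have Vadd u v : V u -> V v -> V (u + v) by move=> Vu; rewrite -[u]scale1r; exact: VD.
have VB u v : V u -> V v -> V (u - v).
  by move=> Vu Vv; rewrite -scaleN1r; apply: Vadd => //; exact: VZ.
have Vind A (mA : measurable A) : V (rclass mu \1_A).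
  have := mA; rewrite mG; move: A {mA}.
  apply: (dynkin_induction (P := fun A => V (rclass mu \1_A)) mG GI) => //=.
  - by rewrite indicT.
  - move=> S mS VS; rewrite (_ : \1_(~` S) = (fun x => (cst 1 x : R) - \1_S x)).
      by rewrite rclassB ?Lfun2_indic//; [exact: VB|exact: Lfun_cst].
    by apply/funext => x; rewrite !indicE in_setC /=; case: (_ \in _) => /=; lra.
  - move=> F mF tF VF; pose S n := \bigcup_(i < n) F i.
    have mS n : measurable (S n) by exact: bigcup_measurable.
    have VS n : V (rclass mu \1_(S n)).
      elim: n => [|n ih].
        rewrite (_ : \1_(S 0%N) = (fun=> 0)) ?rclass0//.
        by apply/funext => x; rewrite indicE memNset// => -[].
      rewrite (_ : \1_(S n.+1) = (fun x => (\1_(S n) x : R) + \1_(F n) x)).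
        by rewrite rclassD ?Lfun2_indic//; exact: Vadd.
      apply/funext => x; rewrite !indicE; have [Fn|nFn] := pselect (F n x).
        have nS : ~ S n x.
          move=> [k /= kn Fk]; have kn' : k = n by apply: tF => //; exists x.
          by rewrite kn' ltnn in kn.
        by rewrite (mem_set Fn) (memNset nS) mem_set ?add0r//; exists n => /=.
      rewrite (memNset nFn) addr0; congr (nat_of_bool _)%:R.
      apply/idP/idP; rewrite !inE => -[k /= kn Fk]; exists k => //=; last exact: ltnW.
      move: kn; rewrite ltnS leq_eqVlt => /predU1P[kn|//].
      by rewrite kn in Fk.
    apply: (closed_subspace_lim clV VS).
    apply: (@rclass_dominated _ _ _ _ _ _ (cst 1)).
    + exact: Lfun_cst.
    + by apply: Lfun2_indic; exact: bigcup_measurable.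
    + by move=> n; exact: measurable_indic.
    + by move=> n x; rewrite indicE; case: (_ \in _); rewrite ?normr1 ?normr0.
    + move=> x; have [[k _ Fk]|nF] := pselect ((\bigcup_k F k) x).
        apply: cvg_near_cst; exists k.+1 => // n /= kn.
        by rewrite !indicE !mem_set//; exists k.
      apply: cvg_near_cst; apply: nearW => n; rewrite !indicE !memNset//.
      by move=> [k _ Fk]; apply: nF; exists k.
have Vpos f : f \in Lfun2 -> (forall x, 0 <= f x) -> V (rclass mu f).
  move=> f2 f0; have mf : measurable_fun setT f by move: f2; rewrite inE => /andP[/[!inE]].
  have mEf : measurable_fun setT (EFin \o f) by exact/measurable_EFinP.
  pose g := nnsfun_approx measurableT mEf.
  have gf x : g n x @[n --> \oo] --> f x.
    have := @cvg_nnsfun_approx _ _ _ _ measurableT _ mEf (fun x _ => f0 x) x I.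
    by move=> /fine_cvg.
  have gle n x : g n x <= f x.
    rewrite -(cvg_lim (@Rhausdorff R) (gf x)).
    apply: (@nondecreasing_cvgn_le _ (fun n => g n x)); last by apply/cvg_ex; exists (f x).
    by move=> m k mk; apply/lefP/(nd_nnsfun_approx measurableT mEf mk).
  apply: (@closed_subspace_lim V (fun n => rclass mu (g n)) _ clV).
    move=> n.
    pose s := finmap.enum_fset (fset_set (range (g n))).
    have gE x : g n x = \sum_(y <- s) y * \1_(g n @^-1` [set y]) x.
      by rewrite fimfunE fsbig_finite.
    have -> : (g n : T -> R) = (fun x => \sum_(y <- s) y * \1_(g n @^-1` [set y]) x) by exact/funext.
    suff : (fun x => \sum_(y <- s) y * \1_(g n @^-1` [set y]) x) \in Lfun2 /\
        V (rclass mu (fun x => \sum_(y <- s) y * \1_(g n @^-1` [set y]) x)) by case.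
    elim: s {gE} => [|y s [ih1 ih2]].
      under eq_fun do rewrite big_nil.
      split; first exact: Lfun_cst.
      by rewrite rclass0.
    under eq_fun do rewrite big_cons.
    have i2 : (\1_(g n @^-1` [set y]) : T -> R) \in Lfun2 by apply: Lfun2_indic.
    split; first exact: Lfun2_lin.
    by rewrite rclassP//; apply: VD => //; exact: Vind.
  apply: (@rclass_dominated _ _ _ _ _ _ f) => //.
  by move=> n x; rewrite ger0_norm.
have Vreal f : f \in Lfun2 -> V (rclass mu f).
  move=> f2; have mf : measurable_fun setT f by move: f2; rewrite inE => /andP[/[!inE]].
  have p2 : f^\+ \in Lfun2.
    apply: Lfun2_le f2 _; first exact: measurable_funrpos.
    by move=> x; rewrite /funrpos; have [|] := leP 0 (f x) => ?; rewrite ?normr0.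
  have n2 : f^\- \in Lfun2.
    apply: Lfun2_le f2 _; first exact: measurable_funrneg.
    by move=> x; rewrite /funrneg; have [|] := leP 0 (- f x) => ?; rewrite ?normr0 ?normrN.
  rewrite (_ : f = (fun x => f^\+ x - f^\- x)).
    by rewrite rclassB//; apply: VB; exact: Vpos.
  apply/funext => x; rewrite /funrpos /funrneg.
  by have [|] := ltrP 0 (f x) => ?; have [|] := ltrP 0 (- f x) => ?; lra.
move=> u; rewrite [u]L2_parts; apply: VD; apply: Vreal; [exact: im_partP|exact: re_partP].
Qed.

End closed_subspaces.

(** * The pattern space and its Borel sets *)

Section rational_balls.
Context {R : realType} {d : nat}.

Definition rat_center (p : 'rV[rat]_d * rat) : 'rV[R]_d := \row_i ratr (p.1 0 i).
Definition rat_ball (p : 'rV[rat]_d * rat) : set 'rV[R]_d := ball (rat_center p) (ratr p.2 : R).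

Lemma rat_ballP (s : 'rV[R]_d) (e : R) : 0 < e ->
  exists p, rat_ball p s /\ rat_ball p `<=` ball s e.
Proof.
move=> e0; have [a] := rat_in_itvoo (divr_gt0 e0 (ltr0n R 2)).
rewrite in_itv/= => /andP[a0 ae].
have hq i : exists b : rat, ball (ratr b : R) (ratr a) (s 0 i).
  have [|b] := @rat_in_itvoo R (s 0 i - ratr a) (s 0 i + ratr a); first lra.
  rewrite in_itv/= => /andP[b1 b2]; exists b.
  by rewrite /ball/= ltr_norml; apply/andP; split; lra.
have [q hq'] := choice hq.
exists (\row_i q i, a); rewrite /rat_ball /rat_center; split.
  by split=> // i j; rewrite !mxE/= ord1; exact: hq'.
move=> y [_ yq]; split=> // i j.
have /(le_ball (ltW ae)) := yq i j.
have /(le_ball (ltW ae))/ball_sym := hq' j.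
by rewrite !mxE /= ord1 => h1 h2; have := ball_triangle h1 h2; rewrite -splitr.
Qed.

(** The crude constant d + 1 avoids a square root and is positive for d = 0. *)
Lemma enorm_le (u : 'rV[R]_d) e : 0 <= e -> (forall i, `|u 0 i| <= e) ->
  enorm u <= d.+1%:R * e.
Proof.
move=> e0 ue; rewrite -(@ler_sqr _ (enorm u)) ?nnegrE ?enorm_ge0 ?mulr_ge0//.
rewrite sqr_sqrtr ?dotp_ge0// exprMn.
apply: (@le_trans _ _ (\sum_(i < d) e ^+ 2)).
  by apply: ler_sum => i _; rewrite -expr2 -real_normK ?num_real// lerXn2r ?nnegrE.
rewrite sumr_const card_ord -[leLHS]mulr_natl ler_wpM2r ?sqr_ge0// -natrX ler_nat.
by rewrite (leq_trans (leqnSn d))// expnS expn1 leq_pmulr.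
Qed.

End rational_balls.

Section pattern_flow.
Context {R : realType} {d : nat} {L0 : delone R d}.
Local Notation Om := (pattern_space L0).

Lemma ps_ballE (x y : Om) (e : R) : ball x e y = (rho (val x) (val y) < e) :> Prop.
Proof. by have := congr1 (fun A => A (val y)) (ballEmdist (val x) e). Qed.

Lemma rhoC (x y : delone R d) : rho x y = rho y x.
Proof. exact: (@metric_sym R (delone R d) x y). Qed.
Lemma rho_triangle (y x z : delone R d) : rho x z <= rho x y + rho y z.
Proof. exact: (@metric_triangle R (delone R d) x y z). Qed.

(** Shifting the pattern by t - s matches the two translates exactly. *)
Lemma rho_translate (s t : 'rV[R]_d) (L : delone R d) (e : R) :
  enorm (t - s) < e -> rho (delone_translate s L) (delone_translate t L) <= e.
Proof.
move=> ste; have e0 : 0 < e by exact: le_lt_trans (enorm_ge0 _) ste.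
apply/rho_le/rho_closeP; split=> //; exists (t - s), 0; rewrite enorm0; split=> // x _.
by rewrite /= /translate/= addr0 -addrA subrK.
Qed.

Lemma flowD s t (x : Om) : flow s (flow t x) = flow (s + t) x.
Proof. by apply/val_inj; rewrite /= delone_translateD. Qed.

Lemma flow0 (x : Om) : flow 0 x = x.
Proof.
by apply/val_inj/delone_inj/funext => z; rewrite /= /translate/= addr0.
Qed.

(** Joint continuity of the flow: continuity in the pattern for fixed s0, plus
    a modulus in the translation vector that is uniform over patterns. *)
Lemma flow_continuous2 s0 (x0 : Om) (e : R) : 0 < e ->
  exists2 a, 0 < a & forall s x, ball s0 a s -> ball x0 a x ->
    ball (flow s0 x0) e (flow s x).
Proof.
move=> e0; have e20 : 0 < e / 2 by rewrite divr_gt0.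
have := @delone_translate_continuous R d s0 (val x0).
move=> /(@cvg_ballP R (delone R d) _ _ (nbhs_filter (val x0)))/(_ _ e20).
move=> /nbhs_ballP[a /= a0 ha].
pose b := (e / 4) / d.+1%:R.
have b0 : 0 < b by rewrite divr_gt0// divr_gt0.
exists (Num.min a b); first by rewrite lt_min a0.
move=> s x hs; rewrite !ps_ballE lt_min => /andP[xa _].
apply: (le_lt_trans (rho_triangle (delone_translate s0 (val x)) _ _)).
have h1 : rho (delone_translate s0 (val x0)) (delone_translate s0 (val x)) < e / 2.
  by have := ha (val x); rewrite !ballEmdist/=; apply.
have h2 : rho (delone_translate s0 (val x)) (delone_translate s (val x)) <= e / 3.
  apply: rho_translate; apply: (@le_lt_trans _ _ (e / 4)); last by lra.
  rewrite (_ : e / 4 = d.+1%:R * b); last by rewrite /b [RHS]mulrC divfK ?pnatr_eq0.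
  apply: enorm_le => [|i]; first exact: ltW.
  case: hs => _ /(_ 0 i); rewrite /ball/= => hs.
  by rewrite !mxE distrC ltW// (lt_le_trans hs)// ge_min lexx orbT.
by rewrite /=; lra.
Qed.

Lemma flow_continuous s : continuous (flow s : Om -> Om).
Proof.
move=> x; apply/(@cvg_ballP R Om _ _ (nbhs_filter x)) => e e0; have [a a0 h] := flow_continuous2 s x e0.
by apply/nbhs_ballP; exists a => //= y xy; apply: h => //; exact: ballxx.
Qed.

Definition rat_point (q : 'rV[rat]_d) : Om :=
  flow (\row_i ratr (q 0 i)) (exist _ L0 (hull_self L0)).

(** The translates of L0 are dense by definition of the hull, and a translate
    varies continuously with the translation vector. *)
Lemma rat_point_dense (x : Om) (e : R) : 0 < e -> exists q, rho (val (rat_point q)) (val x) < e.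
Proof.
move=> e0; have e20 : 0 < e / 2 by rewrite divr_gt0.
have := valP x; rewrite inE => /(_ (ball (val x) (e / 2))) [].
  exact/nbhsx_ballx.
move=> _ [[t _ <-]]; rewrite ballEmdist/= => xt.
pose c := (e / 4) / d.+1%:R.
have c0 : 0 < c by rewrite divr_gt0// divr_gt0.
have [p [pt pc]] := rat_ballP t c0.
exists p.1; apply: (le_lt_trans (rho_triangle (delone_translate t L0) _ _)).
have xt' : rho (delone_translate t L0) (val x) < e / 2 by rewrite rhoC.
have h2 : rho (delone_translate (rat_center p) L0) (delone_translate t L0) <= e / 3.
  apply: rho_translate; apply: (@le_lt_trans _ _ (e / 4)); last by lra.
  rewrite (_ : e / 4 = d.+1%:R * c); last by rewrite /c [RHS]mulrC divfK ?pnatr_eq0.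
  apply: enorm_le => [|i]; first exact: ltW.
  have := pc (rat_center p); case: (pt) => r0 _; case=> [|_ /(_ 0 i)]; first exact: ballxx.
  by rewrite /ball/= !mxE => /ltW.
rewrite /= -/(rat_center p); lra.
Qed.

End pattern_flow.
Arguments rat_point {R d} L0 q.

Section borel_real_functions.
Context {R : realType} {T : ptopologicalType}.

Lemma continuous_measurable (f : T -> R) : continuous f ->
  measurable_fun setT (f : borel T -> R).
Proof.
move=> cf; apply: (@measurability _ _ (borel T) _ setT f _ (RGenOInfty.measurableE R)) => //.
move=> _ [_ [r ->] <-]; rewrite setTI; apply: sub_sigma_algebra.
by apply: open_comp; [move=> x _; exact: cf|exact: interval_open].
Qed.

End borel_real_functions.

Section pattern_borel.
Context {R : realType} {d : nat} {L0 : delone R d}.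
Local Notation Om := (pattern_space L0).
Local Notation Omega := (g_sigma_algebraType (@open Om)).

Lemma rho_continuous (y : delone R d) : continuous (fun x : Om => rho y (val x)).
Proof.
move=> x; apply/(@cvgrPdist_lt _ R^o _ _ (nbhs_filter x)) => e e0.
apply/nbhs_ballP; exists e => //= z; rewrite ps_ballE => xz.
rewrite ltr_norml; have := rho_triangle (val x) y (val z).
by have := rho_triangle (val z) y (val x); rewrite (rhoC (val z)); lra.
Qed.

(** Finite intersections of balls of rational radius around rational
    translates of L0: a countable pi-system that generates the Borel sets. *)
Definition dballs (s : seq ('rV[rat]_d * rat)) : set Om :=
  [set x | forall p, p \in s -> rho (val (rat_point L0 p.1)) (val x) < ratr p.2].

Definition tent (p : 'rV[rat]_d * rat) (n : nat) (x : Om) : R :=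
  Num.min 1 (n%:R * Num.max 0 (ratr p.2 - rho (val (rat_point L0 p.1)) (val x))).

(** Continuous functions that converge to the indicator of [dballs s]. *)
Definition bumpf (s : seq ('rV[rat]_d * rat)) (n : nat) (x : Om) : R :=
  \prod_(p <- s) tent p n x.

Lemma tent_continuous p n : continuous (tent p n).
Proof.
move=> x; pose f (y : Om) : R^o := ratr p.2 - rho (val (rat_point L0 p.1)) (val y).
have cf : {for x, continuous f}.
  by apply: (@cvgB _ _ _ (nbhs x)); [exact: cvg_cst|exact: rho_continuous].
have cg := @continuous_max R Om (cst 0) f x (@cst_continuous Om R^o 0 x) cf.
have ch : {for x, continuous (fun y => n%:R * (cst (0 : R^o) \max f) y : R^o)}.
  by apply: (@cvgM _ _ (nbhs x)) => //; exact: cvg_cst.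
exact: (@continuous_min R Om (cst 1) _ x (@cst_continuous Om R^o 1 x) ch).
Qed.

Lemma bumpf_continuous s n : continuous (bumpf s n).
Proof.
elim: s => [|p s ih] x.
  rewrite (_ : bumpf [::] n = cst 1); first exact: (@cst_continuous Om R 1 x).
  by apply/funext => y; rewrite /bumpf big_nil.
rewrite (_ : bumpf (p :: s) n = (fun y => tent p n y * bumpf s n y)).
  by apply: (@cvgM _ _ (nbhs x)); [exact: tent_continuous|exact: ih].
by apply/funext => y; rewrite /bumpf big_cons.
Qed.

Lemma bumpf_itv s n x : 0 <= bumpf s n x <= 1.
Proof.
rewrite /bumpf; elim: s => [|p s /andP[ih0 ih1]]; first by rewrite big_nil lexx ler01.
have h : 0 <= tent p n x <= 1.
  by rewrite /tent le_min ler01 ge_min lexx/= andbT mulr_ge0// le_max lexx.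
rewrite big_cons; case/andP: h => h0 h1; apply/andP; split; first exact: mulr_ge0.
exact: mulr_ile1.
Qed.

Lemma bumpf_cvg s x : bumpf s n x @[n --> \oo] --> (\1_(dballs s) x : R).
Proof.
have [xs|xs] := pselect (dballs s x).
  rewrite indicE mem_set//; elim: s xs => [|p s ih] xs.
    rewrite (_ : (fun n => _) = cst 1); first exact: cvg_cst.
    by apply/funext => n; rewrite /bumpf big_nil.
  rewrite (_ : (fun n => _) = (fun n => tent p n x * bumpf s n x)); last first.
    by apply/funext => n; rewrite /bumpf big_cons.
  rewrite -[X in _ --> X]mulr1.
  apply: cvgM; last by apply: ih => q qs; apply: xs; rewrite inE qs orbT.
  have := xs p (mem_head _ _); set r := rho _ _ => rp.
  have pr : 0 < ratr p.2 - r by rewrite subr_gt0.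
  apply: cvg_near_cst; exists (Num.bound (ratr p.2 - r)^-1) => // n /= hn.
  rewrite /tent -/r; apply/min_idPl; rewrite (max_idPr _) ?(ltW pr)// -ler_pdivrMr// mul1r.
  have pv : 0 <= (ratr p.2 - r)^-1 by rewrite invr_ge0 ltW.
  by apply: (le_trans (ltW (archi_boundP pv))); rewrite ler_nat.
rewrite indicE memNset//; apply: cvg_near_cst; apply: nearW => n.
have [p ps hp] : exists2 p, p \in s & ratr p.2 <= rho (val (rat_point L0 p.1)) (val x).
  apply: contrapT => h; apply: xs => p ps; rewrite ltNge; apply/negP => hp.
  by apply: h; exists p.
rewrite /bumpf (big_rem p)//= /tent (max_idPl _) ?subr_le0// mulr0.
by rewrite (min_idPr _) ?ler01// mul0r.
Qed.

Lemma dballsU s1 s2 : dballs (s1 ++ s2) = dballs s1 `&` dballs s2.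
Proof.
apply/seteqP; split=> x.
  by move=> h; split=> p ps; apply: h; rewrite mem_cat ps ?orbT.
by move=> [h1 h2] p; rewrite mem_cat => /orP[/h1|/h2].
Qed.

Lemma dballs_open s : open (dballs s).
Proof.
elim: s => [|p s ih].
  by rewrite (_ : dballs [::] = setT) ?predeqE//; exact: openT.
rewrite -cat1s dballsU; apply: openI => //.
rewrite (_ : dballs [:: p] = (fun x : Om => rho (val (rat_point L0 p.1)) (val x)) @^-1` [set r | r < ratr p.2]).
  by apply: open_comp; [move=> x _; exact: rho_continuous|exact: open_lt].
apply/seteqP; split=> x /=; first by apply; rewrite mem_head.
by move=> h q; rewrite inE => /eqP ->.
Qed.

Lemma dballs_generate : @measurable _ Omega = <<s range dballs >>.
Proof.
rewrite eqEsubset; split.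
  apply: smallest_sub; first exact: smallest_sigma_algebra.
  move=> O oO.
  pose B p := if `[< dballs [:: p] `<=` O >] then dballs [:: p] else set0.
  rewrite (_ : O = \bigcup_p B p).
    apply: (@countable_bigcupT_measurable _ (g_sigma_algebraType (range dballs))) => // p.
    rewrite /B; case: ifP => _; last exact: measurable0.
    by apply: sub_sigma_algebra; exists [:: p].
  apply/seteqP; split=> [x Ox|x [p _]]; last by rewrite /B; case: asboolP => // h /h.
  have := open_nbhs_nbhs (conj oO Ox) => /nbhs_ballP[e /= e0 he].
  have [q hq] := rat_point_dense x (divr_gt0 e0 (ltr0n _ 2)).
  have [b] := @rat_in_itvoo R (e / 4) (e / 2) ltac:(lra).
  have [b'] := @rat_in_itvoo R (rho (val (rat_point L0 q)) (val x)) (e / 2) hq.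
  rewrite !in_itv/= => /andP[b1 b2] _.
  exists (q, b') => //; rewrite /B; case: asboolP.
    by move=> _ p; rewrite inE => /eqP ->.
  case=> y /(_ _ (mem_head _ _)) /= hy; apply: he; rewrite ps_ballE.
  apply: (le_lt_trans (rho_triangle (val (rat_point L0 q)) _ _)).
  by rewrite rhoC; lra.
apply: smallest_sub; first exact: smallest_sigma_algebra.
by move=> _ [s _ <-]; apply: sub_sigma_algebra; exact: dballs_open.
Qed.

End pattern_borel.

(** * Koopman operators *)

Section pattern_L2.
Context {R : realType} {d : nat} {L0 : delone R d}.
Local Notation Om := (pattern_space L0).
Local Notation Omega := (borel (pattern_space L0)).
Variable mu : probability Omega R.
Local Notation H := (L2 mu).
Local Notation dot := (@L2dot _ _ _ mu).
Local Notation ip := (L2_inner mu).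
Local Notation Lfun2 := (Lfun mu 2%:E).

Lemma dballs_setI_closed : setI_closed (range (@dballs R d L0)).
Proof. by move=> _ _ [s1 _ <-] [s2 _ <-]; exists (s1 ++ s2) => //; exact: dballsU. Qed.

(** Indicators of a generating pi-system of open sets are bounded pointwise
    limits of continuous functions. *)
Lemma closed_subspace_continuous (V : set H) : closed_subspace V ->
  (forall g : Om -> R, continuous g -> (forall x, `|g x| <= 1) -> V (rclass mu g)) ->
  forall u, V u.
Proof.
move=> clV Vc; apply: (closed_subspace_full dballs_generate dballs_setI_closed clV).
  by apply: Vc => [x|x]; [exact: cst_continuous|rewrite normr1].
move=> _ [s _ <-]; apply: (@closed_subspace_lim _ _ _ _ _ (fun n => rclass mu (bumpf s n)) _ clV).
  move=> n; apply: Vc; first exact: bumpf_continuous.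
  by move=> x; have /andP[h0 h1] := bumpf_itv s n x; rewrite ger0_norm.
apply: (@rclass_dominated _ _ _ _ _ _ (cst 1)).
- exact: Lfun_cst.
- by apply: Lfun2_indic; apply: sub_sigma_algebra; exact: dballs_open.
- by move=> n; apply: continuous_measurable; exact: bumpf_continuous.
- by move=> n x; have /andP[h0 h1] := bumpf_itv s n x; rewrite ger0_norm.
- by move=> x; exact: bumpf_cvg.
Qed.

Lemma closed_subspace_orthogonal (u : H) : closed_subspace [set v | dot u v = 0].
Proof.
split.
  by split=> [|a v w /= v0 w0]; rewrite /= ?(dot0r ip)// (dotDr ip) (dotZr ip) v0 w0 mulr0 addr0.
move=> v h /=.
have hr w : (forall e, 0 < e -> exists2 v', rdot dot v' w = 0 & nrm dot (v' - v) < e) ->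
    rdot dot v w = 0.
  move=> {}h; apply/eqP; rewrite -normr_le0; apply/ler_addgt0Pl => e e0; rewrite addr0.
  have w1 : 0 < nrm dot w + 1 by rewrite ltr_wpDl// nrm_ge0.
  have [v' v'0 hv'] := h (e / (nrm dot w + 1)) (divr_gt0 e0 w1).
  rewrite -normrN -[- _]add0r -v'0 -(rdotBl ip) (le_trans (rdot_le ip _ _))//.
  apply: (@le_trans _ _ (e / (nrm dot w + 1) * (nrm dot w + 1))); last by rewrite divfK ?gt_eqF.
  by apply: ler_pM; rewrite ?nrm_ge0 ?(ltW hv')// lerDl.
rewrite (dot_rdot ip) !(rdotC ip u) (rdotZJ ip) !hr// => e e0;
  have [v' /= v'0 hv'] := h e e0; exists v' => //.
- by rewrite -(rdotZJ ip) (rdotC ip) /rdot (dotZr ip) v'0 mulr0.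
- by rewrite (rdotC ip) /rdot v'0.
Qed.

(** The orthogonal of u is a closed subspace. If it contains the indicators of
    the countable generating pi-system [dballs], it contains u itself. *)
Lemma countable_total : exists C : set H, countable C /\
  forall u, (forall c, C c -> dot u c = 0) -> u = 0.
Proof.
have ind1 : (cst 1 : Om -> R) = \1_(@dballs R d L0 [::]).
  by apply/funext => x; rewrite indicE mem_set.
exists (range (fun s => rclass mu \1_(@dballs R d L0 s))); split.
  by apply: sub_countable (card_image_le _ _) _; exact: countableP.
move=> u uC; apply: (dot_eq0 ip).
apply: (@closed_subspace_full _ _ _ mu _ _ (@dballs_generate R d L0) dballs_setI_closed
   (closed_subspace_orthogonal u)) => /=.
- by rewrite ind1; apply: uC; exists [::].
- by move=> _ [s _ <-]; apply: uC; exists s.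
Qed.

Hypothesis mu_inv : flow_invariant mu.

Lemma measurable_flow t : measurable_fun setT (flow t : Omega -> Omega).
Proof.
apply: (@measurability _ _ Omega Omega setT (flow t) (@open Om)) => //.
move=> _ [U oU <-]; rewrite setTI; apply: sub_sigma_algebra.
by apply: open_comp => // x _; exact: flow_continuous.
Qed.

Lemma ge0_integral_flow t (h : Omega -> \bar R) : measurable_fun setT h ->
  (forall x, 0 <= h x)%E -> (\int[mu]_x h (flow t x) = \int[mu]_x h x)%E.
Proof.
move=> mh h0.
have mf : measurable_fun setT (h : Omega -> \bar R) := mh.
have := @ge0_integral_pushforward _ _ Omega Omega R (flow t) (measurable_flow t) mu setT h
  measurableT mf (fun y _ => h0 y).
rewrite preimage_setT => <-.
apply: (@eq_measure_integral _ Omega R setT mu) => [|mF A mA _]; [exact: measurable_flow|by rewrite -[RHS](mu_inv t mA)].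
Qed.

Lemma ae_flow t (Q : Omega -> Prop) : (\forall x \ae mu, Q x) -> \forall x \ae mu, Q (flow t x).
Proof.
move=> [N [mN N0 NQ]]; exists (flow t @^-1` N); split.
- by rewrite -[X in measurable X]setTI; exact: measurable_flow.
- by rewrite mu_inv.
- by move=> x /= nQ; apply: NQ.
Qed.

Lemma Lfun2_flow t (f : Omega -> R) : f \in Lfun2 -> (f \o flow t) \in Lfun2.
Proof.
move=> f2; have mf : measurable_fun setT f by move: f2; rewrite inE => /andP[/[!inE]].
have mft : measurable_fun setT (f \o flow t : Omega -> R) by apply: (measurableT_comp mf); exact: measurable_flow.
apply: Lfun2_sqr => //; apply/integrableP; split.
  by apply/measurable_EFinP; exact: measurable_funX.
have /integrableP[mf2] := Lfun2_integrable_sqr f2.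
rewrite -(@ge0_integral_flow t (fun x => `|(EFin \o (fun x => (f x ^+ 2)%R)) x|)%E)//.
exact: measurableT_comp.
Qed.

Lemma sq_flow t (f : Omega -> R[i]) : f \in sqr_integrable mu -> (f \o flow t) \in sqr_integrable mu.
Proof. by rewrite !inE => /andP[/Lfun2_flow h1 /Lfun2_flow h2]; apply/andP; split; [exact: h1|exact: h2]. Qed.

Lemma integral_flow t (f : Omega -> R) : measurable_fun setT f ->
  \int[mu]_x f (flow t x) = \int[mu]_x f x.
Proof.
move=> mf; have mEf : measurable_fun setT (EFin \o f) by exact/measurable_EFinP.
rewrite /Rintegral; congr fine; rewrite [LHS]integralE [RHS]integralE.
rewrite -(@ge0_integral_flow t (EFin \o f)^\+)%E; [|exact: measurable_funepos|by []].
rewrite -(@ge0_integral_flow t (EFin \o f)^\-)%E; [|exact: measurable_funeneg|].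
  by congr (_ - _)%E; apply: eq_integral => x _; rewrite ?funeposE ?funenegE.
by move=> x; exact: funeneg_ge0.
Qed.

Lemma koopman_class t (f : Omega -> R[i]) : f \in sqr_integrable mu ->
  koopman mu t (L2class mu f) = L2class mu (f \o flow t).
Proof.
move=> sf; apply: eq_L2class.
- by apply: sq_flow; exact: repr_sq.
- exact: sq_flow.
- by apply: (ae_flow t (Q := fun x => sqrint_fun (repr (L2class mu f)) x = f x)); exact: repr_L2class.
Qed.

Lemma koopman_rclass t (f : Omega -> R) : f \in Lfun2 ->
  koopman mu t (rclass mu f) = rclass mu (f \o flow t).
Proof. by move=> f2; rewrite /rclass koopman_class// rclass_sq. Qed.

Lemma koopman_linear t : linear (koopman mu t).
Proof.
move=> a u v; rewrite -[u]L2class_repr -[v]L2class_repr.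
have su := repr_sq u; have sv := repr_sq v.
set f := sqrint_fun _ in su *; set g := sqrint_fun (repr v) in sv *.
by rewrite -L2classP// !koopman_class ?sq_lin// -L2classP ?sq_flow.
Qed.

Lemma koopman_dot t u v : dot (koopman mu t u) (koopman mu t v) = dot u v.
Proof.
rewrite -[u]L2class_repr -[v]L2class_repr.
have su := repr_sq u; have sv := repr_sq v.
set f := sqrint_fun _ in su *; set g := sqrint_fun (repr v) in sv *.
rewrite !koopman_class// !L2dot_class ?sq_flow//.
have [m1 m2] := cintegrable_measurable (sq_mulJ su sv).
apply: complex_ext => /=.
- exact: (integral_flow t m1).
- exact: (integral_flow t m2).
Qed.

Lemma koopmanD s t u : koopman mu s (koopman mu t u) = koopman mu (s + t) u.
Proof.
rewrite -[u]L2class_repr; have su := repr_sq u; set f := sqrint_fun _ in su *.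
rewrite !koopman_class ?sq_flow//; congr (L2class mu _); apply/funext => x.
by rewrite /= flowD addrC.
Qed.

Lemma koopman0 u : koopman mu 0 u = u.
Proof.
rewrite -[u]L2class_repr; have su := repr_sq u; set f := sqrint_fun _ in su *.
by rewrite !koopman_class//; congr (L2class mu _); apply/funext => x; rewrite /= flow0.
Qed.

End pattern_L2.

(** * Gaussian averages along the flow *)

Section lebesgue_tuples.
Context {R : realType}.
Local Notation RR := (measurableTypeR R).
Implicit Types (phi : nat -> R -> R).

Definition prod_fun n phi (t : n.-tuple RR) : R := \prod_(i < n) phi i (tnth t i).

Lemma prod_fun_ge0 n phi t : (forall i x, 0 <= phi i x) -> 0 <= @prod_fun n phi t.
Proof. by move=> phi0; apply: prodr_ge0 => i _. Qed.

Lemma measurable_prod_fun n phi : (forall i, measurable_fun setT (phi i)) ->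
  measurable_fun setT (@prod_fun n phi).
Proof.
move=> mphi; rewrite /prod_fun; apply: measurable_prod => i _.
by apply: (measurableT_comp (mphi i)); exact: measurable_tnth.
Qed.

(** Tonelli, along the recursive construction of Lebesgue measure on tuples. *)
Lemma integral_prod_fun n phi : (forall i, measurable_fun setT (phi i)) ->
  (forall i x, 0 <= phi i x) ->
  (\int[lebesgue_tuple n]_t (prod_fun phi t)%:E =
   \prod_(i < n) \int[@lebesgue_measure R]_x (phi i x)%:E)%E.
Proof.
elim: n phi => [|n ih] phi mphi phi0.
  rewrite big_ord0 /= integral_dirac//.
    by rewrite diracT mul1e /prod_fun big_ord0.
  by apply/measurable_EFinP; exact: measurable_prod_fun.
have mp m : measurable_fun setT (EFin \o @prod_fun m (fun i => phi i.+1)).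
  apply/measurable_EFinP; exact: (measurable_prod_fun (phi := fun i => phi i.+1) (fun i => mphi i.+1)).
rewrite big_ord_recl -(ih (fun i => phi i.+1))//.
pose cons_tup (p : RR * n.-tuple RR) : n.+1.-tuple RR := [tuple of p.1 :: p.2].
have mcons : measurable_fun setT cons_tup.
  exact: (measurable_cons measurable_fst measurable_snd).
transitivity (\int[@lebesgue_measure R \x lebesgue_tuple n]_p
   ((phi 0%N p.1)%:E * (prod_fun (fun i => phi i.+1) p.2)%:E))%E.
  have mE : measurable_fun setT (fun t => (@prod_fun n.+1 phi t)%:E).
    by apply/measurable_EFinP; exact: measurable_prod_fun.
  have := @ge0_integral_pushforward _ _ (RR * n.-tuple RR)%type (n.+1.-tuple RR) R
    cons_tup mcons (@lebesgue_measure R \x lebesgue_tuple n)%E setT _ measurableT mE.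
  rewrite preimage_setT => hp.
  transitivity (\int[@lebesgue_measure R \x lebesgue_tuple n]_p (prod_fun phi (cons_tup p))%:E)%E.
    by rewrite -hp// => t _; rewrite lee_fin prod_fun_ge0.
  apply: eq_integral => -[x t] _ /=; rewrite -EFinM /prod_fun big_ord_recl; congr (_ * _)%:E.
  by apply: eq_bigr => i _; rewrite tnthS.
rewrite fubini_tonelli1; first last.
- by move=> [x t]; rewrite /= -EFinM lee_fin mulr_ge0// prod_fun_ge0.
- apply/measurable_EFinP; apply: measurable_funM.
    by apply: (measurableT_comp (mphi 0%N)); exact: measurable_fst.
  apply: (measurableT_comp (measurable_prod_fun (phi := fun i => phi i.+1) (fun i => mphi i.+1))).
  exact: measurable_snd.
rewrite /fubini_F /=.
transitivity (\int[@lebesgue_measure R]_x ((phi 0%N x)%:E *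
    \int[lebesgue_tuple n]_t (prod_fun (fun i => phi i.+1) t)%:E))%E.
  apply: eq_integral => x _; apply: ge0_integralZl => //.
  - exact: mp.
  - by move=> t _; rewrite lee_fin prod_fun_ge0.
  - by rewrite lee_fin phi0.
rewrite ge0_integralZr//.
- by apply/measurable_EFinP; exact: mphi.
- by move=> x _; rewrite lee_fin phi0.
- by apply: integral_ge0 => t _; rewrite lee_fin prod_fun_ge0.
Qed.

(** The Gaussian kernel factors into centered normal densities of variance t,
    so its integral is 1 and its measurability comes from one variable. *)
Lemma gauss_kernel_prod d (t : R) (x : d.-tuple RR) : 0 < t ->
  gauss_kernel t (tuple_rV x) = prod_fun (fun _ => normal_pdf 0 (Num.sqrt t)) x.
Proof.
move=> t0; have st0 : Num.sqrt t != 0 by rewrite gt_eqF// sqrtr_gt0.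
rewrite /prod_fun /gauss_kernel.
under eq_bigr => i _ do rewrite normal_pdfE//.
rewrite big_split /= prodr_const card_ord; congr (_ * _).
  rewrite powRN.
  rewrite /normal_peak sqr_sqrtr ?(ltW t0)// exprVn; congr (_^-1).
  rewrite (_ : t * pi *+ 2 = 2 * pi * t); last by rewrite -mulr_natl; ring.
  have pt : 0 <= 2 * pi * t by rewrite mulr_ge0 ?mulr_ge0 ?pi_ge0 ?(ltW t0).
  by rewrite [d%:R / 2]mulrC powRrM powR12_sqrt// powR_mulrn// sqrtr_ge0.
rewrite -expR_sum; congr expR; rewrite sqr_sqrtr ?dotp_ge0// /dotp mulr_suml -sumrN.
apply: eq_bigr => i _; rewrite !mxE subr0 sqr_sqrtr ?(ltW t0)// mulNr -expr2.
by rewrite -[t *+ 2]mulr_natl.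
Qed.

Lemma gauss_kernel_ge0 d (t : R) (x : 'rV[R]_d) : 0 <= gauss_kernel t x.
Proof. by rewrite mulr_ge0 ?powR_ge0 ?expR_ge0. Qed.

Lemma gauss_kernel_gt0 d (t : R) (x : 'rV[R]_d) : 0 < t -> 0 < gauss_kernel t x.
Proof.
by move=> t0; rewrite mulr_gt0 ?powR_gt0 ?expR_gt0// !mulr_gt0 ?pi_gt0.
Qed.

Lemma measurable_gauss_kernel d (t : R) : 0 < t ->
  measurable_fun setT (fun x : d.-tuple RR => gauss_kernel t (tuple_rV x)).
Proof.
move=> t0; rewrite (_ : (fun x => _) = prod_fun (fun _ => normal_pdf 0 (Num.sqrt t))).
  by apply: measurable_prod_fun => _; exact: measurable_normal_pdf.
by apply/funext => x; rewrite gauss_kernel_prod.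
Qed.

Lemma integral_gauss_kernel d (t : R) : 0 < t ->
  (\int[lebesgue_tuple d]_x (gauss_kernel t (tuple_rV x))%:E = 1)%E.
Proof.
move=> t0; under eq_integral do rewrite gauss_kernel_prod//.
rewrite integral_prod_fun.
- by rewrite big1// => i _; exact: integral_normal_pdf.
- by move=> _; exact: measurable_normal_pdf.
- by move=> _ x; exact: normal_pdf_ge0.
Qed.

(** Sup-norm balls are cubes, and the measure of a cube is the product of its
    positive side lengths. *)
Lemma ae_lebesgue_tuple_near d (Q : d.-tuple RR -> Prop) (s : 'rV[R]_d) (e : R) :
  0 < e -> (\forall x \ae (lebesgue_tuple d), Q x) ->
  exists2 x, Q x & ball s e (tuple_rV x).
Proof.
move=> e0 aeQ; apply: contrapT => h.
pose c (i : nat) : R := oapp (fun j : 'I_d => s 0 j) 0 (insub i).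
have cE (i : 'I_d) : c i = s 0 i by rewrite /c valK.
pose phi i : R -> R := \1_(ball (c i) e).
have mphi i : measurable_fun setT (phi i).
  by apply: measurable_indic; exact: measurable_ball.
have phi0 i x : 0 <= phi i x by rewrite /phi indicE.
have := @integral_prod_fun d phi mphi phi0.
rewrite (ae_eq_integral (cst 0%E))//; first last.
- apply: filterS aeQ => x Qx _ /=; congr EFin.
  apply/eqP; apply: contrapT => /negP px; apply: h; exists x => //.
  split=> // i j; rewrite ord1 mxE /= -cE; apply: contrapT => nb.
  move/negP : px; apply; rewrite /prod_fun (bigD1 j)//=.
  by rewrite /phi indicE memNset// mul0r.
- by apply/measurable_EFinP; exact: measurable_prod_fun.
rewrite integral0 => /esym/eqP; rewrite gt_eqF//.
elim/big_ind : _ => [|x y x0 y0|i _]; first by rewrite lte01.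
  exact: mule_gt0.
rewrite integral_indic ?setIT; [|by []|exact: measurable_ball].
by rewrite [X in (_ < X)%E](lebesgue_measure_ball _ (ltW e0)) lte_fin mulrn_wgt0.
Qed.

End lebesgue_tuples.

Section heat_integrals.
Context {R : realType} {d : nat} {L0 : delone R d}.
Local Notation Om := (pattern_space L0).
Local Notation Omega := (borel (pattern_space L0)).
Local Notation RR := (measurableTypeR R).
Local Notation tup := (d.-tuple RR).
Local Notation nu := (@lebesgue_tuple R d).
Variable mu : probability Omega R.
Local Notation H := (L2 mu).
Local Notation dot := (@L2dot _ _ _ mu).
Local Notation ip := (L2_inner mu).
Local Notation Lfun2 := (Lfun mu 2%:E).
Hypothesis mu_inv : flow_invariant mu.

(** A countable cover of the open set of pairs by products of a rational ball
    and an open set replaces the comparison of the product sigma-algebra with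
    the Borel sets of the product. *)
Lemma measurable_flow2 (g : Om -> R) : continuous g ->
  measurable_fun setT (fun p : tup * Omega => g (flow (tuple_rV p.1) p.2)).
Proof.
move=> cg; apply: (@measurability _ _ _ _ setT _ _ (RGenOInfty.measurableE R)) => //.
move=> _ [_ [a ->] <-]; rewrite setTI.
pose W p := [set x : Om | forall s, rat_ball p s -> a < g (flow s x)].
pose B p : set (tup * Omega) := (@tuple_rV R d @^-1` rat_ball p) `*` interior (W p).
rewrite (_ : _ @^-1` _ = \bigcup_p B p).
  apply: countable_bigcupT_measurable => // p; apply: measurableX.
    rewrite -[X in measurable X]setTI; apply: measurable_tuple_rV => //.
    by apply: sub_sigma_algebra; exact: ball_open.
  by apply: sub_sigma_algebra; exact: open_interior.
apply/seteqP; split=> [[s x]|[s x] [p _ [/= ps /interior_subset Wx]]].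
  rewrite /= in_itv/= andbT => ag.
  have : nbhs (flow (tuple_rV s) x) (g @^-1` [set y | a < y]).
    by apply: cg; exact: open_nbhs_nbhs (conj (@open_gt _ a) ag).
  move=> /nbhs_ballP[e /= e0 he].
  have [b b0 hb] := flow_continuous2 (tuple_rV s) x e0.
  have [p [ps pb]] := rat_ballP (tuple_rV s) b0.
  exists p => //; split=> //=; apply/nbhs_ballP; exists b => //= y xy s' ps'.
  by apply: he; apply: hb => //; exact: pb.
by rewrite /= in_itv/= andbT; exact: Wx.
Qed.

Lemma measurable_flow1 (g : Om -> R) (x : Om) : continuous g ->
  measurable_fun setT (fun s : tup => g (flow (tuple_rV s) x)).
Proof.
move=> cg; apply: (measurableT_comp (measurable_flow2 cg) (g := fun s : tup => (s, x : Omega))).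
exact: measurable_pair2.
Qed.

Variable t : R.
Hypothesis t0 : 0 < t.
Local Notation K := (fun s : tup => gauss_kernel t (tuple_rV s)).

Let mK : measurable_fun setT K. Proof. exact: measurable_gauss_kernel. Qed.
Let K0 s : 0 <= K s. Proof. exact: gauss_kernel_ge0. Qed.
Lemma gauss_kernel_integrable : nu.-integrable setT (EFin \o K).
Proof.
apply/integrableP; split; first exact/measurable_EFinP.
under eq_integral do rewrite /= ger0_norm//.
by rewrite integral_gauss_kernel// ltry.
Qed.

Lemma gauss_bounded_integrable (h : tup -> R) (M : R) :
  measurable_fun setT (fun s => K s * h s) -> (forall s, `|h s| <= M) ->
  nu.-integrable setT (EFin \o (fun s => K s * h s)).
Proof.
move=> mh hM; apply: (le_integrable _ _ _ (integrableZ_EFin M gauss_kernel_integrable)) => //.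
  exact/measurable_EFinP.
move=> s _ /=; rewrite lee_fin normrM ger0_norm// mulrC (le_trans _ (ler_norm _))//.
by rewrite ler_wpM2r.
Qed.

Lemma gauss_avg_le (h : tup -> R) (M : R) :
  measurable_fun setT (fun s => K s * h s) -> (forall s, `|h s| <= M) ->
  `|\int[nu]_s (K s * h s)| <= M.
Proof.
move=> mh hM; have ih := gauss_bounded_integrable mh hM.
apply: (le_trans (le_normr_Rintegral measurableT ih)).
have iKM := integrableZ_EFin M gauss_kernel_integrable.
apply: (le_trans (le_Rintegral measurableT (integrable_norm ih) iKM _)) => [s _ /=|].
  by rewrite normrM (ger0_norm (K0 s)) mulrC ler_wpM2r.
rewrite RintegralZl//; last exact: gauss_kernel_integrable.
by rewrite /Rintegral integral_gauss_kernel//= mulr1.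
Qed.

Definition heat_avg (g : Om -> R) (x : Om) : R :=
  \int[nu]_s (K s * g (flow (tuple_rV s) x)).

Section heat_avg_theory.
Variable g : Om -> R.
Hypotheses (cg : continuous g) (g1 : forall x, `|g x| <= 1).

Let mKg x : measurable_fun setT (fun s : tup => K s * g (flow (tuple_rV s) x)).
Proof. by apply: measurable_funM => //; exact: measurable_flow1. Qed.

Lemma heat_avg_integrable x :
  nu.-integrable setT (EFin \o (fun s => K s * g (flow (tuple_rV s) x))).
Proof. by apply: gauss_bounded_integrable => // s; exact: g1. Qed.

Lemma heat_avg_le x : `|heat_avg g x| <= 1.
Proof.
by apply: gauss_avg_le => // s; exact: g1.
Qed.

Variable w : Omega -> R.
Hypothesis w1 : mu.-integrable setT (EFin \o w).

Let F (p : tup * Omega) := ((K p.1 * g (flow (tuple_rV p.1) p.2)) * w p.2)%:E.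

Let mF : measurable_fun setT F.
Proof.
apply/measurable_EFinP; apply: measurable_funM.
  apply: measurable_funM; last exact: measurable_flow2.
  by apply: (measurableT_comp mK); exact: measurable_fst.
by apply: (measurableT_comp ((measurable_EFinP _ _).1 (measurable_int _ w1))); exact: measurable_snd.
Qed.

Let iF : (nu \x mu)%E.-integrable setT F.
Proof.
apply/integrable12ltyP => //.
have mw := measurable_int _ w1.
pose C := (\int[mu]_x `|(w x)%:E|)%E.
have Cfin : C \is a fin_num by exact: integrable_fin_num (integrable_abse w1).
apply: (@le_lt_trans _ _ (\int[nu]_s ((K s)%:E * C))%E).
  apply: ge0_le_integral => //.
  - by move=> s _; exact: integral_ge0.
  - apply: (measurable_fun_fubini_tonelli_F (m2 := mu) (abse \o F)) => //.
    exact: measurableT_comp.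
    by move=> p; exact: abse_ge0.
  - by apply: emeasurable_funM; [exact/measurable_EFinP|exact: measurable_cst].
  - move=> s _; rewrite -ge0_integralZl//; last 2 first.
      exact: measurableT_comp.
      by rewrite lee_fin.
    apply: ge0_le_integral => //.
    + apply: measurableT_comp => //; exact: (measurableT_comp mF (measurable_pair1 s)).
    + apply: emeasurable_funM; [exact: measurable_cst|exact: measurableT_comp].
    + move=> x _; rewrite /F /= -EFinM lee_fin normrM (normrM (gauss_kernel _ _)) (ger0_norm (K0 s)).
      by rewrite ler_wpM2r// ler_piMr.
rewrite ge0_integralZr//; last 3 first.
- exact/measurable_EFinP.
- by move=> s _; rewrite lee_fin.
- exact: integral_ge0.
by rewrite integral_gauss_kernel// mul1e ltey_eq Cfin.
Qed.

Lemma flow_mul_integrable s :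
  mu.-integrable setT (EFin \o (fun x : Omega => g (flow s x) * w x)).
Proof.
apply: (le_integrable _ _ _ w1) => //.
  apply/measurable_EFinP; apply: measurable_funM.
    by apply: (measurableT_comp (continuous_measurable cg)); exact: measurable_flow.
  by apply/measurable_EFinP; exact: measurable_int w1.
by move=> x _ /=; rewrite lee_fin normrM ler_piMl.
Qed.

Let F1 s : (\int[mu]_x F (s, x) = (K s * \int[mu]_x (g (flow (tuple_rV s) x) * w x))%:E)%E.
Proof.
have i1 := flow_mul_integrable (tuple_rV s).
rewrite EFinM /Rintegral fineK; last exact: (integrable_fin_num measurableT i1).
rewrite -(integralZl measurableT i1); apply: eq_integral => x _.
by rewrite /F /= -EFinM mulrA.
Qed.

Let F2 x : (\int[nu]_s F (s, x) = (heat_avg g x * w x)%:E)%E.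
Proof.
have i1 := heat_avg_integrable x.
rewrite EFinM /heat_avg /Rintegral fineK; last exact: (integrable_fin_num measurableT i1).
by rewrite -(integralZr measurableT i1); apply: eq_integral.
Qed.

(** The integrand is dominated by K s * |w x|, which is integrable for the
    product measure. *)
Lemma heat_avg_fubini :
  \int[mu]_x (heat_avg g x * w x) =
  \int[nu]_s (K s * \int[mu]_x (g (flow (tuple_rV s) x) * w x)).
Proof.
rewrite /Rintegral; congr fine.
transitivity (\int[mu]_x \int[nu]_s F (s, x))%E.
  by apply: eq_integral => x _; rewrite F2.
by rewrite -(Fubini iF); apply: eq_integral => s _; rewrite F1.
Qed.

Lemma measurable_gauss_correlation :
  measurable_fun setT (fun s : tup => K s * \int[mu]_x (g (flow (tuple_rV s) x) * w x)).
Proof.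
apply/measurable_EFinP; rewrite (_ : _ \o _ = fubini_F mu F).
  exact: measurable_fubini_F iF.
by apply/funext => s; rewrite /fubini_F F1.
Qed.

Lemma measurable_heat_avg_mul : measurable_fun setT (fun x : Omega => heat_avg g x * w x).
Proof.
apply/measurable_EFinP; rewrite (_ : _ \o _ = fubini_G nu F).
  exact: measurable_fubini_G iF.
by apply/funext => s; rewrite /fubini_G F2.
Qed.

End heat_avg_theory.

Lemma measurable_heat_avg (g : Om -> R) : continuous g -> (forall x, `|g x| <= 1) ->
  measurable_fun setT (heat_avg g : Omega -> R).
Proof.
move=> cg g1.
have i1 : mu.-integrable setT (EFin \o (cst 1 : Omega -> R)) by exact: finite_measure_integrable_cst.
have := measurable_heat_avg_mul cg g1 i1.
by under eq_fun do rewrite /cst mulr1.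
Qed.

(** Transports the complex integral over row vectors to the real one over
    tuples, where Lebesgue measure is a product. *)
Lemma heat_integralE (g : Om -> R) (x : Omega) : continuous g -> (forall x, `|g x| <= 1) ->
  heat_integral t (fun y : Omega => (g y)%:C%C) x = (heat_avg g x)%:C%C.
Proof.
move=> cg g1; rewrite /heat_integral /cintegral; apply: complex_ext; last first.
  rewrite [LHS]/= integral0_eq// => s _.
  by rewrite mulr0 mul0r addr0.
rewrite [LHS]/= [RHS]/= /heat_avg /Rintegral; congr fine.
pose h (s : borel 'rV[R]_d) : \bar R := (gauss_kernel t s * g (flow s x))%:E.
transitivity (\int[lebesgue_rV (d := d)]_s h s)%E.
  by apply: eq_integral => s _; rewrite /= mul0r subr0.
have mcoord (i : 'I_d) : measurable_fun setT (fun s : borel 'rV[R]_d => s 0 i : R).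
  by apply: (@continuous_measurable R 'rV[R]_d); exact: coord_continuous.
have mh : measurable_fun setT h.
  apply/measurable_EFinP; apply: measurable_funM.
    apply: measurable_funM; first exact: measurable_cst.
    rewrite (_ : (fun s => _) = (fun s : borel 'rV[R]_d => expR (- (\sum_i s 0 i * s 0 i) / (2 * t)))).
      apply: measurableT_comp => //; apply: measurable_funM; last exact: measurable_cst.
      apply: measurableT_comp => //; apply: measurable_sum => i.
      exact: measurable_funM.
    by apply/funext => s; rewrite sqr_sqrtr ?dotp_ge0// mulNr.
  apply: (@continuous_measurable R 'rV[R]_d (fun s => g (flow s x))) => s.
  apply: (@continuous_comp _ _ _ (fun s => flow s x) g); last exact: cg.
  apply/(@cvg_ballP R Om _ _ (nbhs_filter s)) => e e0; have [a a0 ha] := flow_continuous2 s x e0.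
  by apply/nbhs_ballP; exists a => //= y xy; apply: ha => //; exact: ballxx.
have := @integral_pushforward _ _ _ _ R (@tuple_rV R d) (@measurable_tuple_rV R d) nu setT h mh.
rewrite preimage_setT; apply => //; exact: heat_avg_integrable.
Qed.

End heat_integrals.

(** * The heat semigroup as an average of Koopman operators *)

Section weak_formula.
Context {R : realType} {d : nat} {L0 : delone R d}.
Local Notation Om := (pattern_space L0).
Local Notation Omega := (borel (pattern_space L0)).
Local Notation RR := (measurableTypeR R).
Local Notation tup := (d.-tuple RR).
Local Notation nu := (@lebesgue_tuple R d).
Variable mu : probability Omega R.
Local Notation H := (L2 mu).
Local Notation dot := (@L2dot _ _ _ mu).
Local Notation ip := (L2_inner mu).
Local Notation Lfun2 := (Lfun mu 2%:E).
Hypothesis mu_inv : flow_invariant mu.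

Lemma rdot_rclassl (h : Omega -> R) (v : H) : h \in Lfun2 ->
  rdot dot (rclass mu h) v = \int[mu]_x (h x * re_part v x).
Proof.
move=> h2; rewrite {1}[v]L2_parts (rdotDr ip) (rdot_rclass h2 (re_partP v)).
rewrite (rdotC ip) (rdotZJ ip) /rdot (dotZr ip) conjCK.
rewrite L2dot_class ?rclass_sq ?im_partP// cReM /= mul0r sub0r mul1r.
rewrite [X in - X + _](_ : _ = 0) ?oppr0 ?add0r//.
rewrite [X in fine X](_ : _ = 0)%E// integral0_eq// => x _.
by rewrite mulr0 mul0r addr0.
Qed.

Lemma continuous_Lfun2 (g : Om -> R) : continuous g -> (forall x, `|g x| <= 1) ->
  (g : Omega -> R) \in Lfun2.
Proof. by move=> cg g1; exact: (Lfun2_bounded mu (continuous_measurable cg) g1). Qed.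

Lemma koopmanB s u v : koopman mu s (u - v) = koopman mu s u - koopman mu s v.
Proof.
by rewrite addrC -scaleN1r (koopman_linear mu_inv) scaleN1r addrC.
Qed.

Lemma koopman_zero s : koopman mu s 0 = 0.
Proof. by rewrite -[X in koopman _ _ X](subrr 0) koopmanB subrr. Qed.

Lemma koopman_nrm s u : nrm dot (koopman mu s u) = nrm dot u.
Proof. by rewrite /nrm koopman_dot. Qed.

(** Dominated convergence settles bounded continuous functions, and isometry
    passes to the closure. *)
Lemma koopman_cvg (u : H) (s : nat -> 'rV[R]_d) s0 : s n @[n --> \oo] --> s0 ->
  nrm dot (koopman mu (s n) u - koopman mu s0 u) @[n --> \oo] --> (0 : R).
Proof.
move=> ss0; move: u.
apply: (@closed_subspace_continuous _ _ _ mu (fun u =>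
  nrm dot (koopman mu (s n) u - koopman mu s0 u) @[n --> \oo] --> (0 : R))).
  split; first split.
  - rewrite (_ : (fun n => _) = cst 0); first exact: cvg_cst.
    by apply/funext => n; rewrite !koopman_zero subrr (nrm0 ip).
  - move=> a u v hu hv.
    apply: (@squeeze_cvgr _ _ _ _ (cst 0) (fun n => complex.Re `|a| *
        nrm dot (koopman mu (s n) u - koopman mu s0 u) +
        nrm dot (koopman mu (s n) v - koopman mu s0 v))).
    + apply: nearW => n; rewrite nrm_ge0 /= !(koopman_linear mu_inv) opprD addrACA.
      by rewrite -scalerBr -(nrmZ ip) (nrmD ip).
    + exact: cvg_cst.
    + rewrite -[X in _ --> X]addr0 -[X in _ --> X + _](mulr0 (complex.Re `|a|)).
      apply: cvgD; last exact: hv.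
      by apply: cvgMr; exact: hu.
  - move=> u hu; apply/cvg0_ltP => [n|e e0]; first exact: nrm_ge0.
    have [v hv vu] := hu (e / 3) (divr_gt0 e0 (ltr0n _ 3)).
    have {}hv := (cvg0_ltP (fun n => nrm_ge0 _ _)).1 hv _ (divr_gt0 e0 (ltr0n _ 3)).
    have [N _ hN] := hv; exists N => // n /hN /= hn.
    have h1 : nrm dot (koopman mu (s n) u - koopman mu (s n) v) = nrm dot (v - u).
      by rewrite -koopmanB koopman_nrm (nrmBC ip).
    have h2 : nrm dot (koopman mu s0 v - koopman mu s0 u) = nrm dot (v - u).
      by rewrite -koopmanB koopman_nrm.
    have h3 := nrmB_le ip (koopman mu (s n) v) (koopman mu (s n) u) (koopman mu s0 u).
    have h4 := nrmB_le ip (koopman mu s0 v) (koopman mu (s n) v) (koopman mu s0 u).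
    rewrite h1 in h3; rewrite h2 in h4.
    move: vu hn h3 h4; clear.
    move: (nrm _ (v - u)) (nrm _ (_ - koopman mu s0 v)) => a b.
    move: (nrm _ (koopman mu (s n) v - _)) (nrm _ (koopman mu (s n) u - _)) => c f.
    by lra.
move=> g cg g1; have g2 := continuous_Lfun2 cg g1.
rewrite (_ : (fun n => _) = (fun n => nrm dot (rclass mu (g \o flow (s n)) - rclass mu (g \o flow s0)))).
  apply: (@rclass_dominated _ _ _ mu _ _ (cst 1)).
  - exact: Lfun_cst.
  - exact: Lfun2_flow.
  - move=> n; apply: (measurableT_comp (continuous_measurable cg)); exact: measurable_flow.
  - by move=> n x; exact: g1.
  - move=> x; apply: (@continuous_cvg _ _ _ (\oo) _ _ g); first exact: cg.
    apply/(@cvg_ballP R Om) => e e0; have [a a0 ha] := flow_continuous2 s0 x e0.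
    have /cvg_ballP/(_ a a0) := ss0; apply: filterS => n sn; apply: ha => //; exact: ballxx.
by apply/funext => n; rewrite !koopman_rclass.
Qed.

Variables (P : R -> H -> H).
Hypothesis P_heat : heat_semigroup P.
Variable t : R.
Hypothesis t0 : 0 < t.
Local Notation K := (fun s : tup => gauss_kernel t (tuple_rV s)).

Lemma heat_rclass (g : Om -> R) : continuous g -> (forall x, `|g x| <= 1) ->
  P t (rclass mu g) = rclass mu (heat_avg t g).
Proof.
move=> cg g1; rewrite /rclass P_heat.2//.
  by congr (L2class mu _); apply/funext => x; rewrite heat_integralE.
move=> x; apply/(@cvgrPdist_lt _ R[i]^o _ _ (nbhs_filter x)) => e e0.
have e0' : 0 < complex.Re e by move: e0; rewrite ltcE /= => /andP[].
have := cg x => /(@cvgrPdist_lt _ R^o _ _ (nbhs_filter x))/(_ _ e0').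
apply: filterS => y; rewrite -rmorphB normcRe /= expr0n /= addr0 sqrtr_sqr.
by move=> h; rewrite ltcE /= h andbT; move: e0; rewrite ltcE /= => /andP[].
Qed.

Let Plin : linear (P t). Proof. by have [h _ _] := P_heat.1; have [] := h t t0. Qed.
Let Pcontr u : nrm dot (P t u) <= nrm dot u.
Proof. have [h _ _] := P_heat.1; have [_ h2 _] := h t t0; exact: h2. Qed.

Let PB u v : P t (u - v) = P t u - P t v.
Proof. by rewrite addrC -scaleN1r Plin scaleN1r addrC. Qed.

Lemma koopman_rdot_le s u v : `|rdot dot (koopman mu s u) v| <= nrm dot u * nrm dot v.
Proof. by rewrite -(koopman_nrm s u) (rdot_le ip). Qed.

(** Measurability of the correlation is part of the property, so that it
    passes to limits in u together with the formula. *)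
Definition heat_weak u v :=
  measurable_fun setT (fun s : tup => K s * rdot dot (koopman mu (tuple_rV s) u) v) /\
  rdot dot (P t u) v = \int[nu]_s (K s * rdot dot (koopman mu (tuple_rV s) u) v).

Lemma heat_weak_integrable u v : heat_weak u v ->
  nu.-integrable setT (EFin \o (fun s : tup => K s * rdot dot (koopman mu (tuple_rV s) u) v)).
Proof.
move=> [m1 _]; apply: (gauss_bounded_integrable t0 m1 (M := nrm dot u * nrm dot v)) => s.
exact: koopman_rdot_le.
Qed.

Lemma heat_weak_continuous (g : Om -> R) v : continuous g -> (forall x, `|g x| <= 1) ->
  heat_weak (rclass mu g) v.
Proof.
move=> cg g1; have g2 := continuous_Lfun2 cg g1.
have w1 : mu.-integrable setT (EFin \o re_part v).
  apply/Lfun1_integrable; apply: (Lfun_subset12 _ (re_partP v)).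
  by rewrite [X in X \is a _]probability_setT.
have e s : rdot dot (koopman mu (tuple_rV s) (rclass mu g)) v =
    \int[mu]_x (g (flow (tuple_rV s) x) * re_part v x).
  by rewrite koopman_rclass// rdot_rclassl//; exact: Lfun2_flow.
rewrite /heat_weak; under eq_fun do rewrite e.
split; first exact: measurable_gauss_correlation.
rewrite heat_rclass// rdot_rclassl; last first.
  apply: (Lfun2_bounded mu (M := 1)); first exact: measurable_heat_avg.
  by move=> x; exact: (heat_avg_le t0 cg g1).
rewrite heat_avg_fubini//.
Qed.

(** The vectors u that satisfy it for all v form a closed subspace, since
    both sides are bounded by |u| |v|. *)
Theorem heat_weak_formula u v : heat_weak u v.
Proof.
move: u v; apply: (@closed_subspace_continuous _ _ _ mu (fun u => forall v, heat_weak u v)); last first.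
  by move=> g cg g1 v; exact: heat_weak_continuous.
split; first split.
- move=> v; rewrite /heat_weak.
  have e s : K s * rdot dot (koopman mu (tuple_rV s) 0) v = 0.
    by rewrite koopman_zero /rdot (dot0l ip) mulr0.
  under eq_fun do rewrite e; split; first exact: measurable_cst.
  rewrite /Rintegral integral0 /= -[X in P t X](subrr 0) PB subrr.
  by rewrite /rdot (dot0l ip).
- move=> a u w hu hw v.
  have h1 := hu (a^* *: v); have h2 := hw v.
  have e s : K s * rdot dot (koopman mu (tuple_rV s) (a *: u + w)) v =
      K s * rdot dot (koopman mu (tuple_rV s) u) (a^* *: v) +
      K s * rdot dot (koopman mu (tuple_rV s) w) v.
    by rewrite (koopman_linear mu_inv) (rdotDl ip) (rdotZJ ip) mulrDr.
  rewrite /heat_weak; under eq_fun do rewrite e; split.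
    by apply: measurable_funD; [exact: h1.1|exact: h2.1].
  rewrite RintegralD//; [|exact: heat_weak_integrable..].
  by rewrite -h1.2 -h2.2 Plin (rdotDl ip) (rdotZJ ip).
- move=> u hu v.
  have /choice[u_ hu_] (n : nat) : exists w, (forall v, heat_weak w v) /\ nrm dot (w - u) < n.+1%:R^-1.
    have n0 : 0 < n.+1%:R^-1 :> R by rewrite invr_gt0.
    by have [w ? ?] := hu _ n0; exists w.
  have u_u : nrm dot (u_ n - u) @[n --> \oo] --> (0 : R).
    apply: (@squeeze_cvgr _ _ _ _ (cst 0) (fun n => n.+1%:R^-1)).
    + by apply: nearW => n; rewrite nrm_ge0 /= ltW//; exact: (hu_ n).2.
    + exact: cvg_cst.
    + exact: cvg_harmonic.
  have m1 : measurable_fun setT (fun s : tup => K s * rdot dot (koopman mu (tuple_rV s) u) v).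
    apply: (@measurable_fun_cvg _ _ _ setT (fun n (s : tup) => K s * rdot dot (koopman mu (tuple_rV s) (u_ n)) v) _).
      by move=> n; exact: ((hu_ n).1 v).1.
    move=> s _; apply: cvgMr; apply: (rdot_cvg ip).
    by under eq_fun do rewrite -koopmanB koopman_nrm.
  split=> //; apply/eqP; rewrite -subr_eq0 -normr_le0; apply/ler_addgt0Pl => e e0; rewrite addr0.
  have v1 : 0 < 2 * nrm dot v + 1 by rewrite ltr_wpDl// mulr_ge0 ?nrm_ge0.
  have [w hw wu] := hu _ (divr_gt0 e0 v1).
  have [mw Pw] := hw v.
  have iw := heat_weak_integrable (hw v).
  have iu : nu.-integrable setT (EFin \o (fun s : tup => K s * rdot dot (koopman mu (tuple_rV s) u) v)).
    apply: (gauss_bounded_integrable t0 m1 (M := nrm dot u * nrm dot v)) => s.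
    exact: koopman_rdot_le.
  have eqd (s : tup) : K s * rdot dot (koopman mu (tuple_rV s) w) v - K s * rdot dot (koopman mu (tuple_rV s) u) v
      = K s * rdot dot (koopman mu (tuple_rV s) (w - u)) v.
    by rewrite koopmanB (rdotBl ip) mulrBr.
  have b1 : `|rdot dot (P t u) v - rdot dot (P t w) v| <= nrm dot (w - u) * nrm dot v.
    rewrite -(rdotBl ip) -PB (le_trans (rdot_le ip _ _))// ler_wpM2r ?nrm_ge0//.
    by rewrite (nrmBC ip) Pcontr.
  have b2 : `|rdot dot (P t w) v - \int[nu]_s (K s * rdot dot (koopman mu (tuple_rV s) u) v)|
      <= nrm dot (w - u) * nrm dot v.
    rewrite Pw -RintegralB//; under eq_Rintegral do rewrite eqd.
    apply: (gauss_avg_le t0); last by move=> s; exact: koopman_rdot_le.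
    by under eq_fun do rewrite -eqd; exact: measurable_funB.
  rewrite -(subrKA (rdot dot (P t w) v)) (le_trans (ler_normD _ _))//.
  apply: (le_trans (lerD b1 b2)); rewrite -mulr2n -mulr_natl mulrCA.
  apply: (@le_trans _ _ (nrm dot (w - u) * (2 * nrm dot v + 1))).
    by rewrite ler_wpM2l ?nrm_ge0// lerDl.
  by rewrite -ler_pdivlMr// ltW.
Qed.

End weak_formula.

(** * Ergodicity *)

Section ergodicity.
Context {R : realType} {d : nat} {L0 : delone R d}.
Local Notation Om := (pattern_space L0).
Local Notation Omega := (borel (pattern_space L0)).
Variable mu : probability Omega R.
Hypothesis mu_ue : uniquely_ergodic mu.
Local Notation H := (L2 mu).
Local Notation dot := (@L2dot _ _ _ mu).
Local Notation ip := (L2_inner mu).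
Local Notation Lfun2 := (Lfun mu 2%:E).

Let mu_inv : flow_invariant mu. Proof. exact: mu_ue.1. Qed.

Lemma measure_ae_eq (A B : set Omega) : measurable A -> measurable B ->
  (\forall x \ae mu, A x <-> B x) -> mu A = mu B.
Proof.
move=> mA mB AB; rewrite -[A]setIT -[B]setIT -!integral_indic//.
apply: ae_eq_integral => //; [exact/measurable_EFinP/measurable_indic..|].
apply: filterS AB => x AB _ /=; congr (EFin _); rewrite !indicE.
by congr (nat_of_bool _)%:R; apply/idP/idP; rewrite !inE => /AB.
Qed.

(** Conditioning mu on an invariant set of positive measure gives another
    invariant probability, which unique ergodicity identifies with mu. *)
Lemma invariant_set01 (A : set Omega) : measurable A ->
  (forall s, \forall x \ae mu, A (flow s x) <-> A x) -> mu A = 0%E \/ mu A = 1%E.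
Proof.
move=> mA Ainv; have [A0|A0] := eqVneq (mu A) 0%E; [by left|right].
pose nu := mnormalize (mrestr mu mA) mu.
have nuE B : nu B = (mu (B `&` A) * ((fine (mu A))^-1)%:E)%E.
  have e : mrestr mu mA setT = mu A by rewrite /mrestr setTI.
  rewrite /nu /mnormalize /= e (negbTE A0) /=; case: eqP => // Aoo.
  by have := fin_num_measure mu A mA; rewrite fin_numE => /andP[_ /eqP[]]; exact: Aoo.
have nu_inv : flow_invariant nu.
  move=> s B mB; have mfB : measurable (flow s @^-1` B : set Omega).
    by rewrite -[X in measurable X]setTI; exact: measurable_flow.
  rewrite [LHS]nuE [RHS]nuE; congr (_ * _)%E.
  rewrite -[RHS](mu_inv s); last exact: measurableI.
  rewrite preimage_setI; apply: measure_ae_eq; first exact: measurableI.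
    apply: measurableI => //.
    by rewrite -[X in measurable X]setTI; exact: measurable_flow.
  by apply: ae_mono (Ainv s) => x Ax; split=> -[? /Ax].
have := mu_ue.2 _ nu_inv A mA; rewrite [X in X = _ -> _]nuE setIid => <-.
have Afin := fin_num_measure mu A mA.
rewrite -[X in (X * _)%E]fineK// -EFinM divff//.
by apply: contra A0 => /eqP A0; rewrite -[mu A]fineK// A0.
Qed.

(** The set where g exceeds its mean is invariant, hence null or of full
    measure; in both cases g - m has constant sign almost everywhere and
    integral 0. *)
Lemma ergodic_real (g : Omega -> R) : g \in Lfun2 ->
  (forall s, \forall x \ae mu, g (flow s x) = g x) ->
  exists c, \forall x \ae mu, g x = c.
Proof.
move=> g2 ginv; have mg : measurable_fun setT g by move: g2; rewrite inE => /andP[/[!inE]].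
have ig : mu.-integrable setT (EFin \o g).
  apply/Lfun1_integrable; apply: (Lfun_subset12 _ g2).
  by rewrite [X in X \is a _]probability_setT.
pose m := \int[mu]_x g x; exists m.
have im : mu.-integrable setT (EFin \o (cst m : Omega -> R)) by exact: finite_measure_integrable_cst.
pose h x := g x - m.
have ih : mu.-integrable setT (EFin \o h) by exact: integrableB_EFin.
have h0 : \int[mu]_x h x = 0.
  by rewrite RintegralB// Rintegral_cst// [X in m * fine X]probability_setT /= mulr1 subrr.
have mh := measurable_int _ ih.
pose A : set Omega := [set x | 0 < h x].
have mA : measurable A.
  have mhR : measurable_fun setT h by exact/measurable_EFinP.
  rewrite (_ : A = setT `&` h @^-1` `]0, +oo[).
    by apply: mhR => //; exact: measurable_itv.
  by rewrite setTI; apply/seteqP; split=> x; rewrite /A /= in_itv/= andbT.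
have Ainv s : \forall x \ae mu, A (flow s x) <-> A x.
  by apply: ae_mono (ginv s) => x gx; rewrite /A /h /= gx.
(* b is true when A is null, that is when h <= 0 almost everywhere. *)
have sgn : exists b : bool, \forall x \ae mu, `|h x| = (-1) ^+ b * h x.
  have [A0|A1] := invariant_set01 mA Ainv.
    exists true; exists A; split=> // x /= hx; rewrite /A /= ltNge; apply/negP => hx0.
    by apply: hx; rewrite ler0_norm// expr1 mulN1r.
  exists false; exists (~` A); split=> //.
  - exact: measurableC.
  - by rewrite probability_setC// A1 subee.
  - by move=> x /= hx Ax; apply: hx; rewrite gtr0_norm// mul1r.
have [b hb] := sgn.
have : (\int[mu]_x `|(EFin \o h) x| = 0)%E.
  have ihn := integrable_abse ih.
  rewrite -[LHS]fineK; last exact: (integrable_fin_num measurableT ihn).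
  congr EFin; rewrite -[LHS]/(\int[mu]_x `|h x|).
  rewrite (ae_eq_Rintegral _ _ hb).
  - by rewrite RintegralZl// h0 mulr0.
  - by apply: measurableT_comp => //; exact/measurable_EFinP.
  - by apply: measurable_funM => //; exact/measurable_EFinP.
move=> /(ae_eq_integral_abs _ measurableT mh); apply: ae_mono => x /(_ I) [] /eqP.
by rewrite subr_eq0 => /eqP.
Qed.

(** The real and imaginary parts of a representative are invariant almost
    everywhere under each translation, the null set depending on it. *)
Theorem koopman_invariant_constant (u : H) : (forall s, koopman mu s u = u) ->
  exists c, u = c *: L2class mu (fun=> 1).
Proof.
move=> Uu; have ae s : \forall x \ae mu, sqrint_fun (repr u) (flow s x) = sqrint_fun (repr u) x.
  have := repr_L2class (sq_flow mu_inv s (repr_sq u)).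
  rewrite -[L2class _ _]/(koopman mu s u) Uu.
  by apply: ae_mono => x ->.
have [a ha] : exists a, \forall x \ae mu, re_part u x = a.
  by apply: ergodic_real (re_partP u) _ => s; apply: ae_mono (ae s) => x; rewrite /re_part => ->.
have [b hb] : exists b, \forall x \ae mu, im_part u x = b.
  by apply: ergodic_real (im_partP u) _ => s; apply: ae_mono (ae s) => x; rewrite /im_part => ->.
exists (a +i* b)%C.
have s1 : (fun=> 1 : R[i]) \in sqr_integrable mu.
  exact: (rclass_sq (Lfun_cst mu 1 2)).
rewrite -[RHS]addr0 -(L2class0 mu) -L2classP ?sq0// -[LHS]L2class_repr.
apply: eq_L2class; first exact: repr_sq.
  by apply: sq_lin => //; exact: sq0.
apply: ae_mono2 ha hb => x xa xb; apply: complex_ext; rewrite mulr1 addr0 /=.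
  exact: xa.
exact: xb.
Qed.

End ergodicity.

(** * Projection-valued measures *)

Section point_mass.
Import HBNNSimple.
Context {disp : measure_display} {T : measurableType disp} {R : realType}.

(** The integral only evaluates the set function on measurable sets. This
    allows spectral measures, which are not given as measures, to be compared
    with one. *)
Lemma eq_set_function_integral (m1 m2 : set T -> \bar R) (f : T -> \bar R) :
  (forall A, measurable A -> m1 A = m2 A) ->
  (\int[m1]_x f x = \int[m2]_x f x)%E.
Proof.
move=> m12; rewrite /integral.
have sE (h : {nnsfun T >-> R}) : sintegral m1 h = sintegral m2 h.
  by apply: eq_fsbigr => r _; rewrite m12.
by congr (ereal_sup _ - ereal_sup _)%E; apply: eq_imagel => h _; exact: sE.
Qed.

Lemma integral_point_mass (m : set T -> \bar R) (a : T) (c : R) (f : T -> R) :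
  0 <= c -> measurable_fun setT f ->
  (forall A, measurable A -> m A = (c * (a \in A)%:R)%:E) ->
  fine (\int[m]_x (f x)%:E)%E = c * f a.
Proof.
move=> c0 mf hm; pose k := NngNum c0.
rewrite (@eq_set_function_integral m (mscale k (\d_a : set T -> \bar R))); last first.
  by move=> A mA; rewrite hm// /mscale/= EFinM diracE.
have mE : measurable_fun setT (EFin \o f) by exact/measurable_EFinP.
rewrite integralE !ge0_integral_mscale//; [|exact: measurable_funeneg|exact: measurable_funepos].
rewrite !integral_dirac//; [|exact: measurable_funeneg|exact: measurable_funepos].
rewrite !diracT !mul1e funeposE funenegE /= -!EFin_max -!EFinM -EFinB /=.
have max0 (x : R) : Num.max x 0 - Num.max (- x) 0 = x.
  have [h|h] := leP 0 x; last by rewrite (max_idPl _) ?oppr_ge0 ?ltW// sub0r opprK.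
  by rewrite (max_idPr _) ?oppr_le0// subr0.
by rewrite -mulrBr; congr (_ * _); exact: max0.
Qed.

End point_mass.

Section spectral_resolution.
Context {disp : measure_display} {T : measurableType disp} {R : realType}.
Variable mu : {measure set T -> \bar R}.
Local Notation H := (L2 mu).
Local Notation dot := (@L2dot _ _ _ mu).
Local Notation ip := (L2_inner mu).
Local Notation nrm := (nrm dot).
Context {d : nat}.
Local Notation Rd := (borel 'rV[R]_d).
Variable E : set Rd -> H -> H.
Hypothesis pvm : projection_valued_measure E.

Let E_self_adjoint A u v : measurable A -> dot (E A u) v = dot u (E A v).
Proof. by move=> mA; have [h _ _] := pvm; have [_ h2 _] := h A mA; exact: h2. Qed.
Let E_idem A u : measurable A -> E A (E A u) = E A u.
Proof.
by move=> mA; have [h _ _] := pvm; have [_ _ h2] := h A mA; exact: (congr1 (fun g => g u) h2).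
Qed.
Let E_setT u : E setT u = u.
Proof. by have [_ h _] := pvm; rewrite h. Qed.
Let E_sigma (F : nat -> set Rd) u : (forall n, measurable (F n)) -> trivIset setT F ->
  nrm (\sum_(0 <= k < n) E (F k) u - E (\bigcup_n F n) u) @[n --> \oo] --> (0 : R).
Proof.
move=> mF tF; have [_ _ /(_ F mF tF u)] := pvm.
by under eq_fun => n do rewrite -[L2norm _]/(nrm _) (nrmBC ip).
Qed.

Lemma pvm_dot A u : measurable A -> dot (E A u) u = (nrm (E A u) ^+ 2)%:C%C.
Proof. by move=> mA; rewrite -(dot_nrm ip) -E_self_adjoint// E_idem. Qed.

Lemma pvm_rdot A u : measurable A -> rdot dot (E A u) u = nrm (E A u) ^+ 2.
Proof. by move=> mA; rewrite /rdot pvm_dot. Qed.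

Lemma pvm_nrm_sigma (F : nat -> set Rd) u : (forall n, measurable (F n)) -> trivIset setT F ->
  \sum_(0 <= k < n) nrm (E (F k) u) ^+ 2 @[n --> \oo] --> nrm (E (\bigcup_n F n) u) ^+ 2.
Proof.
move=> mF tF; have := rdot_cvg ip (v := u) (E_sigma u mF tF).
rewrite pvm_rdot; last exact: bigcup_measurable.
move=> h; have -> : (fun n => \sum_(0 <= k < n) nrm (E (F k) u) ^+ 2) =
  (fun n => rdot dot (\sum_(0 <= k < n) E (F k) u) u); last exact: h.
apply/funext => n; elim: n => [|n ih]; first by rewrite !big_geq// /rdot (dot0l ip).
by rewrite !big_nat_recr//= ih (rdotDl ip) pvm_rdot.
Qed.

(** Countable additivity along the constant sequence set0. *)
Lemma pvm_set0 u : E set0 u = 0.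
Proof.
have m0 (n : nat) : measurable (set0 : set Rd) by [].
have t0 : trivIset setT (fun _ : nat => set0 : set Rd) by apply/trivIsetP => i j _ _ _; rewrite setI0.
have := pvm_nrm_sigma (u := u) m0 t0; rewrite bigcup0// => h.
apply: (nrm_eq0 ip); apply/eqP; rewrite -sqrf_eq0; apply/eqP.
set c := _ ^+ 2 in h *; have c0 : 0 <= c by exact: sqr_ge0.
apply/eqP; rewrite eq_le c0 andbT leNgt; apply/negP => cpos.
have /cvgrPdist_lt/(_ c cpos)[N _ /(_ N.+2)] := h.
move=> /(_ (leq_trans (leqnSn _) (leqnSn _))) /=.
rewrite sumr_const_nat subn0 mulrS opprD addrA subrr sub0r normrN ger0_norm ?mulrn_wge0//.
by rewrite mulrS gtrDl ltNge mulrn_wge0.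
Qed.

Lemma pvm_nrmU A B u : measurable A -> measurable B -> A `&` B = set0 ->
  nrm (E (A `|` B) u) ^+ 2 = nrm (E A u) ^+ 2 + nrm (E B u) ^+ 2.
Proof.
move=> mA mB AB; pose F := bigcup2 A B.
have mF n : measurable (F n) by rewrite /F; case: n => [|[|n]] /=.
have tF : trivIset setT F by rewrite -trivIset_bigcup2.
have := pvm_nrm_sigma (u := u) mF tF; rewrite bigcup2E => h.
apply: (@cvg_unique _ (@Rhausdorff R) _ _ _ _ h).
apply: cvg_near_cst; exists 2%N => // n /= n2.
rewrite -(subnK n2) addn2 !big_nat_recl//= big1_seq ?addr0// => i _.
by rewrite pvm_set0 (nrm0 ip) expr0n.
Qed.

Lemma pvm_nrm_le A B u : measurable A -> measurable B -> A `<=` B ->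
  nrm (E A u) ^+ 2 <= nrm (E B u) ^+ 2.
Proof.
move=> mA mB AB; rewrite -(setDUK AB) pvm_nrmU ?lerDl ?sqr_ge0//.
  exact: measurableD.
by apply/seteqP; split=> x // -[Ax [_]].
Qed.

Lemma pvm_null_sub A B u : measurable A -> measurable B -> A `<=` B -> E B u = 0 -> E A u = 0.
Proof.
move=> mA mB AB B0; apply: (nrm_eq0 ip); apply/eqP; rewrite -sqrf_eq0 eq_le sqr_ge0 andbT.
by rewrite (le_trans (pvm_nrm_le u mA mB AB))// B0 (nrm0 ip) expr0n.
Qed.

Lemma pvm_null_bigcup (V : nat -> set Rd) u : (forall n, measurable (V n)) ->
  (forall n, E (V n) u = 0) -> E (\bigcup_n V n) u = 0.
Proof.
move=> mV V0; rewrite seqDU_bigcup_eq.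
have mS n : measurable (seqDU V n).
  by apply: measurableD => //; apply: bigsetU_measurable => i _.
have := pvm_nrm_sigma (u := u) mS (@trivIset_seqDU _ V) => h.
apply: (nrm_eq0 ip); apply/eqP; rewrite -sqrf_eq0; apply/eqP.
apply: (@cvg_unique _ (@Rhausdorff R) _ _ _ _ h).
apply: cvg_near_cst; apply: nearW => n; rewrite big1// => k _.
rewrite (pvm_null_sub (mS k) (mV k) _ (V0 k)) ?(nrm0 ip) ?expr0n//.
exact: subset_seqDU.
Qed.

Lemma measurable_set1_rV (a : 'rV[R]_d) : measurable ([set a] : set Rd).
Proof.
rewrite -[X in measurable X]setCK; apply: measurableC; apply: sub_sigma_algebra.
by apply: closed_openC; apply: accessible_closed_set1; apply: hausdorff_accessible; exact: norm_hausdorff.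
Qed.

Lemma pvm_nrmC A u : measurable A -> nrm (E A u) ^+ 2 + nrm (E (~` A) u) ^+ 2 = nrm u ^+ 2.
Proof.
move=> mA; rewrite -pvm_nrmU ?setUv ?E_setT//; last by rewrite setICr.
exact: measurableC.
Qed.

(** w is fixed by E {a} and killed by the projection of the complement. *)
Lemma pvm_point (a : 'rV[R]_d) u (w := E [set a] u) B : measurable B ->
  nrm (E B w) ^+ 2 = nrm w ^+ 2 * (a \in B)%:R.
Proof.
move=> mB; have ma := measurable_set1_rV a.
have wa : E [set a] w = w by rewrite E_idem.
have wC : E (~` [set a]) w = 0.
  apply: (nrm_eq0 ip); apply/eqP; rewrite -sqrf_eq0; apply/eqP.
  by have := pvm_nrmC w ma; rewrite wa => /eqP; rewrite -subr_eq0 addrAC subrr add0r => /eqP.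
have out (C : set Rd) : measurable C -> ~ C a -> nrm (E C w) ^+ 2 = 0.
  move=> mC Ca; rewrite (pvm_null_sub mC _ _ wC) ?(nrm0 ip) ?expr0n//; first exact: measurableC.
  by move=> b Cb ba; apply: Ca; rewrite -ba.
have [aB|aB] := pselect (B a); last by rewrite memNset// mulr0 out.
rewrite mem_set// mulr1 -(pvm_nrmC w mB) (out (~` B)) ?addr0//.
exact: measurableC.
Qed.

Variable U : 'rV[R]_d -> H -> H.
Hypothesis U_dot : forall t u v, dot (U t u) (U t v) = dot u v.
Hypothesis resolution : forall t u, L2dot (U t u) u =
  cintegral (spectral_measure E u) (fun a : Rd => expi (2 * pi * dotp t a)).

(** The spectral measure of a vector w in the range of E {a} sits at a, so
    <U_t w, w> = expi (2 pi <t, a>) |w|^2 and the Cauchy-Schwarz inequality is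
    an equality. *)
Lemma pvm_point_eigenvector a u t (w := E [set a] u) :
  U t w = expi (2 * pi * dotp t a) *: w.
Proof.
set z := expi _.
have zz : `|z| = 1 by rewrite normcRe /= cos2Dsin2 sqrtr1.
have mdot : measurable_fun setT (fun b : Rd => 2 * pi * dotp t b : R).
  apply: measurable_funM => //; apply: measurable_sum => i; apply: measurable_funM => //.
  by apply: (@continuous_measurable R 'rV[R]_d); exact: coord_continuous.
have Uw : dot (U t w) w = (nrm w ^+ 2)%:C%C * z.
  have sm A : measurable A -> spectral_measure E w A = (nrm w ^+ 2 * (a \in A)%:R)%:E.
    by move=> mA; rewrite /spectral_measure pvm_dot//= pvm_point.
  rewrite resolution; apply: complex_ext; rewrite ?(cReM, cImM) /= ?mul0r ?subr0 ?addr0.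
  - apply: (integral_point_mass (f := fun b : Rd => cos (2 * pi * dotp t b)) (sqr_ge0 _) _ sm).
    exact: (measurableT_comp (continuous_measurable_fun (@continuous_cos R)) mdot).
  - apply: (integral_point_mass (f := fun b : Rd => sin (2 * pi * dotp t b)) (sqr_ge0 _) _ sm).
    exact: (measurableT_comp (continuous_measurable_fun (@continuous_sin R)) mdot).
have nz : nrm (z *: w) = nrm w by rewrite (nrmZ ip) zz mul1r.
apply: (cauchy_schwarz_eq ip); first by rewrite nz /nrm U_dot.
rewrite nz /rdot (dotZr ip) Uw mulrCA [z^* * z]mulrC.
have -> : z * z^* = 1 by rewrite -[LHS]sqr_normc zz expr1n.
by rewrite mulr1.
Qed.

(** The complement of the support is a countable union of null rational
    balls. *)
Lemma pvm_support_null : exists N : set Rd,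
  [/\ measurable N, ~` N `<=` spectral_support E & forall u, E N u = 0].
Proof.
pose good p := `[< forall u, E (rat_ball p) u = 0 >].
pose B p : set Rd := if good p then rat_ball p else set0.
have mrat p : measurable (rat_ball p : set Rd) by apply: sub_sigma_algebra; exact: ball_open.
have mB p : measurable (B p) by rewrite /B; case: ifP.
pose V n : set Rd := oapp B set0 (unpickle n).
have mV n : measurable (V n) by rewrite /V; case: (unpickle n) => [p|] /=; [exact: mB|exact: measurable0].
exists (\bigcup_n V n); split.
- exact: bigcup_measurable.
- move=> a aN W [oW Wa]; apply: contrapT => h.
  have W0 u : E W u = 0 by apply: contrapT => /eqP Wu; apply: h; exists u.
  have /nbhs_ballP[e /= e0 he] := open_nbhs_nbhs (conj oW Wa).
  have [p [pa pe]] := rat_ballP a e0.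
  apply: aN; exists (pickle p) => //; rewrite /V pickleK /= /B.
  have -> : good p.
    apply/asboolP => u; apply: (pvm_null_sub (mrat p) _ _ (W0 u)).
      exact: sub_sigma_algebra.
    by move=> b /pe; exact: he.
  exact: pa.
- move=> u; apply: pvm_null_bigcup => // n; rewrite /V; case: (unpickle n) => [p|] /=.
    by rewrite /B; case: ifPn => [/asboolP|_]; [exact|rewrite pvm_set0].
  exact: pvm_set0.
Qed.

(** By countable additivity, for an enumeration of the part of the support
    outside a null set. *)
Lemma pvm_countable_support u (e : R) : countable (spectral_support E) -> 0 < e ->
  exists2 s : seq 'rV[R]_d, {in s, forall a, spectral_support E a} &
    nrm (u - \sum_(a <- s) E [set a] u) < e.
Proof.
move=> cS e0; have [N [mN NS N0]] := pvm_support_null.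
pose C := ~` N; have mC : measurable (C : set Rd) by exact: measurableC.
have cC : countable C by apply: sub_countable cS; exact: subset_card_le.
have /countable_injP[f finj] := cC.
pose F k : set Rd := [set a | C a /\ f a = k].
have hF k : F k = set0 \/ exists2 a, C a & F k = [set a].
  have [[a [Ca fa]]|h] := pselect (exists a, F k a); [right|left].
    exists a => //; apply/seteqP; split=> [b [Cb fb]|b ->//].
    by apply: finj; rewrite ?inE// fa.
  by apply/seteqP; split=> // a Fa; apply: h; exists a.
have mF k : measurable (F k).
  by case: (hF k) => [->|[a _ ->]]; [exact: measurable0|exact: measurable_set1_rV].
have tF : trivIset setT F by move=> i j _ _ [a [[_ <-] [_ <-]]].
have FC : \bigcup_n F n = C.
  by apply/seteqP; split=> [a [k _ []//]|a Ca]; exists (f a).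
have ECu : E C u = u.
  have h : nrm (E C u) ^+ 2 = nrm u ^+ 2.
    by rewrite -(pvm_nrmC u mN) N0 (nrm0 ip) expr0n /= add0r.
  apply: (cauchy_schwarz_eq ip); last by rewrite pvm_rdot.
  by rewrite -ler_sqr ?nnegrE ?nrm_ge0// h.
have := @E_sigma F u mF tF; rewrite FC ECu => /(cvg0_ltP (fun n => nrm_ge0 _ _)) h.
have [n _ /(_ n (leqnn n)) /= hn] := h e e0.
suff [s sS sE] : exists2 s : seq 'rV[R]_d, {in s, forall a, spectral_support E a} &
    \sum_(a <- s) E [set a] u = \sum_(0 <= k < n) E (F k) u.
  by exists s => //; rewrite sE (nrmBC ip).
elim: n {hn} => [|n [s sS sE]]; first by exists [::]; rewrite ?big_nil ?big_geq.
rewrite big_nat_recr//= -sE; case: (hF n) => [->|[a Ca ->]].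
  by exists s; rewrite // pvm_set0 addr0.
exists (a :: s); last by rewrite big_cons addrC.
by move=> b; rewrite inE => /predU1P[->|/sS//]; exact: NS.
Qed.

End spectral_resolution.

(** * Eigenvectors of the heat semigroup and of its generator *)

Lemma has_dim1 (K : fieldType) (V : lmodType K) (W : set V) (e : V) : e != 0 ->
  (forall u, W u <-> exists c, u = c *: e) -> has_dim W 1.
Proof.
move=> e0 We; exists (fun=> e); split.
- by move=> _; apply/We; exists 1; rewrite scale1r.
- move=> c; rewrite big_ord1 => /eqP; rewrite scaler_eq0 (negbTE e0) orbF => /eqP c0 i.
  by rewrite ord1.
- by move=> w /We[c ->]; exists (fun=> c); rewrite big_ord1.
Qed.

Section heat_flow.
Context {R : realType} {d : nat} {L0 : delone R d}.
Local Notation Om := (pattern_space L0).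
Local Notation Omega := (borel (pattern_space L0)).
Local Notation tup := (d.-tuple (measurableTypeR R)).
Local Notation nu := (@lebesgue_tuple R d).
Variable mu : probability Omega R.
Hypothesis mu_ue : uniquely_ergodic mu.
Local Notation H := (L2 mu).
Local Notation dot := (@L2dot _ _ _ mu).
Local Notation ip := (L2_inner mu).
Local Notation rip := (rdot dot).
Local Notation nrm := (nrm dot).
Local Notation U := (koopman mu).
Variable P : R -> H -> H.
Hypothesis P_heat : heat_semigroup P.

Let mu_inv : flow_invariant mu. Proof. exact: mu_ue.1. Qed.

Let P_linear t : 0 < t -> linear (P t).
Proof. by move=> t0; have [h _ _] := P_heat.1; have [] := h t t0. Qed.
Let P_contr t u : 0 < t -> nrm (P t u) <= nrm u.
Proof. by move=> t0; have [h _ _] := P_heat.1; have [_ h2 _] := h t t0; exact: h2. Qed.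
Let P_sa t u v : 0 < t -> dot (P t u) v = dot u (P t v).
Proof. by move=> t0; have [h _ _] := P_heat.1; have [_ _ h2] := h t t0; exact: h2. Qed.
Let P_add s t u : 0 < s -> 0 < t -> P (s + t) u = P s (P t u).
Proof. by move=> s0 t0; have [_ h _] := P_heat.1; exact: h. Qed.
Let P_cvg u : nrm (P t u - u) @[t --> 0^'+] --> (0 : R).
Proof. by have [_ _ h] := P_heat.1; exact: h. Qed.
Let PB t u v : 0 < t -> P t (u - v) = P t u - P t v.
Proof. by move=> t0; rewrite addrC -scaleN1r P_linear// scaleN1r addrC. Qed.
Let PZ t a u : 0 < t -> P t (a *: u) = a *: P t u.
Proof.
move=> t0; have P0 : P t 0 = 0 by rewrite -[X in P t X](subrr 0) PB// subrr.
by rewrite -[a *: u]addr0 P_linear// P0 addr0.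
Qed.
Let weak t u v : 0 < t -> rip (P t u) v =
  \int[nu]_s (gauss_kernel t (tuple_rV s) * rip (U (tuple_rV s) u) v).
Proof. by move=> t0; have [_] := heat_weak_formula mu_inv P_heat t0 u v. Qed.

(** The nonnegative |u|^2 - Re <U_s u, u> has Gaussian mean
    |u|^2 - Re <P_t u, u> = 0, so it vanishes for almost every s, where
    U_s u = u by Cauchy-Schwarz. Strong continuity extends this to every s. *)
Lemma heat_fixed_koopman_fixed t u : 0 < t -> P t u = u -> forall s, U s u = u.
Proof.
move=> t0 Pu.
have i1 := heat_weak_integrable mu_inv t0 (heat_weak_formula mu_inv P_heat t0 u u).
have iK : nu.-integrable setT (EFin \o (fun s : tup => gauss_kernel t (tuple_rV s) * (nrm u ^+ 2))).
  apply: (gauss_bounded_integrable t0 (M := nrm u ^+ 2)).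
    by apply: measurable_funM => //; exact: measurable_gauss_kernel.
  by move=> s; rewrite ger0_norm ?sqr_ge0.
pose h (s : tup) := gauss_kernel t (tuple_rV s) * (nrm u ^+ 2) -
  gauss_kernel t (tuple_rV s) * rip (U (tuple_rV s) u) u.
have h_ge0 s : 0 <= h s.
  rewrite /h -mulrBr mulr_ge0 ?gauss_kernel_ge0// subr_ge0.
  by rewrite (le_trans (ler_norm _))// (le_trans (koopman_rdot_le mu_inv _ _ _))// expr2.
have ih : nu.-integrable setT (EFin \o h) by exact: integrableB_EFin.
have h0 : \int[nu]_s h s = 0.
  rewrite RintegralB// -weak// Pu -(nrm_sqr ip).
  have e1 : \int[nu]_s gauss_kernel t (tuple_rV s) = 1.
    by rewrite /Rintegral integral_gauss_kernel.
  rewrite RintegralZr// ?e1 ?mul1r ?subrr//.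
  exact: gauss_kernel_integrable.
have aeU : \forall s \ae nu, U (tuple_rV s) u = u.
  have : (\int[nu]_s `|(EFin \o h) s| = 0)%E.
    rewrite -[LHS]fineK; last exact: (integrable_fin_num measurableT (integrable_abse ih)).
    congr EFin; rewrite -[RHS]h0; congr fine; apply: eq_integral => s _ /=.
    by rewrite ger0_norm.
  move=> /(ae_eq_integral_abs _ measurableT (measurable_int _ ih)).
  apply: ae_mono => s /(_ I) [] /eqP; rewrite /h -mulrBr mulf_eq0 gt_eqF ?gauss_kernel_gt0//=.
  rewrite subr_eq0 => /eqP hs; apply: (cauchy_schwarz_eq ip) => //.
  by rewrite koopman_nrm.
move=> s0.
have /choice[s_ hs] (n : nat) : exists s, U s u = u /\ ball s0 n.+1%:R^-1 s.
  have n0 : 0 < n.+1%:R^-1 :> R by rewrite invr_gt0.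
  by have [x Ux bx] := ae_lebesgue_tuple_near s0 n0 aeU; exists (tuple_rV x).
have ss : s_ n @[n --> \oo] --> s0.
  apply/cvg_ballP => e e0; have := @cvg_harmonic R => /cvgrPdist_lt/(_ e e0)[N _ hN].
  exists N => // n /hN /=; rewrite sub0r normrN ger0_norm// => hn.
  by apply: le_ball (hs n).2; exact: ltW.
have := koopman_cvg mu_inv u ss.
under eq_fun do rewrite (hs _).1.
move=> /(cvg_unique (@Rhausdorff R) (cvg_cst _)) /(nrm_eq0 ip) /eqP.
by rewrite subr_eq0 => /eqP.
Qed.

Lemma koopman_fixed_heat_fixed t u : 0 < t -> (forall s, U s u = u) -> P t u = u.
Proof.
move=> t0 Uu; apply: (rdot_ext ip) => v; rewrite weak//.
under eq_Rintegral do rewrite Uu.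
rewrite RintegralZr//; last exact: gauss_kernel_integrable.
by rewrite /Rintegral integral_gauss_kernel// mul1r.
Qed.

Lemma koopman_rdotN s u v : rip (U s u) v = rip u (U (- s) v).
Proof.
rewrite /rdot -(koopman_dot mu_inv (- s) (U s u)) koopmanD// addNr koopman0//.
Qed.

Lemma heat_koopman_comm t s u : 0 < t -> P t (U s u) = U s (P t u).
Proof.
move=> t0; apply: (rdot_ext ip) => v.
rewrite (weak (U s u) v t0) (koopman_rdotN s (P t u) v) (weak u _ t0).
apply: eq_Rintegral => r _; congr (_ * _).
rewrite -(koopman_rdotN s (U (tuple_rV r) u) v).
by rewrite (koopmanD mu_inv) (koopmanD mu_inv) addrC.
Qed.

(** A vector orthogonal to w is orthogonal to all its translates, so P_t w
    has no component off the line of w. The eigenvalue is real because P_t is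
    self-adjoint. *)
Lemma koopman_eigenvector_heat a w : w != 0 -> koopman_eigenspace mu a w ->
  exists lam : R -> R, forall t, 0 < t -> P t w = (lam t)%:C%C *: w.
Proof.
move=> w0 hw; have nw := nrm_gt0 ip w0; have nw2 : 0 < nrm w ^+ 2 by rewrite exprn_gt0.
exists (fun t => rip (P t w) w / nrm w ^+ 2) => t t0.
set lam := _ / _.
have Pww : dot (P t w) w = (rip (P t w) w)%:C%C.
  apply: complex_ext => //=.
  have : complex.Im (dot (P t w) w) = - complex.Im (dot (P t w) w).
    by rewrite {1}P_sa// (dotJ ip) cImJ.
  have self_opp (x : R) : x = - x -> x = 0 by move=> ?; lra.
  exact: self_opp.
pose z := P t w - lam%:C%C *: w.
have zw : dot z w = 0.
  rewrite (dotBl ip) (dotZl ip) (dot_nrm ip) Pww -rmorphM /lam divfK ?gt_eqF//.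
  by rewrite subrr.
have wz : dot w z = 0 by rewrite (dotJ ip) zw rmorph0.
apply/eqP; rewrite -subr_eq0 -/z; apply/eqP/(nrm_eq0 ip)/eqP.
rewrite -sqrf_eq0 (nrm_sqr ip) {1}/z (rdotBl ip) (rdotZl ip) {2}/rdot wz mulr0 subr0 weak//.
apply/eqP; rewrite (eq_Rintegral _ (g := cst 0)).
  by rewrite /Rintegral integral0.
by move=> s _; rewrite hw /rdot (dotZl ip) wz !mulr0.
Qed.

(** The eigenvalues of P_t form a semigroup in t, hence are expR (l * t), and
    l is their derivative at 0. *)
Lemma koopman_eigenvector_generator a w : w != 0 -> koopman_eigenspace mu a w ->
  exists l : R, generator P w (l%:C%C *: w).
Proof.
move=> w0 hw; have nw := nrm_gt0 ip w0.
have [lam hlam] := koopman_eigenvector_heat w0 hw.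
have inj x y : x%:C%C *: w = y%:C%C *: w -> x = y :> R.
  move=> /eqP; rewrite -subr_eq0 -scalerBl scaler_eq0 (negbTE w0) orbF -rmorphB.
  by rewrite fmorph_eq0 subr_eq0 => /eqP.
have nrmZw (x : R) : nrm (x%:C%C *: w) = `|x| * nrm w by rewrite (nrmZr ip).
have [l hl] : exists l, forall t, 0 < t -> lam t = expR (l * t).
  apply: scalar_semigroup.
  - move=> s t s0 t0; apply: inj; rewrite -hlam ?addr_gt0// P_add// hlam// PZ// hlam//.
    by rewrite scalerA -rmorphM mulrC.
  - move=> t t0; have := P_contr w t0; rewrite hlam// nrmZw ger_pMl//.
    by apply: le_trans; exact: ler_norm.
  - apply/cvgrPdist_lt => e e0.
    have /(cvg0_ltP (fun n => nrm_ge0 _ _))/(_ _ (mulr_gt0 e0 nw)) := P_cvg w.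
    move=> hF; near=> t.
    have t0 : 0 < t by [].
    have : nrm (P t w - w) < e * nrm w by near: t; exact: hF.
    rewrite hlam// -{2}[w]scale1r -(rmorph1 (real_complex R)) -scalerBl -rmorphB nrmZw.
    by rewrite ltr_pM2r// distrC.
exists l; rewrite /generator.
apply/cvg0_ltP => [t|e e0]; first exact: nrm_ge0.
have := @expR_right_derivative R l => /cvgrPdist_lt/(_ _ (divr_gt0 e0 nw)) hF.
near=> t; have t0 : 0 < t by [].
have : `|l - (expR (l * t) - 1) / t| < e / nrm w by near: t; exact: hF.
rewrite hlam// hl//.
have -> : (t^-1)%:C%C *: ((expR (l * t))%:C%C *: w - w) - l%:C%C *: w =
    ((expR (l * t) - 1) / t - l)%:C%C *: w.
  by rewrite -{2}[w]scale1r -(rmorph1 (real_complex R)) -scalerBl -rmorphB scalerA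
     -rmorphM -scalerBl -rmorphB [t^-1 * _]mulrC.
by rewrite -[L2norm _]/(nrm _) nrmZw distrC ltr_pdivlMr.
Unshelve. all: by end_near. Qed.

(** Subdividing [0, t] into n steps bounds P_t u - u by n times the
    increment over one step, which is o(1/n) when the derivative vanishes. *)
Lemma generator_zero_fixed t u : generator P u 0 -> 0 < t -> P t u = u.
Proof.
move=> gu t0; apply/eqP; rewrite -subr_eq0; apply/eqP/(nrm_eq0 ip)/eqP.
rewrite -normr_le0 ger0_norm ?nrm_ge0//; apply/ler_addgt0Pl => e e0; rewrite addr0.
have /(cvg0_ltP (fun n => nrm_ge0 _ _))/(_ _ (divr_gt0 e0 t0)) [b /= b0 hb] := gu.
pose n := Num.bound (t / b).
have n0 : 0 < n.+1%:R :> R by [].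
pose h := t / n.+1%:R; have h0 : 0 < h by rewrite divr_gt0.
have hb' : h < b.
  rewrite /h ltr_pdivrMr// mulrC -ltr_pdivrMr//.
  apply: (lt_le_trans (archi_boundP _)); first by rewrite divr_ge0 ?(ltW t0) ?(ltW b0).
  by rewrite ler_nat.
have step k : nrm (P (k.+1%:R * h) u - u) <= k.+1%:R * nrm (P h u - u).
  elim: k => [|k ih]; first by rewrite !mul1r.
  have kh0 : 0 < k.+1%:R * h by rewrite mulr_gt0.
  rewrite -[k.+2]addn1 natrD !mulrDl !mul1r P_add//.
  apply: (le_trans (nrmB_le ip (P (k.+1%:R * h) u) _ _)).
  by rewrite -PB// addrC lerD// P_contr.
have tE : n.+1%:R * h = t by rewrite /h mulrC divfK ?gt_eqF.
rewrite -tE; apply: (le_trans (step n)).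
have := hb h; rewrite /= sub0r normrN ger0_norm ?(ltW h0)// => /(_ hb' h0).
rewrite subr0 (nrmZr ip) ger0_norm ?invr_ge0 ?(ltW h0)//.
rewrite mulrC ltr_pdivrMr// => hlt.
apply: (le_trans (ler_wpM2l (ltW n0) (ltW hlt))).
by rewrite mulrCA tE divfK ?gt_eqF.
Qed.

Lemma heat_fixed_generator_zero u : (forall t, 0 < t -> P t u = u) -> generator P u 0.
Proof.
move=> Pu; apply/cvg0_ltP => [t|e e0]; first exact: nrm_ge0.
near=> t; have t0 : 0 < t by [].
by rewrite Pu// subrr scaler0 subr0 -[L2norm _]/(nrm _) (nrm0 ip).
Unshelve. all: by end_near. Qed.

Lemma generator_unique u v w : generator P u v -> generator P u w -> v = w.
Proof.
move=> hv hw; apply/eqP; rewrite -subr_eq0; apply/eqP/(nrm_eq0 ip)/eqP.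
rewrite -normr_le0 ger0_norm ?nrm_ge0//; apply/ler_addgt0Pl => e e0; rewrite addr0.
have e20 : 0 < e / 2 by rewrite divr_gt0.
have hv' := (cvg0_ltP (fun n => nrm_ge0 _ _)).1 hv _ e20.
have hw' := (cvg0_ltP (fun n => nrm_ge0 _ _)).1 hw _ e20.
near (0 : R)^'+ => t.
have h1 : nrm ((t^-1)%:C%C *: (P t u - u) - v) < e / 2 by near: t; exact: hv'.
have h2 : nrm ((t^-1)%:C%C *: (P t u - u) - w) < e / 2 by near: t; exact: hw'.
apply: (le_trans (nrmB_le ip ((t^-1)%:C%C *: (P t u - u)) _ _)).
by rewrite (nrmBC ip v) [e]splitr ltW// ltrD.
Unshelve. all: by end_near. Qed.

Lemma generator_lin a u v u' v' : generator P u u' -> generator P v v' ->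
  generator P (a *: u + v) (a *: u' + v').
Proof.
move=> hu hv.
apply: (@squeeze_cvgr _ _ _ _ (cst 0) (fun t : R => complex.Re `|a| *
   nrm ((t^-1)%:C%C *: (P t u - u) - u') + nrm ((t^-1)%:C%C *: (P t v - v) - v'))).
- near=> t; rewrite -[L2norm _]/(nrm _) nrm_ge0 /= P_linear// opprD addrACA -scalerBr.
  rewrite scalerDr opprD addrACA scalerA mulrC -scalerA -scalerBr.
  by rewrite (le_trans (nrmD ip _ _))// (nrmZ ip).
- exact: cvg_cst.
- rewrite -[X in _ --> X]addr0 -[X in _ --> X + _](mulr0 (complex.Re `|a|)).
  apply: cvgD; last exact: hv.
  by apply: cvgMr; exact: hu.
Unshelve. all: by end_near. Qed.

Lemma generator_eigenspace_submod l : submod_set (op_eigenspace (generator P) l).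
Proof.
split=> [|a u v hu hv].
  rewrite /op_eigenspace /= scaler0; apply: heat_fixed_generator_zero => t t0.
  by rewrite -[X in P t X](subrr 0) PB// subrr.
rewrite /op_eigenspace /= scalerDr scalerA mulrC -scalerA.
exact: generator_lin.
Qed.

Lemma generator_koopman u v s : generator P u v -> generator P (U s u) (U s v).
Proof.
move=> gu; apply/cvg0_ltP => [t|e e0]; first exact: nrm_ge0.
have hF := (cvg0_ltP (fun n => nrm_ge0 _ _)).1 gu _ e0.
near=> t; have t0 : 0 < t by [].
have : nrm ((t^-1)%:C%C *: (P t u - u) - v) < e by near: t; exact: hF.
rewrite -(koopman_nrm mu_inv s) koopmanB//.
rewrite -[X in U s X - _]addr0 koopman_linear// koopman_zero// addr0.
by rewrite koopmanB// -heat_koopman_comm.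
Unshelve. all: by end_near. Qed.

End heat_flow.

Section heat_eigenvalues.
Context {R : realType} {d : nat} {L0 : delone R d}.
Local Notation Omega := (borel (pattern_space L0)).
Variable mu : probability Omega R.
Hypothesis mu_ue : uniquely_ergodic mu.
Local Notation H := (L2 mu).
Local Notation dot := (@L2dot _ _ _ mu).
Local Notation ip := (L2_inner mu).
Local Notation nrm := (nrm dot).
Local Notation U := (koopman mu).
Local Notation one := (L2class mu (fun=> 1)).
Variable P : R -> H -> H.
Hypothesis P_heat : heat_semigroup P.

Let mu_inv : flow_invariant mu. Proof. exact: mu_ue.1. Qed.

Lemma constant_rclass : one = rclass mu (cst 1).
Proof. by congr (L2class mu _); apply/funext => x; rewrite rmorph1. Qed.

Lemma constant_neq0 : one != 0.
Proof.
have c2 : (cst 1 : Omega -> R) \in Lfun mu 2%:E by exact: Lfun_cst.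
apply/eqP => one0; have := nrm_rclass c2; rewrite -constant_rclass one0 (nrm0 ip).
have -> : (fun x => cst 1 x ^+ 2) = cst 1 :> (Omega -> R) by apply/funext => x; rewrite /= expr1n.
rewrite Rintegral_cst//= probability_setT /= mul1r expr0n /= => /eqP.
by rewrite eq_sym oner_eq0.
Qed.

Lemma koopman_constant s : U s one = one.
Proof.
have c2 : (cst 1 : Omega -> R) \in Lfun mu 2%:E by exact: Lfun_cst.
by rewrite constant_rclass koopman_rclass.
Qed.

Lemma koopman_fixed_constants u : (forall s, U s u = u) <-> exists c, u = c *: one.
Proof.
split=> [|[c ->] s]; first exact: koopman_invariant_constant.
rewrite -[c *: _]addr0 (koopman_linear mu_inv) (koopman_zero mu_inv).
by rewrite koopman_constant.
Qed.

Lemma heat_fixed_constants t u : 0 < t -> P t u = u <-> exists c, u = c *: one.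
Proof.
move=> t0; rewrite -koopman_fixed_constants; split=> h.
  exact: (heat_fixed_koopman_fixed mu_ue P_heat t0 h).
exact: (koopman_fixed_heat_fixed mu_ue P_heat t0 h).
Qed.

Lemma generator_kernel u : generator P u 0 <-> exists c, u = c *: one.
Proof.
split=> [gu|hu]; first by apply/(heat_fixed_constants _ (@ltr01 R)); exact: (generator_zero_fixed P_heat gu ltr01).
by apply: (@heat_fixed_generator_zero _ _ _ mu) => t t0; apply/heat_fixed_constants.
Qed.

(** The Koopman operators commute with the generator and so act on a finite
    dimensional eigenspace of it, where they have a common eigenvector; its
    eigenvalues form a character of the translation group. *)
Lemma generator_finite_eigenspace l : op_eigenvalue (generator P) l ->
  finite_dim (op_eigenspace (generator P) l) ->
  exists a w, [/\ w != 0, koopman_eigenspace mu a w & generator P w (l *: w)].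
Proof.
move=> ev fd; have [W0 Wl] := generator_eigenspace_submod P_heat l.
have [|||w [w0 Ww] hw] := common_eigenvector_of_family (I := 'rV[R]_d) (U := U) fd ev _ Wl W0.
- by move=> s; exact: (koopman_linear mu_inv).
- move=> s u hu; have := generator_koopman mu_ue P_heat s hu.
  by rewrite -[l *: u]addr0 (koopman_linear mu_inv) (koopman_zero mu_inv) addr0.
- by move=> s t u; rewrite !(koopmanD mu_inv) addrC.
have [chi hchi] := choice hw.
have inj x y : x *: w = y *: w -> x = y.
  by move=> /eqP; rewrite -subr_eq0 -scalerBl scaler_eq0 (negbTE w0) orbF subr_eq0 => /eqP.
have nw : 0 < nrm w := nrm_gt0 ip w0.
have nw2 : nrm w ^+ 2 != 0 by rewrite gt_eqF// exprn_gt0.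
have UZ s c u : U s (c *: u) = c *: U s u.
  by rewrite -[c *: u]addr0 (koopman_linear mu_inv) (koopman_zero mu_inv) addr0.
have [s t|s|s_ s ss|a ha] := @character_rV R d chi.
- by apply: inj; rewrite -hchi -(koopmanD mu_inv) hchi UZ hchi scalerA mulrC.
- have : complex.Re `|chi s| = 1.
    apply: (mulIf (lt0r_neq0 nw)); rewrite mul1r -(nrmZ ip) -hchi.
    exact: (koopman_nrm mu_inv).
  rewrite normcRe /= => /(congr1 (fun x => x ^+ 2)).
  by rewrite expr1n sqr_sqrtr// addr_ge0 ?sqr_ge0.
- have h := koopman_cvg mu_inv w ss.
  have eRe r : complex.Re (chi r) = rdot dot (U r w) w / nrm w ^+ 2.
    rewrite hchi /rdot (dotZl ip) (dot_nrm ip) cReM /= mulr0 subr0.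
    by rewrite mulfK.
  have eIm r : complex.Im (chi r) = rdot dot (U r w) ('i%C *: w) / nrm w ^+ 2.
    have := congr1 (@complex.Im R) (dot_rdot ip (U r w) w).
    rewrite {1}hchi (dotZl ip) (dot_nrm ip) cImM /= mulr0 add0r => <-.
    by rewrite mulfK.
  split.
    rewrite eRe; under eq_fun do rewrite eRe.
    by apply: cvgM; [exact: (rdot_cvg ip h)|exact: cvg_cst].
  rewrite eIm; under eq_fun do rewrite eIm.
  by apply: cvgM; [exact: (rdot_cvg ip h)|exact: cvg_cst].
by exists a, w; split=> // s; rewrite hchi ha.
Qed.

(** A common eigenvector of the Koopman operators then has eigenvalue 0, so it
    is invariant and lies in the kernel of the generator. *)
Lemma generator_no_finite_eigenvalue l :
  (forall a : 'rV[R]_d, a != 0 -> ~ koopman_eigenvalue mu a) -> l != 0 ->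
  ~ (op_eigenvalue (generator P) l /\ finite_dim (op_eigenspace (generator P) l)).
Proof.
move=> hU l0 [ev fd]; have [a [w [w0 wa wl]]] := generator_finite_eigenspace ev fd.
have a0 : a = 0 by apply: contrapT => /eqP /hU; apply; exists w.
have Uw s : U s w = w.
  by rewrite wa a0 /dotp big1 ?mulr0 ?expi0 ?scale1r// => i _; rewrite mxE mulr0.
have /generator_kernel wk := (koopman_fixed_constants w).1 Uw.
have /eqP := generator_unique wk wl; rewrite eq_sym scaler_eq0.
by rewrite (negbTE l0) (negbTE w0).
Qed.

End heat_eigenvalues.

(** * A basis of Koopman eigenvectors *)

Section koopman_eigenbasis.
Context {R : realType} {d : nat} {L0 : delone R d}.
Local Notation Omega := (borel (pattern_space L0)).
Local Notation Rd := (borel 'rV[R]_d).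
Variable mu : probability Omega R.
Hypothesis mu_inv : flow_invariant mu.
Local Notation H := (L2 mu).
Local Notation dot := (@L2dot _ _ _ mu).
Local Notation ip := (L2_inner mu).
Local Notation nrm := (nrm dot).
Local Notation U := (koopman mu).

(** The eigenvalues of U_t at a and b differ for t = (a - b) / 2 |a - b|^2,
    as their quotient is then expi pi = -1. *)
Lemma koopman_eigenspace_orthogonal a b u v : a != b ->
  koopman_eigenspace mu a u -> koopman_eigenspace mu b v -> dot u v = 0.
Proof.
move=> ab ha hb; pose q := dotp (a - b) (a - b).
have q0 : q != 0.
  apply: contra ab => /eqP q0; rewrite -subr_eq0; apply/eqP/enorm_eq0.
  by rewrite /enorm -/q q0 sqrtr0.
pose t := (2 * q)^-1 *: (a - b).
have hx : 2 * pi * dotp t a - 2 * pi * dotp t b = pi.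
  rewrite -mulrBr.
  have -> : dotp t a - dotp t b = (2 * q)^-1 * q.
    rewrite /t; move: _^-1 => c.
    by rewrite /q /dotp -sumrB mulr_sumr; apply: eq_bigr => i _; rewrite !mxE; ring.
  by field.
set x := 2 * pi * dotp t a in hx; set y := 2 * pi * dotp t b in hx.
have cexp z : (expi z)^* = expi (- z) :> R[i].
  by apply: complex_ext; rewrite ?(cReJ, cImJ) /= ?cosN ?sinN.
have := koopman_dot mu_inv t u v.
rewrite ha hb (dotZl ip) (dotZr ip) cexp mulrA -expiD -/x -/y hx => h.
have em1 : expi pi = -1 :> R[i].
  by apply: complex_ext; rewrite /= ?cospi ?sinpi ?oppr0.
have : 2 * dot u v = 0.
  by rewrite mulr2n mulrDl mul1r -{1}h em1 mulN1r addNr.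
by move/eqP; rewrite mulf_eq0 pnatr_eq0 /= => /eqP.
Qed.

Lemma koopman_eigenspace_submod a : submod_set (koopman_eigenspace mu a).
Proof.
split=> [t|c u v hu hv t]; first by rewrite koopman_zero// scaler0.
by rewrite (koopman_linear mu_inv) hu hv scalerDr !scalerA mulrC.
Qed.

(** Unit eigenvectors, one for each eigenvalue, are orthonormal in a separable
    space. *)
Lemma koopman_eigenvalues_countable (S : set 'rV[R]_d) :
  (forall a, S a -> koopman_eigenvalue mu a) -> countable S.
Proof.
move=> hS; have [C [cC total]] := countable_total mu.
have unit a : exists e, S a -> koopman_eigenspace mu a e /\ dot e e = 1.
  have [/hS[u u0 hu]|] := pselect (S a); last by exists 0.
  have nu := nrm_gt0 ip u0; have [W0 Wl] := koopman_eigenspace_submod a.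
  exists ((nrm u)^-1%:C%C *: u) => _; split.
    by rewrite -[_ *: u]addr0; exact: Wl.
  by rewrite (dot_nrm ip) (nrmZr ip) ger0_norm ?invr_ge0 ?(ltW nu)// mulVf ?gt_eqF// expr1n.
have [e he] := choice unit.
apply: (countable_orthonormal ip (e := e) cC total) => a b Sa Sb.
have [<-|ab] := eqVneq a b; first by have [] := he a Sa.
by apply: (koopman_eigenspace_orthogonal ab); [have [] := he a Sa|have [] := he b Sb].
Qed.

(** The union of orthonormal bases of the eigenspaces over the points of the
    spectrum. It is total because u is approximated by finite sums of
    E {a} u, each of which lies in the eigenspace of a. *)
Lemma koopman_eigenbasis (E : set Rd -> H -> H) : is_spectral_resolution E U ->
  (forall a, spectral_support E a ->
    koopman_eigenvalue mu a /\ finite_dim (koopman_eigenspace mu a)) ->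
  exists B : set H, [/\ Defs.orthonormal B, dense_span B &
    forall u, B u -> u != 0 /\ exists a, koopman_eigenspace mu a u].
Proof.
move=> [pvm res] hE.
have cS : countable (spectral_support E).
  by apply: koopman_eigenvalues_countable => a /hE[].
have basis a : exists s : seq H, spectral_support E a ->
    [/\ orthonormal_seq dot s, {in s, forall u, koopman_eigenspace mu a u} &
    forall u, koopman_eigenspace mu a u -> u = \sum_(e <- s) dot u e *: e].
  have [/hE[_ fd]|] := pselect (spectral_support E a); last by exists [::].
  by have [s hs] := finite_dim_orthonormal ip (koopman_eigenspace_submod a) fd; exists s.
have [s hs] := choice basis.
exists [set u | exists2 a, spectral_support E a & u \in s a]; split.
- move=> u v [a Sa ua] [b Sb vb].
  have [[_ on] sa _] := hs a Sa; have [_ sb _] := hs b Sb.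
  have [ab|ab] := eqVneq a b; first by apply: on; rewrite // ab.
  rewrite (koopman_eigenspace_orthogonal ab (sa u ua) (sb v vb)).
  case: eqP => // uv; have := on u u ua ua.
  rewrite {2}uv (koopman_eigenspace_orthogonal ab (sa u ua) (sb v vb)) eqxx.
  by move=> /eqP; rewrite eq_sym oner_eq0.
- move=> u e e0; have [r rS hr] := pvm_countable_support pvm u cS e0.
  suff [z zB zE] : exists2 z : seq (R[i] * H),
      (forall p, p \in z -> exists2 a, spectral_support E a & p.2 \in s a) &
      \sum_(p <- z) p.1 *: p.2 = \sum_(a <- r) E [set a] u.
    by exists z; split=> //; rewrite zE.
  elim: r rS {hr} => [|a r ih] rS; first by exists [::]; rewrite // !big_nil.
  have [|z zB zE] := ih; first by move=> b br; apply: rS; rewrite inE br orbT.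
  have Sa : spectral_support E a by apply: rS; exact: mem_head.
  have [_ _ dec] := hs a Sa.
  have Ea : koopman_eigenspace mu a (E [set a] u).
    by move=> t; exact: (pvm_point_eigenvector pvm (koopman_dot mu_inv) res).
  exists ([seq (dot (E [set a] u) f, f) | f <- s a] ++ z) => [p|].
    rewrite mem_cat => /orP[/mapP[f fs ->]|/zB//].
    by exists a.
  by rewrite big_cat big_map big_cons zE -dec.
- move=> u [a Sa ua]; have [[_ on] sa _] := hs a Sa; split; last by exists a; exact: sa.
  apply/eqP => u0; have := on u u ua ua; rewrite u0 (dot0l ip) eqxx => /eqP.
  by rewrite eq_sym oner_eq0.
Qed.

End koopman_eigenbasis.

(** * Spectra of the heat semigroup and of the Laplacian *)

Theorem corollary3p12 (R : realType) (d : nat) (L0 : delone R d)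
    (L0_aperiodic : aperiodic L0)
    (L0_repetitive : repetitive L0)
    (L0_flc : finite_local_complexity L0)
    (mu : probability (borel (pattern_space L0)) R)
    (mu_ue : uniquely_ergodic mu)
    (P : R -> L2 mu -> L2 mu) (P_heat : heat_semigroup P) :
  [/\ [/\ simple_op_eigenvalue (generator P) 0,
          op_eigenspace (generator P) 0 (L2class mu (fun=> 1)) &
          forall t : R, 0 < t ->
            simple_op_eigenvalue (graph_of (P t)) 1 /\
            op_eigenspace (graph_of (P t)) 1 (L2class mu (fun=> 1))],
      forall E : set (borel 'rV[R]_d) -> L2 mu -> L2 mu,
        is_spectral_resolution E (koopman mu) ->
        (forall a : 'rV[R]_d, spectral_support E a ->
          koopman_eigenvalue mu a /\ finite_dim (koopman_eigenspace mu a)) ->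
        (forall t : R, 0 < t -> pure_point_spectrum (graph_of (P t))) /\
        pure_point_spectrum (generator P) &
      (forall a : 'rV[R]_d, a != 0 -> ~ koopman_eigenvalue mu a) ->
      forall l : R[i], l != 0 ->
        ~ (op_eigenvalue (generator P) l /\
           finite_dim (op_eigenspace (generator P) l))].
Proof.
have mu_inv := mu_ue.1; have one0 := constant_neq0 mu.
have ker := generator_kernel mu_ue P_heat.
have fix_P t u : 0 < t -> P t u = u <-> exists c, u = c *: L2class mu (fun=> 1).
  exact: (heat_fixed_constants mu_ue P_heat).
split; first split.
- by apply: (has_dim1 one0) => u; rewrite /op_eigenspace /= scale0r.
- by rewrite /op_eigenspace /= scale0r; apply/ker; exists 1; rewrite scale1r.
- move=> t t0; split.
    by apply: (has_dim1 one0) => u; rewrite /op_eigenspace /graph_of /= scale1r fix_P.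
  by rewrite /op_eigenspace /graph_of /= scale1r; apply/fix_P => //; exists 1; rewrite scale1r.
- move=> E resE hE.
  have [B [onB spB eigB]] := koopman_eigenbasis mu_inv resE hE.
  split=> [t t0|]; exists B; split=> // u /eigB[u0 [a ha]].
    have [lam hlam] := koopman_eigenvector_heat mu_ue P_heat u0 ha.
    by exists (lam t)%:C%C; exact: hlam.
  have [l hl] := koopman_eigenvector_generator mu_ue P_heat u0 ha.
  by exists l%:C%C.
- by move=> hU l; exact: (generator_no_finite_eigenvalue mu_ue P_heat hU).
Qed.
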